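(* Let $\Omega$ be a domain in $\mathbb{R}^{2}$. (a) Let $\theta\in C^{0}(\Omega)$ and $H\in L^{1}_{loc}(\Omega)$ satisfy $$\int_{\Omega}(\cos\theta,\sin\theta)\cdot\nabla\varphi+\int_{\Omega}H\varphi=0\qquad\text{for all }\varphi\in C_{0}^{\infty}(\Omega).\tag{$*$}$$ Let $p\in\Omega$ and suppose there is $r_{0}>0$ such that $B_{r_{0}}(p)\subset\subset\Omega$ and $$\int_{0}^{r_{0}}H_{M}(r)\,dr<\infty ,\qquad H_{M}(r)\equiv\max_{q\in\partial B_{r}(p)}|H(q)| .$$ Then there is $r_{1}$ with $0<r_{1}\leq r_{0}$ such that there exists a unique seed curve passing through $p$ in $B_{r_{1}}(p)$. (b) Let $\theta\in C^{0}(\Omega)$ and $H\in C^{0,1}(\Omega)$ (Lipschitzian) satisfy $( * )$. Then for any point $p\in\Omega$ there is $r_{1}>0$ such that there exists a unique characteristic curve passing through $p$ in $B_{r_{1}}(p)$.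
   Context: $N\equiv(\cos\theta,\sin\theta)$ and $N^{\perp}\equiv(\sin\theta,-\cos\theta)$ are $C^{0}$ vector fields. Seed curves are the integral curves of $N$; characteristic curves are the integral curves of $N^{\perp}$. $B_{r}(p)$ is the open disc of radius $r$ centred at $p$. Uniqueness in $B_{r_1}(p)$ means that any two such integral curves through $p$ coincide inside $B_{r_{1}}(p)$. *)

(* Defs.v *)
From HB Require Import structures.
From mathcomp Require Import all_boot all_order all_algebra.
From mathcomp Require Import all_classical all_reals all_analysis.

Set Implicit Arguments.
Unset Strict Implicit.
Unset Printing Implicit Defensive.

Import Order.TTheory GRing.Theory Num.Theory.
Import numFieldNormedType.Exports.

Local Open Scope classical_set_scope.
Local Open Scope ring_scope.

(* The library norm on [R * R] is the max norm; discs and circles below are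
   Euclidean. Functions on a domain [W] are represented by total functions
   [R * R -> R] whose values outside [W] are never used. *)

Section plane.
Context {R : realType}.
Implicit Types (p q : R * R) (r : R) (W K : set (R * R)).

Definition edist p q : R := Num.sqrt ((q.1 - p.1) ^+ 2 + (q.2 - p.2) ^+ 2).

Definition disc p r : set (R * R) := [set q | edist p q < r].

Definition circle p r : set (R * R) := [set q | edist p q = r].

Definition domain W := [/\ open W, connected W & W !=set0].

Definition compactly_contained K W := compact (closure K) /\ closure K `<=` W.

Local Notation mu2 := (@lebesgue_measure R \x @lebesgue_measure R)%E.

(* [measurable_fun] is Borel measurability; a Lebesgue measurable function is
   one that is a.e. equal to a Borel function. The library integral of such a
   function, a difference of suprema of integrals of Borel simple functions, is
   its Lebesgue integral. *)
Definition L1loc W (H : R * R -> R) := exists G : R * R -> R,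
  [/\ measurable_fun W G,
      H = G %[ae mu2 in W] &
      forall K, compact K -> K `<=` W -> mu2.-integrable K (EFin \o G)].

Definition d1 (f : R * R -> R) : R * R -> R := fun q => 'D_((1, 0) : R * R) f q.
Definition d2 (f : R * R -> R) : R * R -> R := fun q => 'D_((0, 1) : R * R) f q.

Fixpoint Ck (k : nat) (f : R * R -> R) : Prop :=
  continuous f /\
  if k is k'.+1 then
    [/\ forall q, derivable f q ((1, 0) : R * R) /\
                  derivable f q ((0, 1) : R * R),
        Ck k' (d1 f) & Ck k' (d2 f)]
  else True.

Definition test_function W (f : R * R -> R) :=
  (forall k, Ck k f) /\ compactly_contained [set q | f q != 0] W.

Definition weak_solution W (theta H : R * R -> R) :=
  forall phi, test_function W phi ->
    \int[mu2]_(q in W) (cos (theta q) * d1 phi q + sin (theta q) * d2 phi q)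
    + \int[mu2]_(q in W) (H q * phi q) = 0.

(* H_M; the maximum over the circle is a supremum, possibly +oo. *)
Definition circle_max (H : R * R -> R) p r : \bar R :=
  ereal_sup [set `|H q|%:E | q in circle p r].

Definition Nfield (theta : R * R -> R) q : R * R :=
  (cos (theta q), sin (theta q)).

Definition Nperp (theta : R * R -> R) q : R * R :=
  (sin (theta q), - cos (theta q)).

(* [c] is an integral curve of [X] lying in [W], with time interval [I] open,
   which passes through [p], the parameter being translated so that this
   happens at time 0. *)
Definition integral_curve (X : R * R -> R * R) W p
    (I : set R) (c : R -> R * R) :=
  [/\ open I, is_interval I, I 0, c 0 = p &
      forall t, I t -> W (c t) /\ is_derive t 1 c (X (c t))].

(* Two curves with different time intervals can only be compared on the common
   part; so the unique curve through [p] in [W] is the maximal one, of which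
   every integral curve through [p] in [W] is a restriction. *)
Definition unique_integral_curve (X : R * R -> R * R) W p :=
  exists (I : set R) (c : R -> R * R), integral_curve X W p I c /\
    forall (J : set R) (e : R -> R * R), integral_curve X W p J e ->
      J `<=` I /\ forall t, J t -> e t = c t.

End plane.

(* Main.v *)
Require Import Defs.
From HB Require Import structures.
From mathcomp Require Import all_boot all_order all_algebra.
From mathcomp Require Import all_classical all_reals all_analysis.
From mathcomp Require Import measurable_realfun.
From mathcomp Require Import ring lra.

Set Implicit Arguments.
Unset Strict Implicit.
Unset Printing Implicit Defensive.

Import Order.TTheory GRing.Theory Num.Theory.
Import numFieldNormedType.Exports.

Local Open Scope classical_set_scope.
Local Open Scope ring_scope.

(* Testing the weak equation against cutoffs of rectangles shows that the flux of
   N through the boundary of a rectangle is the integral of H over it. If u is a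
   primitive of cos theta in y and w one of sin theta in x, this flux is the sum
   of the mixed second differences of u and w.

   (a) Near p, two seed curves through p are graphs of functions a and b over one
   of the axes. As seed curves carry no flux, D(x) = u(x, b(x)) - u(x, a(x)) is at
   most the integral of |H| over the region between the graphs, while
   |D| >= |b - a| / 2. That region meets each circle centred at p in a set of
   diameter at most C L, where L = max |b - a|; in polar coordinates this bounds
   |D| by C L times the integral of H_M over (0, r1), and if r1 is small, L = 0.

   (b) Although theta is only continuous, along a characteristic curve c one has
   (cos theta)' = H sin theta and (sin theta)' = - H cos theta. So (c, N(c)) solves
   an ordinary differential equation with Lipschitz right-hand side, and
   Gronwall's inequality gives uniqueness.

   Existence is Peano's theorem. *)

(* [lra] slows down badly with the number of hypotheses, so it is first tried
   with the most recent ones only. *)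
Ltac revert_recent k := lazymatch k with
  | O => idtac
  | S ?k' => match goal with H : is_true _ |- _ => revert H; revert_recent k' | |- _ => idtac end
  end.
Ltac qlra := first [ solve [revert_recent 4%N; clear; lra] | solve [revert_recent 9%N; clear; lra] | lra ].


(** Instead c is compared with its vertical translate by e. Let D(t) be the flux of N through the
    vertical segment of signed height e above c(t). Flux balance shows that D changes at the rate 1
    - N(c).N(c + (0, e)) + e H(c) sin theta(c), up to an error K e^2. The scalar product is at most
    1, so D grows at least at the rate e H sin theta - K e^2, a bound without any modulus of
    continuity of theta. As D = e cos theta + o(e), dividing by e > 0 bounds the increment of cos
    theta from below, dividing by e < 0 bounds it from above, and the error K |e| vanishes with e.

    In (a) [circle_max] need not be measurable, so its integral is a lower integral, and H is
    compared with it through a Borel function f with f <= |H| at every point. The factor L is gained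
    because seed curves through p stay in a narrow cone at p: circles cross the region between the
    graphs transversally, and the 1/r in the length of the slope interval cancels the r of the area
    element. *)

(** Real induction: the supremum of the points where [f] is at most [f a] belongs to that set and
    cannot lie before [b]. It replaces a mean value theorem for quantities whose growth near each
    point is only bounded on one side. *)
Lemma locally_nonincreasing (R : realType) (f : R -> R) (a b : R) : a <= b ->
  (forall x, a <= x <= b -> exists2 d : R, 0 < d &
     forall y, a <= y <= b -> `|y - x| < d ->
       (y <= x -> f x <= f y) /\ (x <= y -> f y <= f x)) ->
  f b <= f a.
Proof.
move=> ab loc.
pose S := [set x | a <= x <= b /\ f x <= f a].
have Sa : S a by rewrite /S/= lexx ab.
have hS : has_sup S by split; [exists a | exists b => x [/andP[_ xb] _]].
have supS x : S x -> x <= sup S by exact: sup_upper_bound.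
have sab : a <= sup S <= b.
  rewrite supS//=; apply: ge_sup; first by exists a.
  by move=> x [/andP[]].
have [d d0 locs] := loc _ sab.
have [y Sy sy] := sup_adherent d0 hS.
have ys := supS _ Sy.
have fs : f (sup S) <= f a.
  have [yab fy] := Sy.
  have yd : `|y - sup S| < d by rewrite ler0_norm; lra.
  by apply: le_trans fy; exact: (proj1 (locs y yab yd)).
have [//|sb] := eqVneq (sup S) b; first by move=> <-.
pose z := Num.min b (sup S + d / 2).
have sz : sup S < z.
  by rewrite lt_min; apply/andP; split; [rewrite lt_neqAle sb; lra|lra].
have zab : a <= z <= b by rewrite ge_min lexx/=; lra.
have zd : z <= sup S + d / 2 by rewrite ge_min lexx orbT.
have zdd : `|z - sup S| < d by rewrite ger0_norm; lra.
have fz := proj2 (locs z zab zdd) (ltW sz).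
have Sz : S z by split => //; apply: le_trans fs.
by have := supS _ Sz; lra.
Qed.

(** First-order expansion without a quotient: it covers [s = t] and vector values, and is the form
    in which derivatives enter the estimates. *)
Lemma is_derive1P (R : realType) (V : normedModType R) (c : R -> V) (t : R) (v : V) :
  is_derive t 1 c v <->
  (forall e : R, 0 < e -> exists2 d : R, 0 < d &
     forall s, `|s - t| < d -> `|c s - c t - (s - t) *: v| <= e * `|s - t|).
Proof.
split.
  move=> [dc <-] e e0.
  have /cvgrPdist_le /(_ _ e0) := dc.
  rewrite /at_right /dnbhs near_withinE => -[/= d d0 H].
  exists d => // s std.
  have [->|st] := eqVneq s t.
    by rewrite !subrr scale0r subr0 !normr0 mulr0.
  have st0 : s - t != 0 by rewrite subr_eq0.
  have := H (s - t); rewrite /ball/= sub0r normrN => /(_ std st0).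
  rewrite /= scaler1 addrC subrK.
  move=> {}H; rewrite -[c s - c t](scalerKV st0) -scalerBr normrZ mulrC.
  rewrite distrC ler_wpM2r//; move: H; rewrite addrC; exact: id.
move=> H.
have : (h^-1 *: ((c \o shift t) (h *: 1) - c t) @[h --> 0^'] --> v).
  apply/cvgrPdist_le => e e0.
  have [d d0 Hd] := H _ e0.
  rewrite /dnbhs near_withinE; exists d => //= h.
  rewrite /ball/= sub0r normrN => hd h0.
  have := Hd (h + t); rewrite addrK => /(_ hd).
  rewrite /GRing.scale/= mulr1 /shift/= => {}Hd.
  rewrite -[v](scalerK h0) -scalerBr normrZ normfV distrC.
  by rewrite mulrC ler_pdivrMr// normr_gt0.
move=> cv; apply: DeriveDef; last exact: cvg_lim cv.
by apply/cvg_ex; exists v.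
Qed.

Lemma scale_realE (R : realType) (a b : R) : a *: b = a * b.
Proof. by []. Qed.

Ltac pair_ring := apply: injective_projections; rewrite /= ?scale_realE; ring.

(** * Existence of integral curves *)

Section peano.
Context {R : realType}.
Implicit Types (p : R * R) (r : R).

Fixpoint euler (X : R * R -> R * R) p (h : R) (k : nat) : R * R :=
  if k is k'.+1 then euler X p h k' + h *: X (euler X p h k') else p.

(** Each increment over a step [h] is within [e * h] of [h *: v], and the errors add up. *)
Lemma euler_dist (X : R * R -> R * R) p (h : R) i j (v : R * R) (e : R) :
  0 <= h -> (i <= j)%N ->
  (forall k, (i <= k < j)%N -> `|X (euler X p h k) - v| <= e) ->
  `|euler X p h j - euler X p h i - (h * (j - i)%:R) *: v| <= e * (h * (j - i)%:R).
Proof.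
move=> h0 ij; rewrite -(subnKC ij) addKn.
elim: (j - i)%N => [|n IH] H.
  by rewrite addn0 !mulr0 scale0r subrr subr0 normr0.
have /IH {}IH : forall k, (i <= k < i + n)%N -> `|X (euler X p h k) - v| <= e.
  by move=> k /andP[ik kn]; apply: H; rewrite ik addnS ltnS ltnW.
rewrite addnS /= -natr1 !mulrDr !mulr1 scalerDl.
set a := euler X p h (i + n).
have -> : a + h *: X a - euler X p h i - ((h * n%:R) *: v + h *: v) =
  (a - euler X p h i - (h * n%:R) *: v) + h *: (X a - v) by pair_ring.
apply: le_trans (ler_normD _ _) _; apply: lerD => //.
rewrite normrZ ger0_norm// mulrC ler_wpM2r//.
by apply: H; rewrite leq_addr addnS ltnS leqnn.
Qed.

Lemma euler_lip (X : R * R -> R * R) p (h : R) i j : 0 <= h -> (forall q, `|X q| <= 1) -> (i <= j)%N ->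
  `|euler X p h j - euler X p h i| <= h * (j - i)%:R.
Proof.
move=> h0 X1 ij.
have := @euler_dist X p h i j 0 1 h0 ij.
rewrite scaler0 subr0 mul1r; apply => k _; rewrite subr0; exact: X1.
Qed.


Lemma truncn_step (t : R) (n : nat) : 0 <= t ->
  n.+1%:R^-1 * (Num.truncn (t * n.+1%:R))%:R <= t /\
  t < n.+1%:R^-1 * (Num.truncn (t * n.+1%:R))%:R + n.+1%:R^-1.
Proof.
move=> t0.
have n0 : 0 < n.+1%:R :> R by rewrite ltr0n.
have tn0 : 0 <= t * n.+1%:R by rewrite mulr_ge0// ltW.
have /andP[H1 H2] := truncn_itv tn0.
rewrite mulrC ler_pdivrMr// H1; split => //.
by rewrite -[X in _ + X]mul1r -mulrDl ltr_pdivlMr// natr1.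
Qed.

(** The Euler iterates of step 1/(n+1), read as step functions of time, converge pointwise along an
    ultrafilter finer than the cofinite one, since at a fixed time they stay in a compact box; this
    replaces the extraction of a subsequence. The equation is stated for [s >= 0] because the curve
    is built forward in time. *)
Lemma peano_right (X : R * R -> R * R) (p : R * R) (r : R) : 0 < r ->
  (forall q : R * R, `|X q| <= 1) ->
  (forall q : R * R, `|q - p| < r -> {for q, continuous X}) ->
  exists c : R -> R * R, [/\ c 0 = p,
    forall t : R, 0 <= t -> `|c t - p| <= t &
    forall t e : R, 0 <= t < r -> 0 < e -> exists2 d : R, 0 < d &
      forall s : R, 0 <= s -> `|s - t| < d ->
        `|c s - c t - (s - t) *: X (c t)| <= e * `|s - t| ].
Proof.
move=> r0 X1 Xc.
have [U [UU Uoo]] := @ultraFilterLemma nat \oo _.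
pose c_ (n : nat) (t : R) := euler X p n.+1%:R^-1 (Num.truncn (t * n.+1%:R)).
have hpos n : 0 < n.+1%:R^-1 :> R by rewrite invr_gt0 ltr0n.
have tle n (s t : R) : s <= t ->
    (Num.truncn (s * n.+1%:R) <= Num.truncn (t * n.+1%:R))%N.
  by move=> st; apply: le_truncn; rewrite ler_wpM2r.
have clip n (s t : R) : 0 <= s -> s <= t ->
    `|c_ n t - c_ n s| <= t - s + n.+1%:R^-1.
  move=> s0 st; have t0 := le_trans s0 st.
  have [a1 a2] := truncn_step n s0; have [b1 b2] := truncn_step n t0.
  apply: le_trans (euler_lip p (ltW (hpos n)) X1 (tle n _ _ st)) _.
  rewrite natrB ?tle// mulrBr.
  move: a1 a2 b1 b2; set A := _ * (Num.truncn _)%:R; set B := _ * (Num.truncn _)%:R.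
  by set h := n.+1%:R^-1; lra.
have c0 n : c_ n 0 = p by rewrite /c_ mul0r truncn0.
have lim_ (t : R) : exists l : R * R, 0 <= t -> (c_ n t) @[n --> U] --> l.
  have [t0|] := leP 0 t; last by move=> t0; exists p => t0'; lra.
  have cpt : compact (`[p.1 - (t + 1), p.1 + (t + 1)]%classic `*`
                      `[p.2 - (t + 1), p.2 + (t + 1)]%classic).
    by apply: compact_setX; exact: segment_compact.
  suff UK : ((c_ ^~ t) @ U) (`[p.1 - (t + 1), p.1 + (t + 1)]%classic `*`
                      `[p.2 - (t + 1), p.2 + (t + 1)]%classic).
    have [l [_ Hl]] := cpt _ (fmap_proper_filter _ _) UK.
    exists l => _ A Al.
    have [//|UnA] := in_ultra_setVsetC (c_ ^~ t @^-1` A) UU.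
    by have [z []] := Hl (~` A) A UnA Al.
  change (U (c_ ^~ t @^-1` (`[p.1 - (t + 1), p.1 + (t + 1)]%classic `*`
                      `[p.2 - (t + 1), p.2 + (t + 1)]%classic))).
  apply: filterE => n /=.
  have := clip n 0 t (lexx 0) t0; rewrite c0 subr0.
  have : n.+1%:R^-1 <= 1 :> R by rewrite invf_le1 ?ltr0n// ler1n.
  case: (c_ n t) => x y; case: (p) => x' y' n1 /=.
  rewrite prod_normE ge_max /= => /andP[]; rewrite !ler_norml => H1 H2.
  by move: n1 H1 H2; rewrite /= !in_itv/=; set h := n.+1%:R^-1 => *; split; lra.
have /choice[c Hc] := lim_.
(* Finite intersections of members of [U] are nonempty, so a single index serves both times and a
   fine step. *)
have app (s t e : R) : 0 <= s -> 0 <= t -> 0 < e ->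
    exists n, [/\ `|c s - c_ n s| < e, `|c t - c_ n t| < e & n.+1%:R^-1 < e].
  move=> s0 t0 e0.
  have Us : \forall n \near U, `|c s - c_ n s| < e.
    by have /cvgrPdist_lt := Hc s s0; exact.
  have Ut : \forall n \near U, `|c t - c_ n t| < e.
    by have /cvgrPdist_lt := Hc t t0; exact.
  have Un : \forall n \near U, n.+1%:R^-1 < e by apply: Uoo; exact: near_infty_natSinv_lt (PosNum e0).
  have [n [? [? ?]]] := filter_ex (filterI Us (filterI Ut Un)).
  by exists n.
have cle (s t : R) : 0 <= s -> s <= t -> `|c t - c s| <= t - s.
  move=> s0 st; apply/ler_addgt0Pr => e e0.
  have e30 : 0 < e / 3 by rewrite divr_gt0.
  have [n [H1 H2 H3]] := app s t (e / 3) s0 (le_trans s0 st) e30.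
  have -> : c t - c s = (c t - c_ n t) + (c_ n t - c_ n s) - (c s - c_ n s).
    by pair_ring.
  apply: le_trans (ler_normB _ _) _; have := ler_normD (c t - c_ n t) (c_ n t - c_ n s).
  by move: H3 (clip n s t s0 st); set h := n.+1%:R^-1; lra.
have c0E : c 0 = p.
  apply/eqP; rewrite -subr_eq0 -normr_eq0; apply/eqP/le_anti; rewrite normr_ge0 andbT.
  apply/ler_addgt0Pr => e e0.
  have [n [H1 _ _]] := app 0 0 e (lexx 0) (lexx 0) e0.
  by move: H1; rewrite c0; lra.
exists c; split => //.
  by move=> t t0; have := cle 0 t (lexx 0) t0; rewrite c0E subr0.
move=> t e /andP[t0 tr] e0.
have ctp : `|c t - p| < r.
  by have := cle 0 t (lexx 0) t0; rewrite c0E subr0; lra.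
have /cvgrPdist_le /(_ _ e0) := Xc _ ctp.
move=> /nbhs_ballP[/= rho rho0 Hrho].
have XP (q : R * R) : `|q - c t| < rho -> `|X q - X (c t)| <= e.
  by move=> qc; rewrite distrC; apply: Hrho; rewrite -ball_normE/= distrC.
exists (rho / 2); first by lra.
have main (lo hi : R) : 0 <= lo -> lo <= hi -> (lo = t) \/ (hi = t) -> hi - lo < rho / 2 ->
    `|c hi - c lo - (hi - lo) *: X (c t)| <= e * (hi - lo).
  move=> lo0 lohi tlohi hl; apply/ler_addgt0Pr => e' e'0.
  have hi0 : 0 <= hi by lra.
  have tb : lo <= t <= hi by case: tlohi => <-; qlra.
  (* Three errors of at most [e3] and one of [e * e3] must fit in [e']; the bound [rho / 8] keeps
     the Euler nodes between [lo] and [hi] within [rho] of [c t], where [X] varies by at most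
     [e]. *)
  pose e3 := Num.min (rho / 8) (e' / (3 + e)).
  have e30 : 0 < e3 by rewrite lt_min !divr_gt0//; qlra.
  have e3r : e3 <= rho / 8 by rewrite ge_min lexx.
  have e3e : (3 + e) * e3 <= e'.
    rewrite mulrC -ler_pdivlMr; last qlra.
    by rewrite ge_min lexx orbT.
  have [n [H1 H2 H3]] := app lo hi e3 lo0 hi0 e30.
  have Ht : `|c t - c_ n t| < e3 by case: tlohi => <-.
  clearbody e3.
  have [a1 a2] := truncn_step n lo0; have [b1 b2] := truncn_step n hi0.
  have [t1 t2] := truncn_step n t0.
  set h : R := n.+1%:R^-1 in a1 a2 b1 b2 t1 t2 H3.
  have hn0 : 0 < h by exact: hpos.
  have hE : n.+1%:R^-1 = h by [].
  clearbody h.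
  have ij := tle n _ _ lohi.
  set i := Num.truncn (lo * _) in ij a1 a2; set j := Num.truncn (hi * _) in ij b1 b2.
  have it : (i <= Num.truncn (t * n.+1%:R))%N by apply: tle; qlra.
  have tj : (Num.truncn (t * n.+1%:R) <= j)%N by apply: tle; qlra.
  set k0 := Num.truncn (t * _) in it tj t1 t2.
  have near_c k : (i <= k < j)%N -> `|X (euler X p h k) - X (c t)| <= e.
    move=> /andP[ik kj]; apply: XP.
    have kk : `|euler X p h k - euler X p h k0| <= h * (j - i)%:R.
      have [kk0|/ltnW k0k] := leqP k k0.
        rewrite distrC; apply: le_trans (euler_lip p (ltW hn0) X1 kk0) _.
        by apply: ler_wpM2l; [exact: ltW|rewrite ler_nat leq_sub].
      apply: le_trans (euler_lip p (ltW hn0) X1 k0k) _.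
      by apply: ler_wpM2l; [exact: ltW|rewrite ler_nat leq_sub// ltnW].
    have := ler_distD (euler X p h k0) (euler X p h k) (c t).
    have : `|c t - euler X p h k0| < e3 by rewrite -hE.
    rewrite (distrC (c t)); move: kk; rewrite natrB// mulrBr.
    set A := `|_|; set B := `|_|; set C := `|_|.
    set D := h * j%:R in b1 b2 *; set E := h * i%:R in a1 a2 *.
    clearbody A B C D E; move: hl e3r H3 hn0 a1 a2 b1 b2 rho0; clear; lra.
  have := euler_dist (ltW hn0) ij near_c.
  rewrite natrB// mulrBr => main.
  pose v := X (c t).
  have v1 : `|v| <= 1 by exact: X1.
  set w := h * j%:R - h * i%:R in main.
  have ww : `|w - (hi - lo)| <= e3.
    by rewrite ler_norml /w; qlra.
  clearbody w.
  have -> : c hi - c lo - (hi - lo) *: X (c t) =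
     (c hi - c_ n hi) + (c_ n hi - c_ n lo - w *: v) + (w - (hi - lo)) *: v
       - (c lo - c_ n lo).
    by rewrite -/v; clearbody v c_; pair_ring.
  apply: le_trans (ler_normB _ _) _.
  have N1 := ler_normD ((c hi - c_ n hi) + (c_ n hi - c_ n lo - w *: v)) ((w - (hi - lo)) *: v).
  have N2 := ler_normD (c hi - c_ n hi) (c_ n hi - c_ n lo - w *: v).
  have N3 : `|(w - (hi - lo)) *: v| <= e3.
    rewrite normrZ; apply: le_trans ww; exact: ler_piMr.
  have N4 : e * w <= e * (hi - lo) + e * e3.
    rewrite -mulrDr ler_wpM2l ?(ltW e0)//; move: ww; rewrite ler_norml; qlra.
  rewrite /c_ hE -/i -/j in N1 N2 H1 H2 *.
  by move: e3e; rewrite mulrDl; qlra.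
move=> s s0 std.
have [st|/ltW ts] := leP s t.
  rewrite (ler0_norm (x := s - t)) ?subr_le0// opprB -normrN.
  have -> : - (c s - c t - (s - t) *: X (c t)) = (c t - c s) - (t - s) *: X (c t).
    by pair_ring.
  apply: main => //; first by right.
  by move: std; rewrite ler0_norm ?subr_le0// opprB.
rewrite (ger0_norm (x := s - t)) ?subr_ge0//.
apply: main => //; first by left.
by move: std; rewrite ger0_norm ?subr_ge0.
Qed.

(** A forward solution for [X] and the time reversal of a forward solution for [- X] are joined at
    0, where both have derivative [X p]. *)
Theorem peano (X : R * R -> R * R) (p : R * R) (r : R) : 0 < r ->
  (forall q : R * R, `|X q| <= 1) ->
  (forall q : R * R, `|q - p| < r -> {for q, continuous X}) ->
  exists c : R -> R * R, c 0 = p /\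
    forall t : R, `|t| < r -> `|c t - p| <= `|t| /\ is_derive t 1 c (X (c t)).
Proof.
move=> r0 X1 Xc.
have [cp [cp0 cpp cpd]] := peano_right r0 X1 Xc.
have X1' (q : R * R) : `|- X q| <= 1 by rewrite normrN.
have Xc' (q : R * R) : `|q - p| < r -> {for q, continuous (fun q => - X q)}.
  by move=> /Xc H; apply: continuousN.
have [cm [cm0 cmp cmd]] := peano_right r0 X1' Xc'.
pose c (t : R) := if 0 <= t then cp t else cm (- t).
have cE (t : R) : 0 <= t -> c t = cp t by rewrite /c => ->.
have cE' (t : R) : t <= 0 -> c t = cm (- t).
  rewrite /c; have [t0 t0'|//] := leP 0 t.
  have -> : t = 0 by apply/le_anti/andP.
  by rewrite oppr0 cp0 cm0.
exists c; split; first by rewrite cE.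
move=> t tr; split.
  have [t0|/ltW t0] := leP 0 t.
    by rewrite cE// ger0_norm// cpp.
  by rewrite cE'// ler0_norm// cmp// oppr_ge0.
apply/is_derive1P => e e0.
have cpd' (s : R) : 0 <= t -> 0 <= s -> c s - c t - (s - t) *: X (c t) = cp s - cp t - (s - t) *: X (cp t).
  by move=> t0 s0; rewrite !cE.
have cmd' (s : R) : t <= 0 -> s <= 0 -> c s - c t - (s - t) *: X (c t) =
    cm (- s) - cm (- t) - (- s - - t) *: - X (cm (- t)).
  by move=> t0 s0; rewrite !cE'// scalerN -scaleNr -opprD opprK.
have nE (s : R) : `|- s - - t| = `|s - t| by rewrite -opprD normrN.
have [t0|t0|t0] := ltrgtP t 0; rewrite ?t0.
- have tm : 0 <= - t < r by rewrite oppr_ge0 ltW//= -(ltr0_norm t0).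
  have [d d0 H] := cmd _ _ tm e0.
  exists (Num.min d (- t)); first by rewrite lt_min d0 oppr_gt0.
  move=> s; rewrite lt_min => /andP[sd]; rewrite ltr_norml => /andP[_ st].
  have s0 : s <= 0 by qlra.
  by rewrite (cmd' _ (ltW t0) s0) -nE; apply: H; rewrite ?oppr_ge0// nE.
- have tp : 0 <= t < r by rewrite ltW//= -(gtr0_norm t0).
  have [d d0 H] := cpd _ _ tp e0.
  exists (Num.min d t); first by rewrite lt_min d0.
  move=> s; rewrite lt_min => /andP[sd]; rewrite ltr_norml => /andP[st _].
  have s0 : 0 <= s by qlra.
  by rewrite (cpd' _ (ltW t0) s0); apply: H.
- have tp : 0 <= t < r by rewrite t0 lexx.
  have tm : 0 <= - t < r by rewrite t0 oppr0 lexx.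
  have [d d0 H] := cpd _ _ tp e0; have [d' d'0 H'] := cmd _ _ tm e0.
  exists (Num.min d d'); first by rewrite lt_min d0.
  move=> s; rewrite lt_min -t0 => /andP[sd sd'].
  have [s0|/ltW s0] := leP 0 s.
    by rewrite cpd' ?t0//; rewrite -t0; apply: H.
  by rewrite cmd' ?t0//; rewrite -t0 -nE; apply: H'; rewrite ?oppr_ge0// nE.
Qed.

(* The maximal curve is the union of all integral curves through [p]. *)
Lemma unique_integral_curve_glue (X : R * R -> R * R) (W : set (R * R)) (p : R * R) :
  (exists I c, integral_curve X W p I c) ->
  (forall I c J e, integral_curve X W p I c -> integral_curve X W p J e ->
     forall t, I t -> J t -> c t = e t) ->
  unique_integral_curve X W p.
Proof.
move=> [I0 [c0 Ic0]] agree.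
pose P t (Ic : set R * (R -> R * R)) := integral_curve X W p Ic.1 Ic.2 /\ Ic.1 t.
pose I := [set t | exists Ic, P t Ic].
have /choice[f Hf] : forall t, exists Ic, I t -> P t Ic.
  move=> t.
  by have [[Ic PIc]|nI] := pselect (I t); [exists Ic|exists (I0, c0)].
pose c t := (f t).2 t.
have main J e : integral_curve X W p J e -> J `<=` I /\ forall t, J t -> e t = c t.
  move=> Je; have JI : J `<=` I by move=> t Jt; exists (J, e).
  split=> // t Jt; have [H1 H2] := Hf t (JI t Jt).
  exact: agree Je H1 t Jt H2.
exists I, c; split => //.
have [oI0 iI0 I00 c00 dI0] := Ic0.
have I0I : I 0 by exists (I0, c0).
split => //.
- have -> : I = \bigcup_(J in [set J | exists e, integral_curve X W p J e]) J.
    apply/seteqP; split => [t [[J e] [/= Je Jt]]|t [J [e Je] Jt]].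
      by exists J => //; exists e.
    by exists (J, e).
  by apply: bigcup_open => J [e [] ].
- move=> x y [[J e] [/= Je Jx]] [[K g] [/= Kg Ky]] z /andP[xz zy].
  have [_ iJ J0 _ _] := Je; have [_ iK K0 _ _] := Kg.
  have [z0|/ltW z0] := leP 0 z.
    by exists (K, g); split => //=; apply: iK K0 Ky _ _; rewrite z0.
  by exists (J, e); split => //=; apply: iJ Jx J0 _ _; rewrite xz.
- by have [_ <-] := main _ _ Ic0.
- move=> t [[J e] [/= Je Jt]].
  have [oJ iJ J0 _ dJ] := Je; have [JI ec] := main _ _ Je.
  rewrite -ec//; split; first by have [] := dJ t Jt.
  have [_ de] := dJ t Jt.
  apply: near_eq_is_derive de.
  near=> s; apply: ec; near: s.
  exact: open_nbhs_nbhs.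
Unshelve. all: by end_near.
Qed.
End peano.

(** * Test functions *)

Section smooth_functions.
Context {R : realType}.
Implicit Types f g : R -> R.

(** Existence of [k] successive derivatives; continuity of the last one comes from the next order
    once all orders are required, as in [smooth]. *)
Fixpoint Cn (k : nat) f : Prop :=
  if k is k'.+1 then (forall x : R, derivable f x 1) /\ Cn k' (derive1 f) else True.

Definition smooth f := forall k, Cn k f.

Lemma CnS k f g : (forall x : R, is_derive x 1 f (g x)) -> Cn k g -> Cn k.+1 f.
Proof.
move=> df Cg; split; first by move=> x; have [] := df x.
by have -> : (derive1 f) = g by apply/funext => x; rewrite derive1E; have [] := df x.
Qed.

Lemma Cn_is_derive k f (x : R) : Cn k.+1 f -> is_derive x 1 f ((derive1 f) x).
Proof. by move=> [df _]; rewrite derive1E; apply: DeriveDef. Qed.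

Lemma CnW k f : Cn k.+1 f -> Cn k f.
Proof. by elim: k f => [//|k IH] f [df Cf]; split => //; exact: IH. Qed.

Lemma Cn_cst k (c : R) : Cn k (fun=> c).
Proof.
elim: k c => [//|k IH] c; by apply: (@CnS _ _ (fun=> 0)) => // x; exact: is_derive_cst.
Qed.

Lemma CnD k f g : Cn k f -> Cn k g -> Cn k (fun x => f x + g x).
Proof.
elim: k f g => [//|k IH] f g Cf Cg.
apply: (@CnS _ _ (fun x => (derive1 f) x + (derive1 g) x)); last exact: IH (proj2 Cf) (proj2 Cg).
by move=> x; exact: (is_deriveD (Cn_is_derive x Cf) (Cn_is_derive x Cg)).
Qed.

Lemma CnM k f g : Cn k f -> Cn k g -> Cn k (fun x => f x * g x).
Proof.
elim: k f g => [//|k IH] f g Cf Cg.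
apply: (@CnS _ _ (fun x => f x * (derive1 g) x + g x * (derive1 f) x)).
  by move=> x; exact: (is_deriveM (Cn_is_derive x Cf) (Cn_is_derive x Cg)).
by apply: CnD; apply: IH; [exact: CnW|exact: (proj2 Cg)|exact: CnW|exact: (proj2 Cf)].
Qed.

Lemma Cn_affine k f (a b : R) : Cn k f -> Cn k (fun x => f (a * x + b)).
Proof.
elim: k f => [//|k IH] f Cf.
apply: (@CnS k (fun x => f (a * x + b)) (fun x => (derive1 f) (a * x + b) * a)) => [x|]; last first.
  by apply: CnM; [exact: IH (proj2 Cf)|exact: Cn_cst].
have da : is_derive x 1 (fun x : R => a * x + b) a.
  have := is_deriveD (is_deriveZ a (is_derive_id x (1 : R))) (is_derive_cst b x (1 : R)).
  by rewrite scale_realE mulr1 addr0.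
exact: (@is_derive1_comp _ f (fun x => a * x + b) x _ _ (Cn_is_derive (a * x + b) Cf) da).
Qed.

Lemma CnV k f : (forall x, f x != 0) -> Cn k f -> Cn k (fun x => (f x)^-1).
Proof.
move=> f0; elim: k => [//|k IH] Cf.
have Cfk := IH (CnW Cf).
apply: (@CnS _ _ (fun x => (-1) * ((f x)^-1 * (f x)^-1) * (derive1 f) x)) => [x|].
  have -> : -1 * ((f x)^-1 * (f x)^-1) * (derive1 f) x = - f x ^- 2 *: (derive1 f) x.
    by rewrite scale_realE expr2 invfM mulN1r.
  exact: (is_deriveV (f0 x) (Cn_is_derive x Cf)).
by apply: CnM; [apply: CnM; [exact: Cn_cst|exact: CnM]|exact: proj2 Cf].
Qed.

(** The powers of 1/x make the family stable under differentiation up to linear combinations, so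
    that smoothness follows by induction on the order for all [n] at once. *)
Definition flat (n : nat) (x : R) : R :=
  if 0 < x then x^-1 ^+ n * expR (- x^-1) else 0.

Lemma flat_ge0 n x : 0 <= flat n x.
Proof.
rewrite /flat; case: ltP => // x0.
by rewrite mulr_ge0 ?expR_ge0// exprn_ge0// invr_ge0 ltW.
Qed.

(** The exponential series gives exp y >= y^(n+2) / (n+2)! with y = 1/x. The quadratic bound makes
    the derivative of [flat n] at 0 vanish. *)
Lemma flat_le n x : flat n x <= (n.+2`!)%:R * x ^+ 2.
Proof.
rewrite /flat; case: ltP => x0; last by rewrite mulr_ge0// sqr_ge0.
have y0 : 0 < x^-1 by rewrite invr_gt0.
have H := expR_ge1Dxn n.+1 (ltW y0).
have {}H : x^-1 ^+ n.+2 / (n.+2)`!%:R <= expR x^-1 by apply: le_trans H; rewrite lerDr.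
have f0 : 0 < (n.+2)`!%:R :> R by rewrite ltr0n fact_gt0.
rewrite expRN ler_pdivrMr ?expR_gt0//.
have xx : x != 0 by rewrite gt_eqF.
have -> : x^-1 ^+ n = (n.+2)`!%:R * x ^+ 2 * (x^-1 ^+ n.+2 / (n.+2)`!%:R).
  rewrite -(addn2 n) exprD addn2; move: (x^-1 ^+ n) (n.+2`!%:R) f0 {H} => y z z0.
  by field; rewrite xx gt_eqF.
by apply: ler_wpM2l => //; rewrite mulr_ge0 ?sqr_ge0// ltW.
Qed.

Lemma is_derive_flat n (x : R) :
  is_derive x 1 (flat n) (flat n.+2 x + (- n%:R) * flat n.+1 x).
Proof.
have [x0|x0|->] := ltrgtP x 0.
- have -> : flat n.+2 x + - n%:R * flat n.+1 x = 0.
    by rewrite /flat ltNge (ltW x0)/= mulr0 addr0.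
  have H : is_derive x 1 (fun=> 0 : R) (0 : R) by exact: is_derive_cst.
  apply: near_eq_is_derive H.
  near=> y; rewrite /flat; case: ltP => // y0; exfalso.
  suff : y < 0 by lra.
  by near: y; exact: lt_nbhsl.
- have xx : x != 0 by rewrite gt_eqF.
  have dV : is_derive x 1 (fun y : R => y^-1) (- x ^- 2 *: 1).
    exact: (@is_deriveV _ id).
  have dE : is_derive x 1 (fun y : R => expR (- y^-1)) (expR (- x^-1) * - (- x ^- 2 *: 1)).
    by apply: (@is_derive1_comp _ expR (fun y => - y^-1)).
  have dX : is_derive x 1 (fun y : R => y^-1 ^+ n) ((n%:R * x^-1 ^+ n.-1) *: (- x ^- 2 *: 1)).
    have -> : (fun y : R => y^-1 ^+ n) = (fun y => y^-1) ^+ n.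
      by apply/funext => y; rewrite exprfctE.
    exact: is_deriveX.
  have dM := is_deriveM dX dE.
  have H : is_derive x 1 (fun y : R => y^-1 ^+ n * expR (- y^-1))
      (flat n.+2 x + (- n%:R) * flat n.+1 x).
    apply: is_derive_eq dM _; rewrite !scale_realE /flat x0 !mulr1.
    have e2 : x ^- 2 = x^-1 * x^-1 by rewrite expr2 invfM.
    clear dX; case: n => [|n]; rewrite /= e2.
      rewrite expr0 !exprS expr0; ring.
    rewrite !exprS; ring.
  apply: near_eq_is_derive H.
  near=> y; rewrite /flat; case: ltP => // y0; exfalso.
  suff : 0 < y by lra.
  by near: y; exact: lt_nbhsr.
- have -> : flat n.+2 0 + - n%:R * flat n.+1 0 = 0.
    by rewrite /flat ltxx mulr0 addr0.
  apply/is_derive1P => e e0.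
  have f0 : 0 < (n.+2)`!%:R :> R by rewrite ltr0n fact_gt0.
  exists (e / (n.+2)`!%:R); first exact: divr_gt0.
  move=> s; rewrite subr0 ltr_pdivlMr// => se.
  rewrite scaler0 subr0 {2}/flat ltxx subr0 ger0_norm ?flat_ge0//.
  apply: le_trans (flat_le n s) _.
  by rewrite -real_normK ?num_real// expr2 mulrA ler_wpM2r// mulrC ltW.
Unshelve. all: by end_near.
Qed.

Lemma Cn_flat k n : Cn k (flat n).
Proof.
elim: k n => [//|k IH] n; apply: CnS; first exact: is_derive_flat.
by apply: CnD => //; apply: CnM => //; exact: Cn_cst.
Qed.

(** The usual smooth step, 0 for x <= 0 and 1 for x >= 1; 1 - x is written as an affine function in
    the form that [Cn_affine] expects. *)
Definition sstep (x : R) : R := flat 0 x / (flat 0 x + flat 0 (- 1 * x + 1)).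

Lemma flat0_gt0 x : 0 < x -> 0 < flat 0 x.
Proof. by move=> x0; rewrite /flat x0 mulr_gt0 ?expR_gt0// exprn_gt0// invr_gt0. Qed.

Lemma flat0_homo : {homo flat 0 : x y / x <= y}.
Proof.
move=> x y xy; rewrite {1}/flat; case: ltP => x0; last exact: flat_ge0.
have y0 : 0 < y by exact: lt_le_trans xy.
by rewrite /flat y0 !expr0 !mul1r ler_expR lerN2 lef_pV2.
Qed.

Let den_gt0 x : 0 < flat 0 x + flat 0 (- 1 * x + 1).
Proof.
have [x0|x0] := ltP 0 x.
  by rewrite ltr_wpDr ?flat_ge0// flat0_gt0.
by rewrite ltr_wpDl ?flat_ge0// flat0_gt0//; lra.
Qed.

Lemma smooth_sstep : smooth sstep.
Proof.
move=> k; apply: CnM; first exact: Cn_flat.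
apply: CnV => [x|]; first by rewrite gt_eqF.
by apply: CnD; [exact: Cn_flat|apply: Cn_affine; exact: Cn_flat].
Qed.

Lemma sstep_le0 x : x <= 0 -> sstep x = 0.
Proof. by move=> x0; rewrite /sstep {1}/flat ltNge x0/= mul0r. Qed.

Lemma sstep_ge1 x : 1 <= x -> sstep x = 1.
Proof.
move=> x1; rewrite /sstep; have -> : flat 0 (-1 * x + 1) = 0.
  by rewrite /flat; case: ltP => //; lra.
by rewrite addr0 divff// gt_eqF// flat0_gt0//; lra.
Qed.

Lemma sstep_homo : {homo sstep : x y / x <= y}.
Proof.
move=> x y xy; rewrite /sstep ler_pdivrMr// mulrAC ler_pdivlMr//.
have fxy := flat0_homo xy.
have fyx : flat 0 (-1 * y + 1) <= flat 0 (-1 * x + 1) by apply: flat0_homo; lra.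
by rewrite !mulrDr [X in X + _ <= _]mulrC lerD2l ler_pM// flat_ge0.
Qed.

Lemma sstep_ge0 x : 0 <= sstep x.
Proof. by rewrite divr_ge0 ?flat_ge0// ltW. Qed.

Lemma sstep_le1 x : sstep x <= 1.
Proof. by rewrite ler_pdivrMr// mul1r lerDl flat_ge0. Qed.

End smooth_functions.

(** * Products of one-variable functions as smooth functions of the plane *)

Section tensor_test_functions.
Context {R : realType}.
Implicit Types (f : R * R -> R) (chi eta : R -> R) (q : R * R).

Lemma is_derive_fst f q (l : R) :
  is_derive q.1 1 (fun x => f (x, q.2)) l -> is_derive q ((1, 0) : R * R) f l.
Proof.
have E : (fun h : R => h^-1 *: ((f \o shift q) (h *: ((1, 0) : R * R)) - f q)) =
   (fun h : R => h^-1 *: (((fun x => f (x, q.2)) \o shift q.1) (h *: 1) - f (q.1, q.2))).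
  apply/funext => h; rewrite /= -surjective_pairing; congr (_ *: (f _ - _)).
  by apply: injective_projections; rewrite /= ?scale_realE ?mulr1 ?mulr0 ?add0r.
move=> [d1 d2]; apply: DeriveDef; first by rewrite /derivable E.
by rewrite /derive E.
Qed.

Lemma is_derive_snd f q (l : R) :
  is_derive q.2 1 (fun y => f (q.1, y)) l -> is_derive q ((0, 1) : R * R) f l.
Proof.
have E : (fun h : R => h^-1 *: ((f \o shift q) (h *: ((0, 1) : R * R)) - f q)) =
   (fun h : R => h^-1 *: (((fun y => f (q.1, y)) \o shift q.2) (h *: 1) - f (q.1, q.2))).
  apply/funext => h; rewrite /= -surjective_pairing; congr (_ *: (f _ - _)).
  by apply: injective_projections; rewrite /= ?scale_realE ?mulr1 ?mulr0 ?add0r.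
move=> [d1 d2]; apply: DeriveDef; first by rewrite /derivable E.
by rewrite /derive E.
Qed.

Lemma smooth_derive chi : smooth chi -> smooth (derive1 chi).
Proof. by move=> sc k; have [] := sc k.+1. Qed.

Lemma smooth_is_derive chi (x : R) : smooth chi -> is_derive x 1 chi ((derive1 chi) x).
Proof. by move=> sc; apply: (@Cn_is_derive _ 0%N); exact: sc. Qed.

Lemma smooth_continuous chi : smooth chi -> continuous chi.
Proof.
move=> sc x; apply: differentiable_continuous; apply/derivable1_diffP.
by have [] := smooth_is_derive x sc.
Qed.

Definition tensor chi eta q := chi q.1 * eta q.2.

Lemma d1_tensor chi eta q : smooth chi ->
  is_derive q ((1, 0) : R * R) (tensor chi eta) ((derive1 chi) q.1 * eta q.2).
Proof.
move=> sc; apply: is_derive_fst; rewrite /tensor/=.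
have -> : (fun x => chi x * eta q.2) = (eta q.2 \*: chi).
  by apply/funext => x; rewrite /= scale_realE mulrC.
by rewrite mulrC; apply: is_deriveZ; exact: smooth_is_derive.
Qed.

Lemma d2_tensor chi eta q : smooth eta ->
  is_derive q ((0, 1) : R * R) (tensor chi eta) (chi q.1 * (derive1 eta) q.2).
Proof.
move=> se; apply: is_derive_snd; rewrite /tensor/=.
by apply: (@is_deriveZ _ _ _ eta); exact: smooth_is_derive.
Qed.

Lemma continuous_tensor chi eta :
  continuous chi -> continuous eta -> continuous (tensor chi eta).
Proof.
move=> cc ce q; apply: continuousM.
  by apply: continuous_comp; [exact: cvg_fst|exact: cc].
by apply: continuous_comp; [exact: cvg_snd|exact: ce].
Qed.

Lemma Ck_tensor chi eta k : smooth chi -> smooth eta -> Ck k (tensor chi eta).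
Proof.
elim: k chi eta => [|k IH] chi eta sc se; split => //;
  try by apply: continuous_tensor; exact: smooth_continuous.
split.
- by move=> q; split; [have [] := d1_tensor eta q sc|have [] := d2_tensor chi q se].
- have -> : d1 (tensor chi eta) = tensor (derive1 chi) eta.
    by apply/funext => q; have [_] := d1_tensor eta q sc.
  by apply: IH => //; exact: smooth_derive.
- have -> : d2 (tensor chi eta) = tensor chi (derive1 eta).
    by apply/funext => q; have [_] := d2_tensor chi q se.
  by apply: IH => //; exact: smooth_derive.
Qed.

End tensor_test_functions.

(** * Measurability of open sets and continuous functions in the plane *)

Section plane_measurability.
Context {R : realType}.
Implicit Types (U K : set (R * R)) (f : R * R -> R).

(** The sigma-algebra is the product one, so the open set is written as the countable union of the
    open squares with rational centre and half-side 1/(n+1) that it contains. *)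
Lemma open_measurable_plane U : open U -> measurable U.
Proof.
move=> oU.
pose box (k : rat * rat * nat) : set (R * R) :=
  `]ratr k.1.1 - k.2.+1%:R^-1, ratr k.1.1 + k.2.+1%:R^-1[%classic `*`
  `]ratr k.1.2 - k.2.+1%:R^-1, ratr k.1.2 + k.2.+1%:R^-1[%classic.
pose F k := if pselect (box k `<=` U) then box k else set0.
have -> : U = \bigcup_k F k.
  apply/seteqP; split=> [[x y] Uxy|q [k _]]; last first.
    by rewrite /F; case: pselect => // kU /kU.
  have /nbhs_ballP[e /= e0 eU] := oU _ Uxy.
  have [n ne] : exists n, n.+1%:R^-1 < e / 2.
    have e20 : 0 < e / 2 by lra.
    have [n _ H] := near_infty_natSinv_lt (PosNum e20).
    by exists n; exact: H (leqnn n).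
  have n0 : 0 < n.+1%:R^-1 :> R by rewrite invr_gt0 ltr0n.
  have rat_near (z : R) : exists a : rat, z - n.+1%:R^-1 < ratr a < z + n.+1%:R^-1.
    have zz : z - n.+1%:R^-1 < z + n.+1%:R^-1.
      by rewrite (lt_trans (y := z))// ?ltrDl// ltrBlDr ltrDl.
    by have [a az] := rat_in_itvoo zz; exists a; move: az; rewrite in_itv.
  have [a /andP[a1 a2]] := rat_near x; have [b /andP[b1 b2]] := rat_near y.
  exists (a, b, n) => //; rewrite /F.
  move: n0 ne a1 a2 b1 b2; rewrite /box /=.
  move: (n.+1%:R^-1) => h n0 ne a1 a2 b1 b2; case: pselect => [?|[]].
    by split; rewrite /= in_itv/=; apply/andP; split; qlra.
  move=> [x' y'] [/=]; rewrite !in_itv/= => /andP[x1 x2] /andP[y1 y2].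
  by apply: eU; split; rewrite /ball/= ltr_norml; apply/andP; split; qlra.
apply: countable_bigcupT_measurable => [|k]; first exact: countableP.
rewrite /F; case: pselect => [?|?]; last exact: measurable0.
by apply: measurableX; exact: measurable_itv.
Qed.

Lemma open_continuous_measurable_plane U f : open U ->
  (forall q, U q -> {for q, continuous f}) -> measurable_fun U f.
Proof.
move=> oU cf; apply: (measurability _ (RGenOInfty.measurableE R)) => _ [_ [a ->] <-].
apply: open_measurable_plane.
rewrite openE => q [Uq fq].
have fq' : \forall q' \near q, a < f q'.
  have fq1 : a < f q by move: fq; rewrite /= in_itv/= andbT.
  exact: (cf q Uq _ (lt_nbhsr fq1)).
have Uq' : \forall q' \near q, U q' by exact: open_nbhs_nbhs.
near=> q'; split; first by near: q'.
by rewrite /= in_itv/= andbT; near: q'.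
Unshelve. all: by end_near. Qed.
End plane_measurability.

(** * Cutoffs of an interval *)

Section cutoff.
Context {R : realType}.
Local Notation mu := (@lebesgue_measure R).

Lemma homo_derive1_ge0 (f : R -> R) (x : R) : {homo f : x y / x <= y} ->
  derivable f x 1 -> 0 <= derive1 f x.
Proof.
move=> hf df; rewrite derive1E.
have [//|D0] := leP 0 ('D_1 f x).
have dfx : is_derive x 1 f ('D_1 f x) by exact: DeriveDef.
have e0 : 0 < - 'D_1 f x / 2 by lra.
have /is_derive1P/(_ _ e0)[d d0 H] := dfx.
have := H (x + d / 2); rewrite addrAC subrr add0r gtr0_norm; last lra.
move=> /(_ ltac:(lra)); rewrite ler_norml scale_realE => /andP[_].
have fx : f x <= f (x + d / 2) by apply: hf; lra.
nra.
Qed.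

Lemma derive1_cst_near (f : R -> R) (x c : R) :
  (\forall y \near x, f y = c) -> derive1 f x = 0.
Proof.
move=> fc; rewrite derive1E.
have H : is_derive x 1 (fun=> c) (0 : R) by exact: is_derive_cst.
have : is_derive x 1 f 0.
  by apply: near_eq_is_derive H; apply: filterS fc => y ->.
by case.
Qed.

Lemma smooth_FTC2 (f : R -> R) (a b : R) : smooth f -> a < b ->
  \int[mu]_(x in `[a, b]) derive1 f x = f b - f a.
Proof.
move=> sf ab.
have cf : continuous f by exact: smooth_continuous.
have cf' : continuous (derive1 f) by apply: smooth_continuous; exact: smooth_derive.
rewrite /Rintegral (@continuous_FTC2 _ (derive1 f) f) //.
- exact: continuous_subspaceT.
- split; first by move=> x _; have [] := smooth_is_derive x sf.
  + by apply: cvg_at_right_filter; exact: cf.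
  + by apply: cvg_at_left_filter; exact: cf.
Qed.

(** [chi] is a rising plus a falling step minus 1. Its derivative is written as a difference of two
    probability densities living on the end strips of width [d], because integrating a function
    against it then gives the average near [x1] minus the average near [x2]. *)
Lemma cutoff_exists (x1 x2 d : R) : 0 < d -> 2 * d <= x2 - x1 ->
  exists chi a b : R -> R, smooth chi /\
  [/\ forall x, 0 <= chi x <= 1,
      forall x, chi x != 0 -> x1 < x < x2,
      forall x, x1 + d <= x <= x2 - d -> chi x = 1 &
      forall x, derive1 chi x = a x - b x] /\
  [/\ continuous a /\ continuous b,
      forall x, 0 <= a x /\ 0 <= b x,
      forall x, a x != 0 -> x1 <= x <= x1 + d,
      forall x, b x != 0 -> x2 - d <= x <= x2 &
      \int[mu]_(x in `[x1, x2]) a x = 1 /\ \int[mu]_(x in `[x1, x2]) b x = 1].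
Proof.
move=> d0 dx.
have x12 : x1 < x2 by lra.
pose S1 x := sstep (d^-1 * x + - (d^-1 * x1)).
pose S2 x := sstep (- d^-1 * x + d^-1 * x2).
have sS1 : smooth S1 by move=> k; apply: Cn_affine; exact: smooth_sstep.
have sS2 : smooth S2 by move=> k; apply: Cn_affine; exact: smooth_sstep.
have dv0 : 0 < d^-1 by rewrite invr_gt0.
have dvd : d^-1 * d = 1 by rewrite mulVf// gt_eqF.
have S1_0 x : x <= x1 -> S1 x = 0 by move=> xx; apply: sstep_le0; nra.
have S1_1 x : x1 + d <= x -> S1 x = 1 by move=> xx; apply: sstep_ge1; nra.
have S2_0 x : x2 <= x -> S2 x = 0 by move=> xx; apply: sstep_le0; nra.
have S2_1 x : x <= x2 - d -> S2 x = 1 by move=> xx; apply: sstep_ge1; nra.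
pose chi x := S1 x + (S2 x + (-1)).
have schi : smooth chi.
  by move=> k; apply: CnD; [exact: sS1|apply: CnD; [exact: sS2|exact: Cn_cst]].
have H1 x : 0 <= S1 x <= 1 by rewrite sstep_ge0 sstep_le1.
have H2 x : 0 <= S2 x <= 1 by rewrite sstep_ge0 sstep_le1.
pose b x := - derive1 S2 x.
exists chi, (derive1 S1), b; split => //; split; split.
- move=> x; rewrite /chi; have := H1 x; have := H2 x.
  by have [/S1_1 ->|/ltW xx] := leP (x1 + d) x; [qlra|rewrite S2_1; qlra].
- move=> x; have [xx|xx] := leP x x1.
    have E := S1_0 _ xx.
    by rewrite /chi E S2_1 ?subrr ?addr0 ?eqxx//; lra.
  have [xx2|//] := leP x2 x; have E := S2_0 _ xx2.
  by rewrite /chi E S1_1 ?add0r ?subrr ?eqxx//; lra.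
- by move=> x /andP[xa xb]; rewrite /chi S1_1// S2_1// subrr addr0.
- move=> x; have h1 := smooth_is_derive x sS1; have h2 := smooth_is_derive x sS2.
  have := is_deriveD h1 (is_deriveD h2 (is_derive_cst (-1 : R) x (1 : R))).
  by rewrite addr0 /b opprK => dS; rewrite derive1E; case: dS.
- have c1 := smooth_continuous (smooth_derive sS1).
  have c2 := smooth_continuous (smooth_derive sS2).
  by split => // x; apply: continuousN; exact: c2.
- move=> x; split.
    apply: homo_derive1_ge0; last by have [] := smooth_is_derive x sS1.
    by move=> y z yz; apply: sstep_homo; nra.
  have -> : b x = derive1 (fun x => - S2 x) x.
    rewrite [RHS]derive1E; have [_ ->//] := is_deriveN (smooth_is_derive x sS2).
  apply: homo_derive1_ge0; last by have [] := is_deriveN (smooth_is_derive x sS2).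
  by move=> y z yz; rewrite lerN2; apply: sstep_homo; nra.
- move=> x; apply: contra_neqT; rewrite negb_and -!ltNge => /orP[xx|xx].
    apply: (@derive1_cst_near _ _ 0); near=> y; apply: S1_0.
    by apply/ltW; near: y; exact: lt_nbhsl.
  apply: (@derive1_cst_near _ _ 1); near=> y; apply: S1_1.
  by apply/ltW; near: y; exact: lt_nbhsr.
- move=> x; apply: contra_neqT; rewrite negb_and -!ltNge => /orP[xx|xx].
    rewrite /b (@derive1_cst_near _ _ 1) ?oppr0//; near=> y; apply: S2_1.
    by apply/ltW; near: y; exact: lt_nbhsl.
  rewrite /b (@derive1_cst_near _ _ 0) ?oppr0//; near=> y; apply: S2_0.
  by apply/ltW; near: y; exact: lt_nbhsr.
- rewrite smooth_FTC2// (S1_1 x2) ?(S1_0 x1) ?subr0//; last lra; split => //.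
  have c2 := smooth_continuous (smooth_derive sS2).
  have -> : \int[mu]_(x in `[x1, x2]) b x = \int[mu]_(x in `[x1, x2]) (-1 * derive1 S2 x).
    by apply: eq_Rintegral => x _; rewrite mulN1r.
  rewrite RintegralZl//; last first.
    by apply: continuous_compact_integrable; [exact: segment_compact|exact: continuous_subspaceT].
  by rewrite smooth_FTC2// (S2_0 x2) ?(S2_1 x1)//; lra.
Unshelve. all: by end_near. Qed.
End cutoff.

(** * Flux through rectangles *)

Section flux_line.
Context {R : realType}.
Local Notation mu := (@lebesgue_measure R).

Lemma bounded_integrable_itv (f : R -> R) (a b M : R) :
  measurable_fun `[a, b] f -> (forall x, a <= x <= b -> `|f x| <= M) ->
  mu.-integrable `[a, b] (EFin \o f).
Proof.
move=> mf fM; apply: measurable_bounded_integrable => //.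
- by apply: compact_finite_measure; exact: segment_compact.
- exists M; split; rewrite ?num_real// => y My x xab.
  by apply: le_trans (ltW My); apply: fM; move: xab; rewrite /= in_itv.
Qed.

Lemma continuous_integrable_itv (f : R -> R) (a b : R) :
  {within `[a, b], continuous f} -> mu.-integrable `[a, b] (EFin \o f).
Proof.
by move=> cf; apply: continuous_compact_integrable => //; exact: segment_compact.
Qed.

Lemma Rintegral_itv_cst (a b c : R) : a <= b ->
  \int[mu]_(x in `[a, b]) c = c * (b - a).
Proof.
move=> ab; rewrite Rintegral_cst//= lebesgue_measure_itv/= lte_fin.
case: ltP => ab'; first by rewrite -EFinB.
have -> : b = a by apply/le_anti; rewrite ab ab'.
by rewrite subrr.
Qed.

Lemma integrable_itvZ (f : R -> R) (a b k : R) :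
  mu.-integrable `[a, b] (EFin \o f) -> mu.-integrable `[a, b] (EFin \o (fun x => k * f x)).
Proof.
move=> fi.
have H : mu.-integrable `[a, b] (fun x => k%:E * (EFin \o f) x)%E by exact: integrableZl.
by apply: eq_integrable H => // x _ /=; rewrite EFinM.
Qed.

Lemma integrable_itvD (f g : R -> R) (a b : R) :
  mu.-integrable `[a, b] (EFin \o f) -> mu.-integrable `[a, b] (EFin \o g) ->
  mu.-integrable `[a, b] (EFin \o (fun x => f x + g x)).
Proof.
move=> fi gi.
have H : mu.-integrable `[a, b] ((EFin \o f) \+ (EFin \o g))%E by exact: integrableD.
by apply: eq_integrable H => // x _ /=; rewrite EFinD.
Qed.

Lemma integrable_itvB (f g : R -> R) (a b : R) :
  mu.-integrable `[a, b] (EFin \o f) -> mu.-integrable `[a, b] (EFin \o g) ->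
  mu.-integrable `[a, b] (EFin \o (fun x => f x - g x)).
Proof.
move=> fi gi.
have H : mu.-integrable `[a, b] ((EFin \o f) \- (EFin \o g))%E by exact: integrableB.
by apply: eq_integrable H => // x _ /=; rewrite EFinB.
Qed.

Lemma cst_integrable (a b c : R) : mu.-integrable `[a, b] (EFin \o cst c).
Proof. by apply: continuous_integrable_itv; apply: continuous_subspaceT => x; exact: cvg_cst. Qed.

Lemma norm_Rintegral_itv_le (f g : R -> R) (a b : R) :
  mu.-integrable `[a, b] (EFin \o f) -> mu.-integrable `[a, b] (EFin \o g) ->
  (forall x, a <= x <= b -> `|f x| <= g x) ->
  `|\int[mu]_(x in `[a, b]) f x| <= \int[mu]_(x in `[a, b]) g x.
Proof.
move=> fi gi fg; apply: le_trans (le_normr_Rintegral _ fi) _ => //.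
apply: le_Rintegral => //.
by have := integrable_abse fi; apply: eq_integrable.
Qed.

(** As [w] has total mass 1, the constant [c] can be put under the integral as [c * w], and only the
    support of [w] is seen. *)
Lemma weighted_average_close (f w : R -> R) (x1 x2 c om : R) :
  measurable_fun `[x1, x2] f -> (forall x, `|f x| <= 1) -> continuous w ->
  (forall x, 0 <= w x) -> \int[mu]_(x in `[x1, x2]) w x = 1 ->
  (forall x, x1 <= x <= x2 -> w x != 0 -> `|f x - c| <= om) ->
  mu.-integrable `[x1, x2] (EFin \o (fun x => f x * w x)) /\
  `|\int[mu]_(x in `[x1, x2]) (f x * w x) - c| <= om.
Proof.
move=> mf f1 cw w0 w1 fc.
have wi : mu.-integrable `[x1, x2] (EFin \o w).
  by apply: continuous_integrable_itv; exact: continuous_subspaceT.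
have fwi : mu.-integrable `[x1, x2] (EFin \o (fun x => f x * w x)).
  have bf : [bounded f x | x in `[x1, x2]%classic].
    by exists 1; split; rewrite ?num_real// => y y1 x _; apply: le_trans (f1 x) (ltW y1).
  have H : mu.-integrable `[x1, x2] ((EFin \o f) \* (EFin \o w))%E by exact: integrableMr.
  by apply: eq_integrable H => // x _ /=; rewrite EFinM.
split => //.
have cwi (k : R) : mu.-integrable `[x1, x2] (EFin \o (fun x => k * w x)).
  exact: integrable_itvZ.
have -> : \int[mu]_(x in `[x1, x2]) (f x * w x) - c =
    \int[mu]_(x in `[x1, x2]) (f x * w x - c * w x).
  by rewrite RintegralB// RintegralZl// w1 mulr1.
have -> : om = \int[mu]_(x in `[x1, x2]) (om * w x) by rewrite RintegralZl// w1 mulr1.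
apply: norm_Rintegral_itv_le => //.
  exact: integrable_itvB.
move=> x xx; rewrite -mulrBl normrM (ger0_norm (w0 x)).
have [->|wx] := eqVneq (w x) 0; first by rewrite !mulr0.
by rewrite ler_wpM2r// fc.
Qed.

(** The integrand is at most 1 and lives on two end strips of width [d]. *)
Lemma cutoff_integral (eta : R -> R) (y1 y2 d : R) : continuous eta -> 0 < d ->
  2 * d <= y2 - y1 -> (forall y, 0 <= eta y <= 1) ->
  (forall y, y1 + d <= y <= y2 - d -> eta y = 1) ->
  \int[mu]_(y in `[y1, y2]) (1 - eta y) <= 2 * d.
Proof.
move=> ce d0 dy e01 e1.
have ei (a b : R) : mu.-integrable `[a, b] (EFin \o (fun y => 1 - eta y)).
  apply: continuous_integrable_itv; apply: continuous_subspaceT => y.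
  by apply: continuousB; [exact: cvg_cst|exact: ce].
have split (a b c : R) : a <= b -> b <= c -> \int[mu]_(y in `[a, c]) (1 - eta y) =
    \int[mu]_(y in `[a, b]) (1 - eta y) + \int[mu]_(y in `[b, c]) (1 - eta y).
  move=> ab bc; have H := @Rintegral_itvB R (fun y => 1 - eta y) (BLeft a) (BRight c) b (ei a c).
  have {}H := H _ _; rewrite -(subrK (\int[mu]_(y in `[a, b]) (1 - eta y)) (\int[mu]_(y in `[a, c]) (1 - eta y))).
  rewrite H ?bnd_simp// addrC Rintegral_itv_obnd_cbnd//.
  by apply: integrableS (ei b c) => //; exact: subset_itv_oc_cc.
have le1 (a : R) : \int[mu]_(y in `[a, a + d]) (1 - eta y) <= d.
  have E : \int[mu]_(y in `[a, a + d]) (1 : R) = d.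
    by rewrite Rintegral_itv_cst ?mul1r; lra.
  rewrite -[leRHS]E.
  apply: le_Rintegral => //; first exact: cst_integrable.
  by move=> x _; have := e01 x; lra.
rewrite (split y1 (y1 + d) y2); [|lra|lra].
rewrite (split (y1 + d) (y2 - d) y2); [|lra|lra].
have -> : \int[mu]_(y in `[(y1 + d), (y2 - d)]) (1 - eta y) = 0.
  rewrite (@eq_Rintegral _ _ _ mu _ (cst 0)).
    by rewrite Rintegral_itv_cst ?mul0r//; lra.
  by move=> x; rewrite inE/= in_itv/= => /e1 ->; rewrite subrr.
have h1 := le1 y1; have h2 := le1 (y2 - d); rewrite subrK in h2; lra.
Qed.

(* [J y] is the [x]-integral of [M] against the derivative [a - b] of a cutoff
   of [x1, x2]. *)
Lemma iterated_flux (M : R -> R -> R) (a b eta : R -> R) (x1 x2 y1 y2 d om : R) :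
  0 < d -> 2 * d <= x2 - x1 -> 2 * d <= y2 - y1 ->
  (forall x y, `|M x y| <= 1) ->
  (forall y, y1 <= y <= y2 -> measurable_fun `[x1, x2] (M ^~ y)) ->
  (forall x y, x1 <= x <= x1 + d -> y1 <= y <= y2 -> `|M x y - M x1 y| <= om) ->
  (forall x y, x2 - d <= x <= x2 -> y1 <= y <= y2 -> `|M x y - M x2 y| <= om) ->
  mu.-integrable `[y1, y2] (EFin \o (M x1)) ->
  mu.-integrable `[y1, y2] (EFin \o (M x2)) ->
  [/\ continuous a /\ continuous b,
      forall x, 0 <= a x /\ 0 <= b x,
      forall x, a x != 0 -> x1 <= x <= x1 + d,
      forall x, b x != 0 -> x2 - d <= x <= x2 &
      \int[mu]_(x in `[x1, x2]) a x = 1 /\ \int[mu]_(x in `[x1, x2]) b x = 1] ->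
  continuous eta -> (forall y, 0 <= eta y <= 1) ->
  (forall y, y1 + d <= y <= y2 - d -> eta y = 1) ->
  let J y := \int[mu]_(x in `[x1, x2]) (M x y * (a x - b x)) in
  mu.-integrable `[y1, y2] (EFin \o (fun y => J y * eta y)) ->
  `|\int[mu]_(y in `[y1, y2]) (J y * eta y) +
    (\int[mu]_(y in `[y1, y2]) M x2 y - \int[mu]_(y in `[y1, y2]) M x1 y)|
    <= 2 * om * (y2 - y1) + 4 * d.
Proof.
move=> d0 dx dy M1 mM om1 om2 iM1 iM2 [[ca cb] ab0 sa sb [ia ib]] ce e01 e1 J Ji.
have JD y : y1 <= y <= y2 -> `|J y - (M x1 y - M x2 y)| <= 2 * om.
  move=> yy.
  have [Mai Ma] := weighted_average_close (mM y yy) (M1 ^~ y) ca (fun x => proj1 (ab0 x)) ia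
    (fun x _ ax => om1 x y (sa x ax) yy).
  have [Mbi Mb] := weighted_average_close (mM y yy) (M1 ^~ y) cb (fun x => proj2 (ab0 x)) ib
    (fun x _ bx => om2 x y (sb x bx) yy).
  have -> : J y = \int[mu]_(x in `[x1, x2]) (M x y * a x) - \int[mu]_(x in `[x1, x2]) (M x y * b x).
    by rewrite -RintegralB//; apply: eq_Rintegral => x _; rewrite mulrBr.
  by move: Ma Mb; rewrite !ler_norml; qlra.
have iB := integrable_itvB iM2 iM1.
rewrite -RintegralB// -RintegralD//.
have ie : mu.-integrable `[y1, y2] (EFin \o (fun y => 1 - eta y)).
  apply: continuous_integrable_itv; apply: continuous_subspaceT => y.
  by apply: continuousB; [exact: cvg_cst|exact: ce].
have i2e : mu.-integrable `[y1, y2] (EFin \o (fun y => 2 * (1 - eta y))).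
  exact: integrable_itvZ.
(* The integrand on the left is (J - (M x1 - M x2)) eta - (M x1 - M x2) (1 - eta); here |J - (M x1 -
   M x2)| <= 2 om and |M x1 - M x2| <= 2. *)
apply: (@le_trans _ _ (\int[mu]_(y in `[y1, y2]) (2 * om + 2 * (1 - eta y)))).
  apply: norm_Rintegral_itv_le.
  - exact: integrable_itvD Ji iB.
  - exact: integrable_itvD (cst_integrable y1 y2 (2 * om)) i2e.
  - move=> y yy; have := JD y yy; have /andP[h0 h1] := e01 y.
    have := M1 x1 y; have := M1 x2 y.
    rewrite !ler_norml => /andP[? ?] /andP[? ?] /andP[? ?].
    have om0 : 0 <= om by apply: le_trans (om1 x1 y _ yy); rewrite ?normr_ge0//; qlra.
    by apply/andP; split; nra.
rewrite RintegralD//; last exact: cst_integrable.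
rewrite Rintegral_itv_cst; last qlra.
rewrite RintegralZl//.
by have := cutoff_integral ce d0 dy e01 e1; qlra.
Qed.
End flux_line.

(** * Iterated integrals over rectangles *)

Section fubini_rectangle.
Context {R : realType}.
Local Notation mu := (@lebesgue_measure R).
Local Notation mu2 := (@lebesgue_measure R \x @lebesgue_measure R)%E.

Definition rect (x1 x2 y1 y2 : R) : set (R * R) :=
  `[x1, x2]%classic `*` `[y1, y2]%classic.

Lemma measurable_rect (x1 x2 y1 y2 : R) : measurable (rect x1 x2 y1 y2).
Proof. by apply: measurableX; exact: measurable_itv. Qed.

Lemma rect_measure_lty (x1 x2 y1 y2 : R) : (mu2 (rect x1 x2 y1 y2) < +oo)%E.
Proof.
rewrite /rect product_measure1E//.
apply: lte_mul_pinfty => //; last by apply: compact_finite_measure; exact: segment_compact.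
by rewrite ge0_fin_numE//; apply: compact_finite_measure; exact: segment_compact.
Qed.

Lemma bounded_integrable_rect (F : R * R -> R) (x1 x2 y1 y2 C : R) :
  measurable_fun (rect x1 x2 y1 y2) F ->
  (forall q, rect x1 x2 y1 y2 q -> `|F q| <= C) ->
  mu2.-integrable (rect x1 x2 y1 y2) (EFin \o F).
Proof.
move=> mF FC; apply: measurable_bounded_integrable.
- exact: measurable_rect.
- exact: rect_measure_lty.
- exact: mF.
- exists C; split; rewrite ?num_real// => y Cy q Kq.
  by apply: le_trans (ltW Cy); exact: FC.
Qed.

(** Extension by zero reduces the claim to the whole plane. The bound [C] makes every section
    integrable, so that the inner integrals are meaningful at each point of a side and not just at
    almost every one. *)
Lemma fubini_rect (F : R * R -> R) (x1 x2 y1 y2 C : R) :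
  measurable_fun (rect x1 x2 y1 y2) F ->
  (forall q, rect x1 x2 y1 y2 q -> `|F q| <= C) ->
  let Jy y := \int[mu]_(x in `[x1, x2]) F (x, y) in
  let Jx x := \int[mu]_(y in `[y1, y2]) F (x, y) in
  [/\ mu.-integrable `[y1, y2] (EFin \o Jy),
      \int[mu2]_(q in rect x1 x2 y1 y2) F q = \int[mu]_(y in `[y1, y2]) Jy y,
      mu.-integrable `[x1, x2] (EFin \o Jx) &
      \int[mu2]_(q in rect x1 x2 y1 y2) F q = \int[mu]_(x in `[x1, x2]) Jx x].
Proof.
move=> mF FC Jy Jx.
set K := rect x1 x2 y1 y2 in mF FC *.
have mK : measurable K by exact: measurable_rect.
have Fi : mu2.-integrable K (EFin \o F) by exact: bounded_integrable_rect mF FC.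
pose f := ((EFin \o F) \_ K)%E.
have fi : mu2.-integrable setT f by apply: (proj1 (integrable_mkcond _ _)) Fi; exact: mK.
have mFK : measurable_fun setT (F \_ K) by apply/(measurable_restrictT _ mK).
have fE q : f q = ((F \_ K) q)%:E.
  by rewrite /f /patch; case: ifP.
have KE x y : (x \in `[x1, x2]) -> (y \in `[y1, y2]) -> (F \_ K) (x, y) = F (x, y).
  by move=> xx yy; rewrite patchE mem_set.
have K0 x y : ~ ((x \in `[x1, x2]) /\ (y \in `[y1, y2])) -> (F \_ K) (x, y) = 0.
  by move=> xy; rewrite patchE memNset//.
have my y : measurable_fun setT (fun x => (F \_ K) (x, y)).
  exact: measurableT_comp mFK (measurable_pair2 y).
have mx x : measurable_fun setT (fun y => (F \_ K) (x, y)).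
  exact: measurableT_comp mFK (measurable_pair1 x).
have FKC q : `|(F \_ K) q| <= Num.max C 0.
  rewrite /patch; case: ifP => [|_]; last by rewrite normr0 le_max lexx orbT.
  by rewrite inE => Kq; rewrite le_max FC.
have iFy y : y1 <= y <= y2 -> mu.-integrable `[x1, x2] (EFin \o (fun x => F (x, y))).
  move=> yy.
  have : mu.-integrable `[x1, x2] (EFin \o (fun x => (F \_ K) (x, y))).
    apply: (bounded_integrable_itv (M := Num.max C 0)) => //.
    exact: measurable_funTS (my y).
  by apply: eq_integrable => // x; rewrite inE /= => xx; rewrite KE.
have Ey y : (\int[mu]_x f (x, y))%E = ((EFin \o Jy) \_ `[y1, y2]%classic) y.
  rewrite patchE; case: ifPn => [|]; rewrite ?inE ?notin_setE/= => yy.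
    rewrite /Jy /Rintegral fineK; last exact: integrable_fin_num (iFy y yy).
    rewrite [in RHS]integral_mkcond; apply: eq_integral => x _.
    rewrite fE [RHS]patchE; case: ifPn => [|]; rewrite ?inE ?notin_setE/= => xx.
      by rewrite KE.
    by rewrite K0// => -[].
  by rewrite -[RHS](integral0 mu setT); apply: eq_integral => x _; rewrite fE K0// => -[].
have Ex x : (\int[mu]_y f (x, y))%E = ((EFin \o Jx) \_ `[x1, x2]%classic) x.
  rewrite patchE; case: ifPn => [|]; rewrite ?inE ?notin_setE/= => xx.
    have iF : mu.-integrable `[y1, y2] (EFin \o (fun y => F (x, y))).
      have : mu.-integrable `[y1, y2] (EFin \o (fun y => (F \_ K) (x, y))).
        apply: (bounded_integrable_itv (M := Num.max C 0)) => //.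
        exact: measurable_funTS (mx x).
      by apply: eq_integrable => // y; rewrite inE /= => yy; rewrite KE.
    rewrite /Jx /Rintegral fineK; last exact: integrable_fin_num iF.
    rewrite [in RHS]integral_mkcond; apply: eq_integral => y _.
    rewrite fE [RHS]patchE; case: ifPn => [|]; rewrite ?inE ?notin_setE/= => yy.
      by rewrite KE.
    by rewrite K0// => -[].
  by rewrite -[RHS](integral0 mu setT); apply: eq_integral => y _; rewrite fE K0// => -[].
have IK : (\int[mu2]_(q in K) (F q)%:E = \int[mu2]_q f q)%E by rewrite integral_mkcond.
split.
- have mJ : measurable_fun `[y1, y2]%classic Jy.
    apply/measurable_EFinP.
    apply: (@eq_measurable_fun _ _ _ _ _ (fubini_G mu f)).
      by move=> y yy; rewrite /fubini_G Ey patchE yy.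
    exact: measurable_funTS (measurable_fubini_G fi).
  apply: (bounded_integrable_itv (M := \int[mu]_(x in `[x1, x2]) Num.max C 0)) => // y yy.
  apply: norm_Rintegral_itv_le; [exact: iFy|exact: cst_integrable|].
  by move=> x xx; have := FKC (x, y); rewrite KE.
- rewrite {1}/Rintegral IK -(integral21_prod_meas1 fi) /Rintegral [in RHS]integral_mkcond.
  by congr fine; apply: eq_integral => y _; rewrite /fubini_G Ey.
- apply: (proj2 (integrable_mkcond _ _)) => //.
  by apply: eq_integrable (integrable_fubini_F fi) => // x _; rewrite -Ex.
- rewrite {1}/Rintegral IK -(integral12_prod_meas1 fi) /Rintegral [in RHS]integral_mkcond.
  by congr fine; apply: eq_integral => x _; rewrite /fubini_F Ex.
Qed.
End fubini_rectangle.

(** * Uniform continuity along a segment *)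

Section uniform_closeness.
Context {R : realType}.

(** Tube argument: compactness of the segment makes the neighbourhoods of [x0] obtained from
    continuity at each of its points uniform in [y]. *)
Lemma edge_uniform (M : R -> R -> R) (x0 y1 y2 om : R) : 0 < om ->
  (forall y, y1 <= y <= y2 -> {for (x0, y), continuous (fun q : R * R => M q.1 q.2)}) ->
  exists2 d0 : R, 0 < d0 & forall x y, `|x - x0| < d0 -> y1 <= y <= y2 ->
    `|M x y - M x0 y| <= om.
Proof.
move=> om0 cM.
have om20 : 0 < om / 2 by lra.
have /compact_near_coveringP := @segment_compact R y1 y2.
move=> /(_ R (nbhs x0) (fun x y => `|M x y - M x0 y| <= om) _) [].
  move=> y; rewrite /= in_itv/= => yy.
  have /cvgrPdist_le/(_ _ om20)/nbhs_ballP[e /= e0 He] := cM y yy.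
  near=> y' x => /=.
  have xe : `|x0 - x| < e by near: x; exact: (@cvgr_dist_lt _ _ _ _ _ id x0).
  have ye : `|y - y'| < e by near: y'; exact: (@cvgr_dist_lt _ _ _ _ _ id y).
  have h1 := He (x, y') (conj xe ye).
  have h2 : `|M x0 y - M x0 y'| <= om / 2.
    by apply: (He (x0, y')); split => //; rewrite /ball/= subrr normr0.
  move: h1 h2; rewrite /= !ler_norml; lra.
move=> d /= d0 H; exists d => // x y xd yy.
by apply: H; rewrite /ball /= ?in_itv// distrC.
Unshelve. all: by end_near. Qed.
End uniform_closeness.

(** * Flux through a rectangle, tested by a product of cutoffs *)

Section plane_flux.
Context {R : realType}.
Local Notation mu := (@lebesgue_measure R).
Local Notation mu2 := (@lebesgue_measure R \x @lebesgue_measure R)%E.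
Implicit Types (U : set (R * R)) (N : R * R -> R).

Lemma continuous_section1 N (x y : R) : {for (x, y), continuous N} ->
  {for x, continuous (fun x => N (x, y))}.
Proof.
move=> cN; apply: (@continuous_comp _ _ _ (fun x => (x, y)) N) => //.
by apply: (@cvg_pair _ _ _ (nbhs x) (nbhs x) (nbhs y) _ _ _ id (fun=> y)); [exact: cvg_id|exact: cvg_cst].
Qed.

Lemma continuous_section2 N (x y : R) : {for (x, y), continuous N} ->
  {for y, continuous (fun y => N (x, y))}.
Proof.
move=> cN; apply: (@continuous_comp _ _ _ (fun y => (x, y)) N) => //.
by apply: (@cvg_pair _ _ _ (nbhs y) (nbhs x) (nbhs y) _ _ _ (fun=> x) id); [exact: cvg_cst|exact: cvg_id].
Qed.

Lemma continuous_mul_at (f g : R -> R) (x : R) : {for x, continuous f} ->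
  {for x, continuous g} -> {for x, continuous (fun x => f x * g x)}.
Proof. by move=> cf cg; apply: continuousM. Qed.

Lemma continuous_itv_bounded (w : R -> R) (a b : R) : continuous w ->
  exists M, forall x, a <= x <= b -> `|w x| <= M.
Proof.
move=> cw.
have /compact_bounded[M [_ HM]] :=
  continuous_compact (continuous_subspaceT cw) (@segment_compact R a b).
exists (M + 1) => x xab; apply: (HM (M + 1)); first by rewrite ltrDl.
by exists x => //; rewrite /= in_itv.
Qed.

Lemma Rintegral_support U K (F : R * R -> R) : K `<=` U ->
  (forall q, ~ K q -> F q = 0) ->
  \int[mu2]_(q in U) F q = \int[mu2]_(q in K) F q.
Proof.
move=> KU F0; rewrite Rintegral_mkcond [RHS]Rintegral_mkcond.
congr (Rintegral _ _ _); apply/funext => q; rewrite !patchE.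
case: ifPn => [|]; rewrite ?inE ?notin_setE => Uq; case: ifPn => [|]; rewrite ?inE ?notin_setE => Kq //.
  by rewrite F0.
by exfalso; apply: Uq; exact: KU.
Qed.

Lemma test_function_rect U (phi : R * R -> R) (x1 x2 y1 y2 : R) :
  rect x1 x2 y1 y2 `<=` U -> (forall k, Ck k phi) ->
  (forall q, phi q != 0 -> x1 < q.1 < x2 /\ y1 < q.2 < y2) ->
  test_function U phi.
Proof.
move=> rU Cphi sphi; split => //.
have rc : compact (rect x1 x2 y1 y2) by apply: compact_setX; exact: segment_compact.
have cr : closed (rect x1 x2 y1 y2).
  by apply: compact_closed => //; exact: norm_hausdorff.
have sub : closure [set q | phi q != 0] `<=` rect x1 x2 y1 y2.
  rewrite [X in _ `<=` X](closure_id _).1//; apply: closure_subset => q /sphi[].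
  move=> /andP[? ?] /andP[? ?].
  by split; rewrite /= in_itv/=; apply/andP; split; apply: ltW.
split; last exact: subset_trans sub rU.
by apply: subclosed_compact sub => //; exact: closed_closure.
Qed.

Definition flux N1 N2 (x1 x2 y1 y2 : R) : R :=
  (\int[mu]_(y in `[y1, y2]) N1 (x2, y) - \int[mu]_(y in `[y1, y2]) N1 (x1, y)) +
  (\int[mu]_(x in `[x1, x2]) N2 (x, y2) - \int[mu]_(x in `[x1, x2]) N2 (x, y1)).

(** [phi] is a product of two cutoffs. Its gradient is concentrated near the sides of the rectangle
    and points inwards, whence the plus sign before the flux. The support and the integral of [phi]
    are recorded in order to control the integral of H phi afterwards. *)
Lemma flux_approx U N1 N2 (x1 x2 y1 y2 e : R) : open U ->
  (forall q, U q -> {for q, continuous N1} /\ {for q, continuous N2}) ->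
  (forall q, `|N1 q| <= 1 /\ `|N2 q| <= 1) ->
  rect x1 x2 y1 y2 `<=` U -> x1 < x2 -> y1 < y2 -> 0 < e ->
  exists phi, [/\ test_function U phi, continuous phi /\ (forall q, 0 <= phi q <= 1),
    forall q, phi q != 0 -> x1 < q.1 < x2 /\ y1 < q.2 < y2,
    `|\int[mu2]_(q in rect x1 x2 y1 y2) phi q - (x2 - x1) * (y2 - y1)| <= e &
    `|\int[mu2]_(q in U) (N1 q * d1 phi q + N2 q * d2 phi q) + flux N1 N2 x1 x2 y1 y2| <= e].
Proof.
move=> oU cN N1b rU x12 y12 e0.
have inU x y : x1 <= x <= x2 -> y1 <= y <= y2 -> U (x, y).
  by move=> xx yy; apply: rU; split; rewrite /= in_itv.
pose B := 1 + (x2 - x1) + (y2 - y1).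
have B1 : 1 < B by rewrite /B; lra.
(* The two edge estimates cost 2 om (y2 - y1) + 2 om (x2 - x1) + 8 d in all; this is at most [e]
   because of [B] and of the bound d <= e / 16 below. *)
pose om := e / (4 * B).
have om0 : 0 < om by rewrite divr_gt0//; lra.
have omB : 4 * (om * B) = e.
  have B0 : B != 0 by rewrite gt_eqF//; lra.
  by rewrite /om; field.

have edge1 N x : (forall q, U q -> {for q, continuous N}) -> x1 <= x <= x2 ->
    exists2 d0 : R, 0 < d0 & forall x' y, `|x' - x| < d0 -> y1 <= y <= y2 ->
      `|N (x', y) - N (x, y)| <= om.
  move=> cN' xx; apply: (@edge_uniform _ (fun x y => N (x, y))) => // y yy.
  rewrite (_ : (fun q => _) = N); last by apply/funext => -[].
  by apply: cN'; exact: inU.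
have edge2 N y : (forall q, U q -> {for q, continuous N}) -> y1 <= y <= y2 ->
    exists2 d0 : R, 0 < d0 & forall y' x, `|y' - y| < d0 -> x1 <= x <= x2 ->
      `|N (x, y') - N (x, y)| <= om.
  move=> cN' yy; apply: (@edge_uniform _ (fun y x => N (x, y))) => // x xx.
  apply: (@continuous_comp _ _ _ (fun q : R * R => (q.2, q.1)) N); last by apply: cN'; exact: inU.
  exact: (cvg_pair cvg_snd cvg_fst).
have cN1 q : U q -> {for q, continuous N1} by move=> /cN[].
have cN2 q : U q -> {for q, continuous N2} by move=> /cN[].
have [da da0 Hda] := edge1 N1 x1 cN1 ltac:(lra).
have [db db0 Hdb] := edge1 N1 x2 cN1 ltac:(lra).
have [dc dc0 Hdc] := edge2 N2 y1 cN2 ltac:(lra).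
have [dd dd0 Hdd] := edge2 N2 y2 cN2 ltac:(qlra).
(* [d] is taken below all of these: the first four keep the oscillation of the field on the end
   strips below [om], the next two make the strips fit into the sides, and [om] controls the defect
   of area, which is at most 2 d B. *)
pose s := [:: da / 2; db / 2; dc / 2; dd / 2; (x2 - x1) / 4; (y2 - y1) / 4; e / 16; om].
have [d d0 Hd] : exists2 d : R, 0 < d & forall z, z \in s -> d <= z.
  have : all (fun z => 0 < z) s by rewrite /= om0 !divr_gt0//; qlra.
  elim: s => [|z s IH] /=; first by exists 1.
  move=> /andP[z0 /IH[d d0 Hd]]; exists (Num.min z d); first by rewrite lt_min z0.
  move=> w; rewrite inE => /predU1P[->|/Hd dw]; rewrite ge_min ?lexx//.
  by rewrite dw orbT.
have dda : d < da by have := Hd (da / 2); rewrite !inE eqxx ?orbT; move=> /(_ isT); qlra.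
have ddb : d < db by have := Hd (db / 2); rewrite !inE eqxx ?orbT; move=> /(_ isT); qlra.
have ddc : d < dc by have := Hd (dc / 2); rewrite !inE eqxx ?orbT; move=> /(_ isT); qlra.
have ddd : d < dd by have := Hd (dd / 2); rewrite !inE eqxx ?orbT; move=> /(_ isT); qlra.
have dx : 2 * d <= x2 - x1.
  by have := Hd ((x2 - x1) / 4); rewrite !inE eqxx ?orbT; move=> /(_ isT); qlra.
have dy : 2 * d <= y2 - y1.
  by have := Hd ((y2 - y1) / 4); rewrite !inE eqxx ?orbT; move=> /(_ isT); qlra.
have de : 16 * d <= e.
  by have := Hd (e / 16); rewrite !inE eqxx ?orbT; move=> /(_ isT); qlra.
have dom : d <= om by apply: Hd; rewrite !inE eqxx ?orbT.
clear Hd s.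
have xx1 : x1 <= x1 <= x2 by qlra.
have xx2 : x1 <= x2 <= x2 by qlra.
have yy1 : y1 <= y1 <= y2 by qlra.
have yy2 : y1 <= y2 <= y2 by qlra.
have {}Hda x y : x1 <= x <= x1 + d -> y1 <= y <= y2 -> `|N1 (x, y) - N1 (x1, y)| <= om.
  by move=> xx; apply: Hda; rewrite ger0_norm; qlra.
have {}Hdb x y : x2 - d <= x <= x2 -> y1 <= y <= y2 -> `|N1 (x, y) - N1 (x2, y)| <= om.
  by move=> xx; apply: Hdb; rewrite ler0_norm; qlra.
have {}Hdc y x : y1 <= y <= y1 + d -> x1 <= x <= x2 -> `|N2 (x, y) - N2 (x, y1)| <= om.
  by move=> yy; apply: Hdc; rewrite ger0_norm; qlra.
have {}Hdd y x : y2 - d <= y <= y2 -> x1 <= x <= x2 -> `|N2 (x, y) - N2 (x, y2)| <= om.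
  by move=> yy; apply: Hdd; rewrite ler0_norm; qlra.
have [chi [a [b [sc [[c01 csupp c1 dchi] ab]]]]] := cutoff_exists d0 dx.
have [eta [a' [b' [se [[e01 esupp e1 deta] ab']]]]] := cutoff_exists d0 dy.
have [[ca cb] ab0 sa sb _] := ab; have [[ca' cb'] ab0' sa' sb' _] := ab'.
have cc := smooth_continuous sc; have ce := smooth_continuous se.
have ctensor (f g : R -> R) : continuous f -> continuous g -> measurable_fun setT (tensor f g).
  move=> cf cg; apply: open_continuous_measurable_plane; first exact: openT.
  by move=> q _; exact: continuous_tensor.
have mN N : (forall q, U q -> {for q, continuous N}) -> measurable_fun (rect x1 x2 y1 y2) N.
  move=> cN'; apply: measurable_funS rU _; first exact: open_measurable_plane.
  exact: open_continuous_measurable_plane.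
have dsupp x : derive1 chi x != 0 -> x1 <= x <= x2.
  rewrite dchi => abx; have [a0|/sa] := eqVneq (a x) 0; last qlra.
  have [b0|/sb] := eqVneq (b x) 0; last qlra.
  by move: abx; rewrite a0 b0 subrr eqxx.
have dsupp' y : derive1 eta y != 0 -> y1 <= y <= y2.
  rewrite deta => abx; have [a0|/sa'] := eqVneq (a' y) 0; last qlra.
  have [b0|/sb'] := eqVneq (b' y) 0; last qlra.
  by move: abx; rewrite a0 b0 subrr eqxx.
have cab : continuous (fun x => a x - b x).
  by move=> x; apply: continuousB; [exact: ca|exact: cb].
have cab' : continuous (fun x => a' x - b' x).
  by move=> x; apply: continuousB; [exact: ca'|exact: cb'].
pose phi := tensor chi eta.
pose F1 q := N1 q * tensor (fun x => a x - b x) eta q.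
pose F2 q := N2 q * tensor chi (fun y => a' y - b' y) q.
have [C1 HC1] := continuous_itv_bounded x1 x2 cab.
have [C2 HC2] := continuous_itv_bounded y1 y2 cab'.
have mF1 : measurable_fun (rect x1 x2 y1 y2) F1.
  by apply: measurable_funM; [exact: mN|apply: measurable_funTS; exact: ctensor].
have mF2 : measurable_fun (rect x1 x2 y1 y2) F2.
  by apply: measurable_funM; [exact: mN|apply: measurable_funTS; exact: ctensor].
have bF1 q : rect x1 x2 y1 y2 q -> `|F1 q| <= C1.
  case: q => x y [/=]; rewrite !in_itv/= => xx yy.
  rewrite /F1 /tensor/= !normrM (ger0_norm (x := eta y)); last by have /andP[] := e01 y.
  have h1 := HC1 x xx; have h2 := proj1 (N1b (x, y)); have /andP[h3 h4] := e01 y.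
  have h5 : `|a x - b x| * eta y <= C1.
    by apply: le_trans h1; apply: ler_piMr.
  by apply: le_trans h5; apply: ler_piMl => //; apply: mulr_ge0.
have bF2 q : rect x1 x2 y1 y2 q -> `|F2 q| <= C2.
  case: q => x y [/=]; rewrite !in_itv/= => xx yy.
  rewrite /F2 /tensor/= !normrM (ger0_norm (x := chi x)); last by have /andP[] := c01 x.
  have h1 := HC2 y yy; have h2 := proj2 (N1b (x, y)); have /andP[h3 h4] := c01 x.
  have h5 : chi x * `|a' y - b' y| <= C2.
    by apply: le_trans h1; apply: ler_piMl.
  by apply: le_trans h5; apply: ler_piMl => //; apply: mulr_ge0.
exists phi; split.
- apply: (test_function_rect rU); first by move=> k; exact: Ck_tensor.
  move=> q; rewrite /phi /tensor mulf_eq0 negb_or => /andP[h1 h2].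
  by split; [exact: csupp|exact: esupp].
- split; first exact: continuous_tensor.
  move=> q; rewrite /phi /tensor; have /andP[? ?] := c01 q.1; have /andP[? ?] := e01 q.2.
  by rewrite mulr_ge0//= mulr_ile1.
- move=> q; rewrite /phi /tensor mulf_eq0 negb_or => /andP[h1 h2].
  by split; [exact: csupp|exact: esupp].
- have phi1 q : rect x1 x2 y1 y2 q -> `|phi q| <= 1.
    move=> _; rewrite /phi /tensor; have /andP[? ?] := c01 q.1; have /andP[? ?] := e01 q.2.
    by rewrite ger0_norm ?mulr_ge0// mulr_ile1.
  have mphi : measurable_fun (rect x1 x2 y1 y2) phi by apply: measurable_funTS; exact: ctensor.
  have [_ -> _ _] := fubini_rect mphi phi1.
  have ichi : mu.-integrable `[x1, x2] (EFin \o chi).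
    by apply: continuous_integrable_itv; exact: continuous_subspaceT.
  have ieta : mu.-integrable `[y1, y2] (EFin \o eta).
    by apply: continuous_integrable_itv; exact: continuous_subspaceT.
  have -> : \int[mu]_(y in `[y1, y2]) (\int[mu]_(x in `[x1, x2]) phi (x, y)) =
     (\int[mu]_(x in `[x1, x2]) chi x) * \int[mu]_(y in `[y1, y2]) eta y.
    rewrite -RintegralZl//; apply: eq_Rintegral => y _.
    by rewrite -RintegralZr.
  have near1 (g : R -> R) (z1 z2 : R) : continuous g -> 2 * d <= z2 - z1 ->
      (forall y, 0 <= g y <= 1) -> (forall y, z1 + d <= y <= z2 - d -> g y = 1) ->
      z2 - z1 - 2 * d <= \int[mu]_(y in `[z1, z2]) g y <= z2 - z1.
    move=> cg dz g01 g1.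
    have ig : mu.-integrable `[z1, z2] (EFin \o g).
      by apply: continuous_integrable_itv; exact: continuous_subspaceT.
    have := cutoff_integral cg d0 dz g01 g1.
    rewrite RintegralB//; last exact: cst_integrable.
    have : 0 <= \int[mu]_(y in `[z1, z2]) (1 - g y).
      by apply: Rintegral_ge0 => y _; have := g01 y; qlra.
    rewrite RintegralB//; last exact: cst_integrable.
    by rewrite Rintegral_itv_cst; move: dz d0; clear; lra.
  have /andP[hx1 hx2] := near1 chi x1 x2 cc dx c01 c1.
  have /andP[hy1 hy2] := near1 eta y1 y2 ce dy e01 e1.
  move: hx1 hx2 hy1 hy2; set X := Rintegral _ _ _; set Y := Rintegral _ _ _ => hx1 hx2 hy1 hy2.
  have dB : d * B <= om * B by apply: ler_wpM2r => //; qlra.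
  move: omB dB hx1 hx2 hy1 hy2 d0 dx dy; rewrite /B ler_norml; clear => *; apply/andP; split; nra.
- have -> : \int[mu2]_(q in U) (N1 q * d1 phi q + N2 q * d2 phi q) =
      \int[mu2]_(q in rect x1 x2 y1 y2) (F1 q + F2 q).
    have phiE q : N1 q * d1 phi q + N2 q * d2 phi q = F1 q + F2 q.
      rewrite /d1 /d2; have [_ ->] := d1_tensor eta q sc; have [_ ->] := d2_tensor chi q se.
      by rewrite dchi deta.
    rewrite (Rintegral_support rU).
      by apply: eq_Rintegral => q _; exact: phiE.
    move=> [x y] nr; rewrite phiE /F1 /F2 /tensor/= -dchi -deta.
    have E1 : derive1 chi x * eta y = 0.
      apply/eqP; rewrite mulf_eq0; apply: contra_notT nr; rewrite negb_or => /andP[/dsupp h1 /esupp h2].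
      by move: h1 h2; clear; split; rewrite /= in_itv/=; lra.
    have E2 : chi x * derive1 eta y = 0.
      apply/eqP; rewrite mulf_eq0; apply: contra_notT nr; rewrite negb_or => /andP[/csupp h1 /dsupp' h2].
      by move: h1 h2; clear; split; rewrite /= in_itv/=; lra.
    by rewrite E1 E2 !mulr0 addr0.
  rewrite RintegralD; first last.
  + exact: bounded_integrable_rect mF2 bF2.
  + exact: bounded_integrable_rect mF1 bF1.
  + exact: measurable_rect.
  have [iJ1 -> _ _] := fubini_rect mF1 bF1.
  have [_ _ iJ2 ->] := fubini_rect mF2 bF2.
  have cs1 N y : (forall q, U q -> {for q, continuous N}) -> y1 <= y <= y2 ->
      {within `[x1, x2], continuous (fun x => N (x, y))}.
    move=> cN' yy; apply: continuous_in_subspaceT => x; rewrite inE/= in_itv/= => xx.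
    by apply: continuous_section1; apply: cN'; exact: inU.
  have cs2 N x : (forall q, U q -> {for q, continuous N}) -> x1 <= x <= x2 ->
      {within `[y1, y2], continuous (fun y => N (x, y))}.
    move=> cN' xx; apply: continuous_in_subspaceT => y; rewrite inE/= in_itv/= => yy.
    by apply: continuous_section2; apply: cN'; exact: inU.
  have JE1 y : y1 <= y <= y2 -> \int[mu]_(x in `[x1, x2]) F1 (x, y) =
     \int[mu]_(x in `[x1, x2]) (N1 (x, y) * (a x - b x)) * eta y.
    move=> yy; rewrite -RintegralZr//; last first.
      apply: continuous_integrable_itv; apply: continuous_in_subspaceT => x; rewrite inE/= in_itv/= => xx.
      exact: continuous_mul_at (continuous_section1 (cN1 _ (inU x y xx yy))) (cab x).
    by apply: eq_Rintegral => x _; rewrite /F1 /tensor/= mulrA.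
  have JE2 x : x1 <= x <= x2 -> \int[mu]_(y in `[y1, y2]) F2 (x, y) =
     \int[mu]_(y in `[y1, y2]) (N2 (x, y) * (a' y - b' y)) * chi x.
    move=> xx; rewrite -RintegralZr//; last first.
      apply: continuous_integrable_itv; apply: continuous_in_subspaceT => y; rewrite inE/= in_itv/= => yy.
      exact: continuous_mul_at (continuous_section2 (cN2 _ (inU x y xx yy))) (cab' y).
    by apply: eq_Rintegral => y _; rewrite /F2 /tensor/= mulrAC -mulrA.
  have H1 := @iterated_flux R (fun x y => N1 (x, y)) a b eta x1 x2 y1 y2 d om d0 dx dy
    (fun x y => proj1 (N1b (x, y)))
    (fun y yy => subspace_continuous_measurable_fun (measurable_itv _) (cs1 N1 y cN1 yy))
    Hda Hdb (continuous_integrable_itv (cs2 N1 x1 cN1 xx1))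
    (continuous_integrable_itv (cs2 N1 x2 cN1 xx2)) ab ce e01 e1.
  have H2 := @iterated_flux R (fun y x => N2 (x, y)) a' b' chi y1 y2 x1 x2 d om d0 dy dx
    (fun y x => proj2 (N1b (x, y)))
    (fun x xx => subspace_continuous_measurable_fun (measurable_itv _) (cs2 N2 x cN2 xx))
    Hdc Hdd (continuous_integrable_itv (cs1 N2 y1 cN2 yy1))
    (continuous_integrable_itv (cs1 N2 y2 cN2 yy2)) ab' cc c01 c1.
  have eJ1 : mu.-integrable `[y1, y2] (EFin \o (fun y =>
     \int[mu]_(x in `[x1, x2]) (N1 (x, y) * (a x - b x)) * eta y)).
    by apply: eq_integrable iJ1 => // y; rewrite inE/= in_itv/= => yy; rewrite JE1.
  have eJ2 : mu.-integrable `[x1, x2] (EFin \o (fun x =>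
     \int[mu]_(y in `[y1, y2]) (N2 (x, y) * (a' y - b' y)) * chi x)).
    by apply: eq_integrable iJ2 => // x; rewrite inE/= in_itv/= => xx; rewrite JE2.
  have {}H1 := H1 eJ1; have {}H2 := H2 eJ2.
  rewrite (@eq_Rintegral _ _ _ mu _ (fun y =>
     \int[mu]_(x in `[x1, x2]) (N1 (x, y) * (a x - b x)) * eta y)); last first.
    by move=> y; rewrite inE/= in_itv/= => yy; rewrite JE1.
  rewrite (@eq_Rintegral _ _ _ mu `[x1, x2]%classic (fun x =>
     \int[mu]_(y in `[y1, y2]) (N2 (x, y) * (a' y - b' y)) * chi x)); last first.
    by move=> x; rewrite inE/= in_itv/= => xx; rewrite JE2.
  move: H1 H2; rewrite /flux; move: (Rintegral _ _ _) => I1.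
  move: (Rintegral _ _ _) (Rintegral _ _ _) => I2 I3.
  move: (Rintegral _ _ _) (Rintegral _ _ _) (Rintegral _ _ _) => I4 I5 I6.
  have omB' : om * (y2 - y1) + om * (x2 - x1) <= om * B by rewrite /B; nra.
  by rewrite !ler_norml => H1 H2; move: H1 H2 omB' omB de; clear; lra.
Qed.
End plane_flux.

(** * Comparison of lower integrals up to null sets *)

Section lower_integral.
Local Open Scope ereal_scope.
Import HBNNSimple.
Context d (T : measurableType d) (R : realType) (m : {measure set T -> \bar R}).

(* The functions are not assumed measurable: their library integrals are lower
   integrals. *)
Lemma le_integral_off_null (N : set T) (F1 F2 : T -> \bar R) :
  measurable N -> m N = 0 -> (forall x, 0 <= F1 x) -> (forall x, 0 <= F2 x) ->
  (forall x, ~ N x -> F1 x <= F2 x) -> \int[m]_x F1 x <= \int[m]_x F2 x.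
Proof.
move=> mN N0 F10 F20 F12.
rewrite !ge0_integralTE//; apply: ge_ereal_sup => _ [h hF1 <-].
have -> : sintegral m h = sintegral m (proj_nnsfun h (measurableC mN)).
  have mh : measurable_fun setT (EFin \o h) by exact/measurable_EFinP.
  have h0 x : setT x -> 0 <= (h x)%:E by move=> _; rewrite lee_fin.
  rewrite -!integralT_nnsfun (ge0_negligible_integral mN measurableT mh h0 N0).
  rewrite setTD integral_mkcond; apply: eq_integral => x _.
  have [xN|/negPf xN] := boolP (x \in ~` N); rewrite patchE /= mindicE xN.
    by rewrite mulr1.
  by rewrite mulr0.
apply: ereal_sup_ubound; exists (proj_nnsfun h (measurableC mN)) => //= x.
have [xN|/negPf xN] := boolP (x \in ~` N); rewrite mindicE xN ?mulr0//.
rewrite mulr1; apply: le_trans (hF1 x) (F12 x _); exact: set_mem xN.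
Qed.

(** Allows H, which is only known to agree almost everywhere with a Borel function, to be replaced
    by that function under an integral. Positive and negative parts are compared separately. *)
Lemma eq_integral_off_null (N D : set T) (F1 F2 : T -> \bar R) :
  measurable N -> m N = 0 -> (forall x, D x -> ~ N x -> F1 x = F2 x) ->
  \int[m]_(x in D) F1 x = \int[m]_(x in D) F2 x.
Proof.
move=> mN N0 F12.
have aux (G1 G2 : T -> \bar R) : (forall x, 0 <= G1 x) -> (forall x, 0 <= G2 x) ->
    (forall x, D x -> ~ N x -> G1 x = G2 x) ->
    \int[m]_(x in D) G1 x = \int[m]_(x in D) G2 x.
  move=> G10 G20 G12; rewrite integral_mkcond [RHS]integral_mkcond.
  have p0 G x : (forall x, 0 <= G x) -> 0 <= (G \_ D) x.
    by move=> G0; rewrite patchE; case: ifP.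
  have pe x : ~ N x -> (G1 \_ D) x = (G2 \_ D) x.
    by move=> Nx; rewrite !patchE; case: ifPn => //; rewrite inE => Dx; exact: G12.
  by apply/le_anti/andP; split; apply: (le_integral_off_null mN N0) => // x;
    rewrite ?p0// => Nx; rewrite pe.
rewrite integralE [RHS]integralE; congr (_ - _); apply: aux => // x Dx Nx.
  by rewrite !funeposE (F12 x Dx Nx).
by rewrite !funenegE (F12 x Dx Nx).
Qed.

End lower_integral.

(** * Potentials of the flux *)

Section potentials.
Context {R : realType}.
Local Notation mu := (@lebesgue_measure R).
Local Notation mu2 := (@lebesgue_measure R \x @lebesgue_measure R)%E.
Implicit Types (U : set (R * R)) (N : R * R -> R).

Lemma section_primitive (f : R -> R) (a b : R) :
  (forall y, a <= y <= b -> {for y, continuous f}) ->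
  let u y := \int[mu]_(s in `[a, y]) f s in
  (forall y : R, a < y < b -> is_derive y 1 u (f y)) /\
  (forall y1 y2, a <= y1 -> y1 <= y2 -> y2 <= b ->
    \int[mu]_(s in `[y1, y2]) f s = u y2 - u y1).
Proof.
move=> cf u.
have fi : mu.-integrable `[a, b] (EFin \o f).
  apply: continuous_integrable_itv; apply: continuous_in_subspaceT => y.
  by rewrite inE/= in_itv/=; exact: cf.
split=> [y /andP[ay yb]|y1 y2 ay1 y12 y2b].
  have [d1 d2] := continuous_FTC1_closed yb fi ay (cf y ltac:(lra)).
  by apply: DeriveDef; [exact: d1|rewrite -derive1E; exact: d2].
have fi2 : mu.-integrable `[a, y2] (EFin \o f).
  by apply: integrableS fi => //; apply: subset_itvl; rewrite bnd_simp.
rewrite /u Rintegral_itvB// ?bnd_simp// Rintegral_itv_obnd_cbnd//.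
apply: integrableS fi2 => //; apply: subset_itv; rewrite bnd_simp//.
Qed.

Definition mixed_diff (u : R -> R -> R) (x1 x2 y1 y2 : R) : R :=
  (u x2 y2 - u x2 y1) - (u x1 y2 - u x1 y1).

(** Turns the flux into values at the four corners, so that curves can be followed pointwise. The
    potentials are integrals from the lower and from the left side of the square. *)
Lemma flux_potentials U N1 N2 (p : R * R) (r : R) : 0 < r ->
  (forall q, U q -> {for q, continuous N1} /\ {for q, continuous N2}) ->
  rect (p.1 - r) (p.1 + r) (p.2 - r) (p.2 + r) `<=` U ->
  exists u w : R -> R -> R,
  [/\ forall x y : R, `|x - p.1| < r -> `|y - p.2| < r -> is_derive y 1 (u x) (N1 (x, y)),
      forall x y : R, `|x - p.1| < r -> `|y - p.2| < r -> is_derive x 1 (fun x => w x y) (N2 (x, y)) &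
      forall x1 x2 y1 y2 : R, p.1 - r < x1 -> x1 <= x2 -> x2 < p.1 + r ->
        p.2 - r < y1 -> y1 <= y2 -> y2 < p.2 + r ->
        flux N1 N2 x1 x2 y1 y2 = mixed_diff u x1 x2 y1 y2 + mixed_diff w x1 x2 y1 y2].
Proof.
move=> r0 cN rU.
have inU x y : `|x - p.1| < r -> p.2 - r <= y <= p.2 + r -> U (x, y).
  by rewrite ltr_norml => xx yy; apply: rU; split; rewrite /= in_itv/=; lra.
have inU' x y : `|y - p.2| < r -> p.1 - r <= x <= p.1 + r -> U (x, y).
  by rewrite ltr_norml => xx yy; apply: rU; split; rewrite /= in_itv/=; lra.
have s1 x (xr : `|x - p.1| < r) := @section_primitive (fun y => N1 (x, y)) (p.2 - r) (p.2 + r)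
  (fun y yy => continuous_section2 (proj1 (cN _ (inU x y xr yy)))).
have s2 y (yr : `|y - p.2| < r) := @section_primitive (fun x => N2 (x, y)) (p.1 - r) (p.1 + r)
  (fun x xx => continuous_section1 (proj2 (cN _ (inU' x y yr xx)))).
exists (fun x y => \int[mu]_(s in `[p.2 - r, y]) N1 (x, s)).
exists (fun x y => \int[mu]_(s in `[p.1 - r, x]) N2 (s, y)).
split.
- by move=> x y xr yr; apply: (proj1 (s1 x xr)); move: yr; rewrite ltr_norml; lra.
- by move=> x y xr yr; apply: (proj1 (s2 y yr)); move: xr; rewrite ltr_norml; lra.
- move=> x1 x2 y1 y2 h1 h2 h3 h4 h5 h6.
  have e1 : `|x1 - p.1| < r by rewrite ltr_norml; lra.
  have e2 : `|x2 - p.1| < r by rewrite ltr_norml; lra.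
  have e3 : `|y1 - p.2| < r by rewrite ltr_norml; qlra.
  have e4 : `|y2 - p.2| < r by rewrite ltr_norml; qlra.
  rewrite /flux /mixed_diff.
  rewrite (proj2 (s1 x1 e1) y1 y2) ?(ltW h4) ?(ltW h6)//.
  rewrite (proj2 (s1 x2 e2) y1 y2) ?(ltW h4) ?(ltW h6)//.
  rewrite (proj2 (s2 y1 e3) x1 x2) ?(ltW h1) ?(ltW h3)//.
  rewrite (proj2 (s2 y2 e4) x1 x2) ?(ltW h1) ?(ltW h3)//.
  ring.
Qed.
End potentials.

(** * Consequences of the weak equation for the flux *)

Section weak_flux.
Context {R : realType}.
Local Notation mu := (@lebesgue_measure R).
Local Notation mu2 := (@lebesgue_measure R \x @lebesgue_measure R)%E.
Implicit Types (U W : set (R * R)) (theta H : R * R -> R) (p q : R * R).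

Definition N1 theta q := cos (theta q).
Definition N2 theta q := sin (theta q).

Lemma N_continuous theta q : {for q, continuous theta} ->
  {for q, continuous (N1 theta)} /\ {for q, continuous (N2 theta)}.
Proof.
move=> ct; split.
  by apply: (@continuous_comp _ _ _ theta (@cos R)) => //; exact: continuous_cos.
by apply: (@continuous_comp _ _ _ theta (@sin R)) => //; exact: continuous_sin.
Qed.

Lemma N_le1 theta q : `|N1 theta q| <= 1 /\ `|N2 theta q| <= 1.
Proof. by split; rewrite ler_norml ?cos_geN1 ?cos_le1 ?sin_geN1 ?sin_le1. Qed.

(** By the weak equation the integral of H phi is minus that of N . grad phi, hence the flux up to a
    small error, while the integral of [phi] is nearly the area of the rectangle. *)
Lemma weak_flux_bounds W theta H (x1 x2 y1 y2 m M : R) : open W ->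
  (forall q, W q -> {for q, continuous theta}) ->
  (forall q, W q -> {for q, continuous H}) ->
  weak_solution W theta H -> rect x1 x2 y1 y2 `<=` W -> x1 < x2 -> y1 < y2 ->
  (forall q, rect x1 x2 y1 y2 q -> m <= H q <= M) ->
  m * ((x2 - x1) * (y2 - y1)) <= flux (N1 theta) (N2 theta) x1 x2 y1 y2
    <= M * ((x2 - x1) * (y2 - y1)).
Proof.
move=> oW ct cH ws rW x12 y12 HmM.
have cN q : W q -> {for q, continuous (N1 theta)} /\ {for q, continuous (N2 theta)}.
  by move=> /ct; exact: N_continuous.
set F := flux _ _ _ _ _ _; set A := (x2 - x1) * (y2 - y1).
suff main (e : R) : 0 < e -> m * A - e <= F <= M * A + e.
  by apply/andP; split; apply/ler_addgt0Pr => e /main; lra.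
move=> e0.
(* The error [e / B] occurs once from the flux and once, multiplied by |m| or |M|, from the area. *)
pose B := 1 + `|m| + `|M|.
have B0 : 0 < B by rewrite /B; have := normr_ge0 m; have := normr_ge0 M; lra.
have e10 : 0 < e / B by exact: divr_gt0.
have eB : e / B * B = e by rewrite divfK// gt_eqF.
have [phi [tphi [cphi phi01] sphi aphi fphi]] :=
  flux_approx oW cN (N_le1 theta) rW x12 y12 e10.
have := ws phi tphi; rewrite -/(N1 theta) -/(N2 theta).
have mphi : measurable_fun (rect x1 x2 y1 y2) phi.
  apply: measurable_funTS; apply: open_continuous_measurable_plane; first exact: openT.
  by move=> q _; exact: cphi.
have mH : measurable_fun (rect x1 x2 y1 y2) H.
  apply: measurable_funS rW _; first exact: open_measurable_plane.
  exact: open_continuous_measurable_plane.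
have phin q : `|phi q| <= 1 by have /andP[? ?] := phi01 q; rewrite ger0_norm.
have iphi : mu2.-integrable (rect x1 x2 y1 y2) (EFin \o phi).
  by apply: (bounded_integrable_rect (C := 1)).
have iZ k : mu2.-integrable (rect x1 x2 y1 y2) (EFin \o (fun q => k * phi q)).
  apply: (bounded_integrable_rect (C := `|k|)).
    by apply: measurable_funM => //; exact: measurable_cst.
  by move=> q _; rewrite normrM ler_piMr.
have iH : mu2.-integrable (rect x1 x2 y1 y2) (EFin \o (fun q => H q * phi q)).
  apply: (bounded_integrable_rect (C := B)); first exact: measurable_funM.
  move=> q /HmM /andP[h1 h2]; rewrite normrM; apply: le_trans (_ : `|H q| <= _).
    exact: ler_piMr.
  rewrite ler_norml /B; have := ler_norm M; have := ler_norm (- m); rewrite normrN.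
  by have := normr_ge0 m; have := normr_ge0 M; qlra.
have -> : \int[mu2]_(q in W) (H q * phi q) = \int[mu2]_(q in rect x1 x2 y1 y2) (H q * phi q).
  apply: Rintegral_support => // q nr; have [->|/sphi[h1 h2]] := eqVneq (phi q) 0.
    by rewrite mulr0.
  by exfalso; apply: nr; split; rewrite /= in_itv/=; qlra.
have mr := @measurable_rect R x1 x2 y1 y2.
have l1 : \int[mu2]_(q in rect x1 x2 y1 y2) (H q * phi q) <=
          \int[mu2]_(q in rect x1 x2 y1 y2) (M * phi q).
  by apply: le_Rintegral => // q /HmM /andP[_ ?]; apply: ler_wpM2r => //; case/andP: (phi01 q).
have l2 : \int[mu2]_(q in rect x1 x2 y1 y2) (m * phi q) <=
          \int[mu2]_(q in rect x1 x2 y1 y2) (H q * phi q).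
  by apply: le_Rintegral => // q /HmM /andP[? _]; apply: ler_wpM2r => //; case/andP: (phi01 q).
move: l1 l2 aphi fphi; rewrite !RintegralZl// -/F -/A.
move: (Rintegral _ _ _) (Rintegral _ _ _) (Rintegral _ _ _) => I1 I2 I3.
rewrite !ler_norml => l1 l2 /andP[a1 a2] /andP[f1 f2] ws0.
have MI : M * (I2 - A) <= `|M| * (e / B).
  apply: le_trans (ler_norm _) _; rewrite normrM ler_wpM2l// ler_norml; qlra.
have mI : - (m * (I2 - A)) <= `|m| * (e / B).
  apply: le_trans (ler_norm _) _; rewrite normrN normrM ler_wpM2l// ler_norml; qlra.
have E3 : e / B + `|m| * (e / B) + `|M| * (e / B) = e.
  by rewrite -[RHS]eB /B; ring.
have := mulr_ge0 (normr_ge0 M) (ltW e10); have := mulr_ge0 (normr_ge0 m) (ltW e10).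
move: l1 l2 MI mI E3 f1 f2 ws0; rewrite !mulrBr; clear; lra.
Qed.

Lemma continuous_edist p : continuous (Defs.edist p).
Proof.
move=> q; apply: (@continuous_comp _ _ _ (fun q => (q.1 - p.1) ^+ 2 + (q.2 - p.2) ^+ 2) (@Num.sqrt R)).
  apply: cvgD.
    by apply: (@continuous_comp _ _ _ (fun q : R * R => q.1 - p.1) (fun x : R => x ^+ 2));
      [apply: cvgB; [exact: cvg_fst|exact: cvg_cst]|exact: exprn_continuous].
  by apply: (@continuous_comp _ _ _ (fun q : R * R => q.2 - p.2) (fun x : R => x ^+ 2));
      [apply: cvgB; [exact: cvg_snd|exact: cvg_cst]|exact: exprn_continuous].
exact: sqrt_continuous.
Qed.

Lemma open_disc p (r : R) : open (disc p r).
Proof.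
have -> : disc p r = Defs.edist p @^-1` `]-oo, r[.
  by apply/seteqP; split => q; rewrite /disc /= in_itv.
by apply: open_comp => [q _|]; [exact: continuous_edist|exact: interval_open].
Qed.

Definition open_rect (x1 x2 y1 y2 : R) : set (R * R) :=
  `]x1, x2[%classic `*` `]y1, y2[%classic.

(** [f] is the modulus of a Borel representative of H, set to 0 on the exceptional null set and
    outside the disc. Hence f <= |H| holds at every point, as a comparison with suprema over
    circles, themselves null sets, requires. *)
Lemma weak_flux_density W theta H p (r0 : R) : open W ->
  (forall q, W q -> {for q, continuous theta}) ->
  L1loc W H -> weak_solution W theta H -> compactly_contained (disc p r0) W ->
  exists f : R * R -> R, [/\ measurable_fun setT f /\ (forall q, 0 <= f q),
    forall q, f q <= `|H q|,
    mu2.-integrable setT (EFin \o f) &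
    forall x1 x2 y1 y2, x1 < x2 -> y1 < y2 -> rect x1 x2 y1 y2 `<=` disc p r0 ->
     (`|flux (N1 theta) (N2 theta) x1 x2 y1 y2|%:E <=
      \int[mu2]_(q in open_rect x1 x2 y1 y2) (f q)%:E)%E].
Proof.
move=> oW ct [G [mG [N [mN N0 HG]] iG]] ws [cK KW].
have cN q : W q -> {for q, continuous (N1 theta)} /\ {for q, continuous (N2 theta)}.
  by move=> /ct; exact: N_continuous.
set D := disc p r0 in cK KW *.
have DK : D `<=` closure D by exact: subset_closure.
have mD : measurable D by apply: open_measurable_plane; exact: open_disc.
have mW : measurable W by exact: open_measurable_plane.
have mDN : measurable (D `\` N) by exact: measurableD.
pose G0 := G \_ (D `\` N).
have iGK := iG _ cK KW.
have iGD : mu2.-integrable (D `\` N) (EFin \o G).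
  apply: integrableS iGK => //; last by move=> q [/DK].
  rewrite -[closure D]setCK; apply: measurableC; apply: open_measurable_plane.
  by apply: closed_openC; exact: closed_closure.
have mG0 : measurable_fun setT G0.
  apply/(measurable_restrictT _ mDN); apply: measurable_funS mW _ mG.
  by move=> q [/DK/KW].
have iG0 : mu2.-integrable setT (EFin \o G0).
  have : mu2.-integrable setT ((EFin \o G) \_ (D `\` N)).
    by apply: (proj1 (integrable_mkcond _ _)) iGD; exact: mDN.
  by apply: eq_integrable => // q _; rewrite /G0 /= !patchE; case: ifP.
have G0H q : W q -> ~ N q -> D q -> G0 q = H q.
  move=> Wq Nq Dq; rewrite /G0 patchE mem_set//.
  by apply: contrapT => HGq; apply: Nq; apply: HG => /(_ Wq)/esym.
exists (fun q => `|G0 q|); split => //.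
- by split => //; apply: measurableT_comp.
- move=> q; rewrite /G0 patchE; case: ifPn => [|_]; last by rewrite normr0.
  rewrite inE => -[Dq Nq]; rewrite -(G0H q (KW _ (DK _ Dq)) Nq Dq).
  by rewrite /G0 patchE mem_set.
- by have := integrable_abse iG0; apply: eq_integrable.
move=> x1 x2 y1 y2 x12 y12 rD.
have rW : rect x1 x2 y1 y2 `<=` W by move=> q /rD/DK/KW.
set F := flux _ _ _ _ _ _.
have mor : measurable (open_rect x1 x2 y1 y2) by apply: measurableX; exact: measurable_itv.
apply/lee_addgt0Pr => e e0.
have [phi [tphi [cphi phi01] sphi _ fphi]] :=
  flux_approx oW cN (N_le1 theta) rW x12 y12 e0.
have := ws phi tphi; rewrite -/(N1 theta) -/(N2 theta).
have phin q : `|phi q| <= 1 by have /andP[? ?] := phi01 q; rewrite ger0_norm.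
have mphi : measurable_fun setT phi.
  apply: open_continuous_measurable_plane; first exact: openT.
  by move=> q _; exact: cphi.
have -> : \int[mu2]_(q in W) (H q * phi q) = \int[mu2]_(q in W) (G0 q * phi q).
  congr fine; apply: (eq_integral_off_null mN N0) => q Wq Nq; congr EFin.
  have [->|/sphi[h1 h2]] := eqVneq (phi q) 0; first by rewrite !mulr0.
  by rewrite G0H//; apply: rD; split; rewrite /= in_itv/=; qlra.
have iGp : mu2.-integrable setT (EFin \o (fun q => G0 q * phi q)).
  apply: le_integrable iG0 => //.
    by apply/measurable_EFinP; apply: measurable_funM.
  by move=> q _ /=; rewrite lee_fin normrM ler_piMr.
have iGpW : mu2.-integrable W (EFin \o (fun q => G0 q * phi q)).
  by apply: integrableS iGp.
pose I := \int[mu2]_(q in W) (G0 q * phi q); rewrite -/I => wI.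
have II : (`|I|%:E <= \int[mu2]_(q in open_rect x1 x2 y1 y2) (`|G0 q|)%:E)%E.
  rewrite EFin_normr_Rintegral//.
  apply: le_trans (le_abse_integral _ _ _) _ => //; first exact: measurable_int iGpW.
  rewrite integral_mkcond [leRHS]integral_mkcond.
  apply: (le_integral_off_null (N := set0)) => // [q|q|q _].
  - by rewrite patchE; case: ifP.
  - by rewrite patchE; case: ifP => // _; rewrite lee_fin.
  - rewrite !patchE; case: ifPn => [Wq|_]; last by case: ifP => // _; rewrite lee_fin.
    case: ifPn => [_|/negP nq].
      by rewrite /= lee_fin normrM ler_piMr.
    have [->|/sphi[h1 h2]] := eqVneq (phi q) 0; first by rewrite /= mulr0 normr0.
    by exfalso; apply: nq; apply/mem_set; split; rewrite /= in_itv/=; qlra.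
apply: (@le_trans _ _ (`|I|%:E + e%:E)%E); last exact: leeD2r.
rewrite -EFinD lee_fin; move: fphi wI; rewrite -/F.
move: (Rintegral _ _ _) => I2 fphi wI.
have -> : F = (I2 + F) + I by qlra.
by apply: le_trans (ler_normD _ _) _; rewrite addrC lerD2l.
Qed.
End weak_flux.

(** * Characteristic curves *)

Section characteristic_core.
Context {R : realType}.
Implicit Types (P Q H : R * R -> R) (u w : R -> R -> R) (p : R * R).

(** [y] and [y'] may come in either order; the position of [z] is kept as a distance to [y], ready
    for continuity estimates. *)
Lemma mvt_between (f df : R -> R) (a b y y' : R) :
  (forall z : R, a < z < b -> is_derive z 1 f (df z)) -> a < y < b -> a < y' < b ->
  exists2 z, `|z - y| <= `|y' - y| & a < z < b /\ f y' - f y = df z * (y' - y).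
Proof.
move=> df1 yab yab'.
have cont (c d : R) : a < c -> d < b -> {within `[c, d], continuous f}.
  move=> ac db; apply: continuous_in_subspaceT => z; rewrite inE/= in_itv/= => zz.
  apply: differentiable_continuous; apply/derivable1_diffP.
  by have [] := df1 z ltac:(lra).
have [yy|/ltW yy] := leP y y'.
  have [||z] := @MVT_segment _ f df y y' yy.
  - by move=> z; rewrite in_itv/= => zz; apply: df1; lra.
  - by apply: cont; lra.
  rewrite in_itv/= => zz E; exists z; last by split => //; lra.
  by rewrite !ger0_norm; lra.
have [||z] := @MVT_segment _ f df y' y yy.
- by move=> z; rewrite in_itv/= => zz; apply: df1; lra.
- by apply: cont; lra.
rewrite in_itv/= => zz E; exists z; last by split; lra.
by rewrite !ler0_norm; lra.
Qed.

(** The field is an abstract pair [P], [Q] here, so that results obtained for [P] can be transferred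
    to [Q] by exchanging the coordinates. *)
Definition potentials_on P Q u w p (r : R) :=
  (forall x y : R, `|x - p.1| < r -> `|y - p.2| < r -> is_derive y 1 (u x) (P (x, y))) /\
  (forall x y : R, `|x - p.1| < r -> `|y - p.2| < r -> is_derive x 1 (fun x => w x y) (Q (x, y))).

Definition divergence_bounds H u w p (r : R) := forall x1 x2 y1 y2 m M : R,
  p.1 - r < x1 -> x1 < x2 -> x2 < p.1 + r -> p.2 - r < y1 -> y1 < y2 -> y2 < p.2 + r ->
  (forall q, rect x1 x2 y1 y2 q -> m <= H q <= M) ->
  m * ((x2 - x1) * (y2 - y1)) <= mixed_diff u x1 x2 y1 y2 + mixed_diff w x1 x2 y1 y2
    <= M * ((x2 - x1) * (y2 - y1)).

Definition square p (r : R) : set (R * R) := [set q | `|q.1 - p.1| < r /\ `|q.2 - p.2| < r].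

Definition lip_on H p (r K : R) := forall q q', square p r q -> square p r q' ->
  `|H q - H q'| <= K * `|q - q'|.

(** On the rectangle H differs from [H (x, y)] by at most K times the larger side. Corners in any
    order are allowed, since mixed differences and the signed area change sign together. *)
Lemma rect_divergence_close H u w p (r K x x' y y' : R) : 0 <= K ->
  divergence_bounds H u w p r -> lip_on H p r K ->
  square p r (x, y) -> square p r (x', y') ->
  `|mixed_diff u x x' y y' + mixed_diff w x x' y y' - H (x, y) * ((x' - x) * (y' - y))| <=
  K * Num.max `|x' - x| `|y' - y| * (`|x' - x| * `|y' - y|).
Proof.
move=> K0 db lH [/= xr yr] [/= xr' yr'].
have [->|xx] := eqVneq x' x.
  have -> : mixed_diff u x x y y' + mixed_diff w x x y y' - H (x, y) * ((x - x) * (y' - y)) = 0.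
    by rewrite /mixed_diff; ring.
  by rewrite normr0 !mulr_ge0// le_max normr_ge0.
have [->|yy] := eqVneq y' y.
  have -> : mixed_diff u x x' y y + mixed_diff w x x' y y - H (x, y) * ((x' - x) * (y - y)) = 0.
    by rewrite /mixed_diff; ring.
  by rewrite normr0 !mulr_ge0// le_max normr_ge0.
pose B : R := Num.max `|x' - x| `|y' - y|; rewrite -/B.
have main (x1 x2 y1 y2 : R) : x1 < x2 -> y1 < y2 -> `|x1 - p.1| < r -> `|x2 - p.1| < r ->
    `|y1 - p.2| < r -> `|y2 - p.2| < r -> x1 <= x <= x2 -> y1 <= y <= y2 ->
    x2 - x1 = `|x' - x| -> y2 - y1 = `|y' - y| ->
    `|mixed_diff u x1 x2 y1 y2 + mixed_diff w x1 x2 y1 y2 - H (x, y) * ((x2 - x1) * (y2 - y1))| <=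
    K * B * (`|x' - x| * `|y' - y|).
  move=> x12 y12 x1r x2r y1r y2r x12x y12y Ex Ey.
  move: (x1r) (x2r) (y1r) (y2r); rewrite !ltr_norml => h1 h2 h3 h4.
  have Hb q : rect x1 x2 y1 y2 q -> H (x, y) - K * B <= H q <= H (x, y) + K * B.
    case: q => a b [/=]; rewrite !in_itv/= => aa bb.
    have sab : square p r (a, b) by split; rewrite /= ltr_norml; qlra.
    have := lH (a, b) (x, y) sab (conj xr yr).
    have : `|(a, b) - (x, y)| <= B.
      rewrite prod_normE ge_max /B /=; apply/andP; split; rewrite le_max.
        by apply/orP; left; rewrite -Ex ler_norml; qlra.
      by apply/orP; right; rewrite -Ey ler_norml; qlra.
    by move=> /(ler_wpM2l K0) h5 h6; have := le_trans h6 h5; rewrite ler_norml; qlra.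
  have := db x1 x2 y1 y2 _ _ ltac:(qlra) x12 ltac:(qlra) ltac:(qlra) y12 ltac:(qlra) Hb.
  by rewrite -Ex -Ey mulrBl mulrDl ler_norml; qlra.
have anti1 (v : R -> R -> R) (a b c d : R) : mixed_diff v a b c d = - mixed_diff v b a c d by rewrite /mixed_diff; ring.
have anti2 (v : R -> R -> R) (a b c d : R) : mixed_diff v a b c d = - mixed_diff v a b d c by rewrite /mixed_diff; ring.
have [x12|x21|//] := ltgtP x x'; last by move=> E; rewrite E eqxx in xx.
- have [y12|y21|] := ltgtP y y'; last by move=> E; rewrite E eqxx in yy.
  + by apply: main => //; rewrite ?gtr0_norm; qlra.
  + rewrite (anti2 u) (anti2 w) -normrN.
    have -> : - (- mixed_diff u x x' y' y + - mixed_diff w x x' y' y - H (x, y) * ((x' - x) * (y' - y)))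
     = mixed_diff u x x' y' y + mixed_diff w x x' y' y - H (x, y) * ((x' - x) * (y - y')) by ring.
    by apply: main => //; try qlra; [rewrite gtr0_norm; qlra|rewrite ltr0_norm; qlra].
- have [y12|y21|] := ltgtP y y'; last by move=> E; rewrite E eqxx in yy.
  + rewrite (anti1 u) (anti1 w) -normrN.
    have -> : - (- mixed_diff u x' x y y' + - mixed_diff w x' x y y' - H (x, y) * ((x' - x) * (y' - y)))
     = mixed_diff u x' x y y' + mixed_diff w x' x y y' - H (x, y) * ((x - x') * (y' - y)) by ring.
    by apply: main => //; try qlra; [rewrite ltr0_norm; qlra|rewrite gtr0_norm; qlra].
  + rewrite (anti1 u) (anti1 w) (anti2 u) (anti2 w).
    have -> : - - mixed_diff u x' x y' y + - - mixed_diff w x' x y' y - H (x, y) * ((x' - x) * (y' - y))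
     = mixed_diff u x' x y' y + mixed_diff w x' x y' y - H (x, y) * ((x - x') * (y - y')) by ring.
    by apply: main => //; rewrite ?ltr0_norm; qlra.
Qed.

Lemma norm_mul_le (a b A B : R) : `|a| <= A -> `|b| <= B -> `|a * b| <= A * B.
Proof. by move=> aA bB; rewrite normrM ler_pM. Qed.

Lemma continuous_square P (q : R * R) (e : R) : {for q, continuous P} -> 0 < e ->
  exists2 d : R, 0 < d & forall x y, `|x - q.1| < d -> `|y - q.2| < d -> `|P (x, y) - P q| <= e.
Proof.
move=> cN e0; have /cvgrPdist_le/(_ _ e0)/nbhs_ballP[d /= d0 Hd] := cN.
exists d => // x y xd yd; rewrite distrC; apply: Hd.
by split; rewrite /ball/= distrC.
Qed.

(** Flux balance on the rectangle between [c t] and [c s] of height [e]. With dx = Q ds and dy = - P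
    ds, the motion of the two ends of the segment contributes (P_e - P) dy, the horizontal sides (Q
    - Q_e) dx and the interior e H dx. The sum is (1 - P P_e - Q Q_e + e H Q) ds because P^2 + Q^2 =
    1. The variation of H over the height causes the error K e^2. *)
Lemma characteristic_step P Q H u w p (r K : R) (c : R -> R * R) (t e eta : R) :
  0 <= K -> potentials_on P Q u w p r -> divergence_bounds H u w p r -> lip_on H p r K ->
  (forall q, square p r q -> {for q, continuous P}) ->
  (forall q, P q ^+ 2 + Q q ^+ 2 = 1) ->
  is_derive t 1 c (Q (c t), - P (c t)) ->
  square p r (c t) -> square p r ((c t).1, (c t).2 + e) -> e != 0 -> 0 < eta ->
  let D s := u (c s).1 ((c s).2 + e) - u (c s).1 (c s).2 in
  let c_e := ((c t).1, (c t).2 + e) in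
  exists2 d : R, 0 < d & forall s, `|s - t| < d ->
    `|D s - D t - (s - t) * (1 - (P (c t) * P c_e + Q (c t) * Q c_e)
       + e * (H (c t) * Q (c t)))| <= (K * e ^+ 2 + eta) * `|s - t|.
Proof.
move=> K0 [pu pw] db lH cN PQ1 dc sc sce e0 eta0 D c_e.

rewrite {}/c_e; case ctE : (c t) => [x y] in dc sc sce *.
move: sc sce => [/= xr yr] [/= _ yer]; pose c_e : R * R := (x, y + e); rewrite -/c_e.
have Pb q : `|P q| <= 1 /\ `|Q q| <= 1.
  by have := PQ1 q; rewrite !ler_norml => ?; split; apply/andP; split; nra.
(* An upper bound for the sum of the factors of k |s - t| in the estimates [E1] to [E7]. *)
pose G := 16 + `|H (x, y) * e| + K * e ^+ 2.
have G0 : 0 < G.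
  have := normr_ge0 (H (x, y) * e); have := mulr_ge0 K0 (sqr_ge0 e); rewrite /G; lra.
pose k := Num.min 1 (eta / G).
have k0 : 0 < k by rewrite lt_min ltr01 divr_gt0.
have k1 : k <= 1 by rewrite ge_min lexx.
have kG : k * G <= eta by rewrite -ler_pdivlMr// ge_min lexx orbT.
have /is_derive1P/(_ _ k0)[da da0 Hda] := dc.
have sq0 : square p r (x, y) by [].
have sqe : square p r c_e by [].
have [db' db0 Hdb] := continuous_square (cN _ sq0) k0.
have [dc' dc0 Hdc] := continuous_square (cN _ sqe) k0.
have /is_derive1P/(_ _ k0)[dd dd0 Hdd] := pw x y xr yr.
have /is_derive1P/(_ _ k0)[de de0 Hde] := pw x (y + e) xr yer.
pose g1 := r - `|x - p.1|; pose g2 := r - `|y - p.2|; pose g3 := r - `|y + e - p.2|.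
have en0 : 0 < `|e| by rewrite normr_gt0.
have [d0 d00 [Hd0 [Hd1 [Hd2 [Hd3 [Hd4 Hd5]]]]]] : exists2 d0 : R, 0 < d0 &
   [/\ d0 <= db', d0 <= dc' & d0 <= dd] /\ (d0 <= de /\ (d0 <= g1 /\ (d0 <= g2 /\ (d0 <= g3 /\ d0 <= `|e|)))).
  exists (Num.min db' (Num.min dc' (Num.min dd (Num.min de (Num.min g1 (Num.min g2 (Num.min g3 `|e|))))))).
    by rewrite !lt_min db0 dc0 dd0 de0 en0 !subr_gt0 xr yr yer.
  by rewrite !ge_min !lexx !orbT.
(* Each coordinate of the curve moves by at most 2 |s - t|, hence the half. *)
exists (Num.min da (d0 / 2)); first by rewrite lt_min da0/=; qlra.
move=> s; rewrite lt_min => /andP[sda sd0].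
have := Hda s sda; rewrite ctE prod_normE ge_max /= !scale_realE.
rewrite /D ctE /=; case: (c s) => x' y' /= /andP[rx ry].
set De := s - t in sda sd0 rx ry *.
have [_ Q1] := Pb (x, y); have [P1 _] := Pb (x, y).
have [Pe1 Qe1] := Pb c_e.
have dx2 : `|x' - x| <= (1 + k) * `|De|.
  have -> : x' - x = (x' - x - De * Q (x, y)) + De * Q (x, y) by ring.
  apply: le_trans (ler_normD _ _) _; rewrite [leRHS]mulrDl [in leRHS]mul1r [leRHS]addrC.
  by apply: lerD => //; rewrite ?normrN normrM ler_piMr.
have dy2 : `|y' - y| <= (1 + k) * `|De|.
  have -> : y' - y = (y' - y - De * - P (x, y)) - De * P (x, y) by ring.
  apply: le_trans (ler_normB _ _) _; rewrite [leRHS]mulrDl [in leRHS]mul1r [leRHS]addrC.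
  by apply: lerD => //; rewrite ?normrN normrM ler_piMr.
have De0 := normr_ge0 De.
have kD : k * `|De| <= `|De| by rewrite ler_piMl.
have dx3 : `|x' - x| <= 2 * `|De| by qlra.
have dy3 : `|y' - y| <= 2 * `|De| by qlra.
have dxd : `|x' - x| < d0 by move: dx3 sd0; clear; lra.
have dyd : `|y' - y| < d0 by move: dy3 sd0; clear; lra.
have [Hd01 Hd02 Hd03] := Hd0.
have xr' : `|x' - p.1| < r.
  by have := ler_normD (x' - x) (x - p.1); rewrite addrA subrK; move: Hd2 dxd; rewrite /g1; clear; lra.
have yr' : `|y' - p.2| < r.
  by have := ler_normD (y' - y) (y - p.2); rewrite addrA subrK; move: Hd3 dyd; rewrite /g2; clear; lra.
have yer' : `|y' + e - p.2| < r.
  have := ler_normD (y' - y) (y + e - p.2).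
  have -> : y' - y + (y + e - p.2) = y' + e - p.2 by ring.
  by move: Hd4 dyd; rewrite /g3; clear; lra.
have itv z : `|z - p.2| < r -> p.2 - r < z < p.2 + r by rewrite ltr_norml; clear; lra.
have itv' z : p.2 - r < z < p.2 + r -> `|z - p.2| < r by rewrite ltr_norml; clear; lra.
have [z1 hz1 [z1i Az]] := mvt_between (fun z zi => pu x' z xr' (itv' z zi)) (itv _ yer) (itv _ yer').
have [z2 hz2 [z2i Bz]] := mvt_between (fun z zi => pu x' z xr' (itv' z zi)) (itv _ yr) (itv _ yr').
have eyy : y' + e - (y + e) = y' - y by ring.
rewrite eyy in hz1 Az.
have kx : k * `|x' - x| <= 2 * (k * `|De|) by rewrite mulrCA ler_pM2l.
have ky : k * `|y' - y| <= 2 * (k * `|De|) by rewrite mulrCA ler_pM2l.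
have E1 : `|(P (x', z1) - P c_e) * (y' - y)| <= 2 * (k * `|De|).
  apply: le_trans ky; rewrite normrM ler_wpM2r//; apply: Hdc => /=; first exact: lt_le_trans dxd Hd02.
  by apply: le_lt_trans hz1 _; exact: lt_le_trans dyd Hd02.
have E2 : `|(P (x', z2) - P (x, y)) * (y' - y)| <= 2 * (k * `|De|).
  apply: le_trans ky; rewrite normrM ler_wpM2r//; apply: Hdb => /=; first exact: lt_le_trans dxd Hd01.
  by apply: le_lt_trans hz2 _; exact: lt_le_trans dyd Hd01.
have E3 : `|w x' (y + e) - w x (y + e) - (x' - x) * Q c_e| <= 2 * (k * `|De|).
  by apply: le_trans kx; apply: (Hde x'); exact: lt_le_trans dxd Hd1.
have E4 : `|w x' y - w x y - (x' - x) * Q (x, y)| <= 2 * (k * `|De|).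
  by apply: le_trans kx; apply: (Hdd x'); exact: lt_le_trans dxd Hd03.
have sq' : square p r (x', y + e) by [].
have := rect_divergence_close K0 db lH sq0 sq'.
have -> : y + e - y = e by ring.
rewrite (max_idPr _); last exact: le_trans (ltW dxd) Hd5.
move=> E5.
have E5' : K * `|e| * (`|x' - x| * `|e|) <= K * e ^+ 2 * `|De| + k * `|De| * (K * e ^+ 2).
  have -> : K * `|e| * (`|x' - x| * `|e|) = K * e ^+ 2 * `|x' - x|.
    by rewrite -[e ^+ 2]real_normK ?num_real//; ring.
  apply: le_trans (_ : K * e ^+ 2 * ((1 + k) * `|De|) <= _).
    by rewrite ler_wpM2l// mulr_ge0// sqr_ge0.
  by rewrite le_eqVlt; apply/orP; left; apply/eqP; ring.
have E6 : `|(P c_e - P (x, y)) * (y' - y - De * - P (x, y))| <= 2 * (k * `|De|).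
  apply: norm_mul_le => //; apply: le_trans (ler_normB _ _) _; move: Pe1 P1; clear; lra.
have E7 : `|(H (x, y) * e - Q c_e + Q (x, y)) * (x' - x - De * Q (x, y))| <=
    (`|H (x, y) * e| + 2) * (k * `|De|).
  apply: norm_mul_le => //; apply: le_trans (ler_normD _ _) _.
  by have := ler_normB (H (x, y) * e) (Q c_e); move: Q1 Qe1; clear; lra.
have PQ : P (x, y) ^+ 2 + Q (x, y) ^+ 2 = 1 by exact: PQ1.
have kGD : k * `|De| * G <= eta * `|De| by rewrite mulrAC ler_wpM2r.
rewrite -PQ [leRHS]mulrDl.
(* With 1 written as P^2 + Q^2, the error is exactly the signed sum of the seven terms bounded
   above. *)
have id1 : u x' (y' + e) - u x' y' - (u x (y + e) - u x y) -
    De * (P (x, y) ^+ 2 + Q (x, y) ^+ 2 - (P (x, y) * P c_e + Q (x, y) * Q c_e) + e * (H (x, y) * Q (x, y)))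
  = (P (x', z1) - P c_e) * (y' - y) - (P (x', z2) - P (x, y)) * (y' - y)
   - (w x' (y + e) - w x (y + e) - (x' - x) * Q c_e) + (w x' y - w x y - (x' - x) * Q (x, y))
   + (mixed_diff u x x' y (y + e) + mixed_diff w x x' y (y + e) - H (x, y) * ((x' - x) * e))
   + (P c_e - P (x, y)) * (y' - y - De * - P (x, y))
   + (H (x, y) * e - Q c_e + Q (x, y)) * (x' - x - De * Q (x, y)).
  have -> : u x' (y' + e) = u x' (y + e) + P (x', z1) * (y' - y) by rewrite -Az; ring.
  have -> : u x' y' = u x' y + P (x', z2) * (y' - y) by rewrite -Bz; ring.
  by rewrite /mixed_diff; ring.
rewrite id1; move: E1 E2 E3 E4 E5 E5' E6 E7 kGD; rewrite /G.
set a1 := (P (x', z1) - P c_e) * _; set a2 := (P (x', z2) - P (x, y)) * _.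
set a3 := w x' (y + e) - w x (y + e) - _; set a4 := w x' y - w x y - _.
set a5 := _ - H (x, y) * _; set a6 := (P c_e - _) * _; set a7 := (H (x, y) * e - _ + _) * _.
set b1 := K * `|e| * _; set h := `|H (x, y) * e|; set De1 := `|De|.
by clearbody a1 a2 a3 a4 a5 a6 a7 b1 h De1; clear; rewrite !ler_norml; lra.
Qed.

Lemma unit_dot_le1 (a b a' b' : R) : a ^+ 2 + b ^+ 2 = 1 -> a' ^+ 2 + b' ^+ 2 = 1 ->
  a * a' + b * b' <= 1.
Proof.
by move=> h1 h2; have := addr_ge0 (sqr_ge0 (a - a')) (sqr_ge0 (b - b')); nra.
Qed.

(** In the rate found in [characteristic_step], 1 - (P P_e + Q Q_e) is nonnegative; dropping it
    leaves a one-sided bound, which [locally_nonincreasing] integrates. The sign of [e] is free: [m]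
    is a lower bound of H Q along the curve when e > 0 and an upper bound when e < 0. *)
Lemma characteristic_growth P Q H u w p (r K : R) (c : R -> R * R) (t1 t2 e m : R) :
  0 <= K -> potentials_on P Q u w p r -> divergence_bounds H u w p r -> lip_on H p r K ->
  (forall q, square p r q -> {for q, continuous P}) ->
  (forall q, P q ^+ 2 + Q q ^+ 2 = 1) -> t1 <= t2 -> e != 0 ->
  (forall t, t1 <= t <= t2 -> is_derive t 1 c (Q (c t), - P (c t))) ->
  (forall t, t1 <= t <= t2 -> square p r (c t) /\ square p r ((c t).1, (c t).2 + e)) ->
  (forall t, t1 <= t <= t2 -> e * m <= e * (H (c t) * Q (c t))) ->
  (t2 - t1) * (e * m - K * e ^+ 2) <= u (c t2).1 ((c t2).2 + e) - u (c t2).1 (c t2).2 -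
    (u (c t1).1 ((c t1).2 + e) - u (c t1).1 (c t1).2).
Proof.
move=> K0 pot db lH cP PQ1 t12 e0 dc sc em.
pose D s := u (c s).1 ((c s).2 + e) - u (c s).1 (c s).2; rewrite -/(D t1) -/(D t2).
suff main (eta : R) : 0 < eta -> (t2 - t1) * (e * m - K * e ^+ 2 - eta) <= D t2 - D t1.
  apply/ler_addgt0Pr => z z0.
  have tt : 0 < t2 - t1 + 1 by lra.
  have z1 : 0 < z / (t2 - t1 + 1) by exact: divr_gt0.
  have := main _ z1; set y := z / _ in z1 *.
  have zE : y * (t2 - t1 + 1) = z by rewrite divfK// gt_eqF.
  by nra.
move=> eta0.
pose f s := s * (e * m - K * e ^+ 2 - eta) - D s.
suff : f t2 <= f t1 by rewrite /f mulrBl; lra.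
apply: locally_nonincreasing => // t tt.
have [sct scet] := sc t tt.
have [d d0 Hd] := characteristic_step K0 pot db lH cP PQ1 (dc t tt) sct scet e0 eta0.
exists d => // s _ /Hd; rewrite -/(D s) -/(D t).
set c_e := (_, _); set S := P (c t) * _ + _ => HD.
have S1 : S <= 1 by exact: unit_dot_le1.
have := em t tt; set X := e * (H (c t) * _) in HD *; set Y := e * m => YX.
move: HD; rewrite /f -/Y; set Z := K * e ^+ 2; set D1 := D s; set D2 := D t.
move: eta0 S1 YX; clear => eta0 S1 YX HD; split=> st.
  move: HD; rewrite (ler0_norm (x := s - t)) ?subr_le0// ler_norml => /andP[_ h].
  have : 0 <= (t - s) * (1 - S + X - Y) by apply: mulr_ge0; lra.
  by move: h; set V := (Z + eta) * _; rewrite /V; nra.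
move: HD; rewrite (ger0_norm (x := s - t)) ?subr_ge0// ler_norml => /andP[h _].
have : 0 <= (s - t) * (1 - S + X - Y) by apply: mulr_ge0; lra.
by nra.
Qed.

(** By the mean value theorem the difference of [u] over the height [e] is [e] times a value of P
    near the curve. Dividing [characteristic_growth] by e > 0 gives the lower bound and by e < 0 the
    upper one; the error K |e| vanishes as e tends to 0. The half square leaves room for the
    translate. *)
Lemma characteristic_increment P Q H u w p (r K : R) (c : R -> R * R) (t1 t2 m M : R) :
  0 <= K -> potentials_on P Q u w p r -> divergence_bounds H u w p r -> lip_on H p r K ->
  (forall q, square p r q -> {for q, continuous P}) ->
  (forall q, P q ^+ 2 + Q q ^+ 2 = 1) -> t1 <= t2 ->
  (forall t, t1 <= t <= t2 -> is_derive t 1 c (Q (c t), - P (c t))) ->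
  (forall t, t1 <= t <= t2 -> square p (r / 2) (c t)) ->
  (forall t, t1 <= t <= t2 -> m <= H (c t) * Q (c t) <= M) ->
  m * (t2 - t1) <= P (c t2) - P (c t1) <= M * (t2 - t1).
Proof.
move=> K0 pot db lH cP PQ1 t12 dc sc HmM.
have t11 : t1 <= t1 <= t2 by rewrite lexx.
have t22 : t1 <= t2 <= t2 by rewrite lexx andbT.
have r20 : 0 < r / 2 by have [h _] := sc t1 t11; exact: le_lt_trans h.
have sqr q : square p (r / 2) q -> square p r q.
  by move=> [h1 h2]; split; [move: h1|move: h2]; lra.
have sqe q e : square p (r / 2) q -> `|e| < r / 2 -> square p r (q.1, q.2 + e).
  move=> [h1 h2] h3; split => /=; first by move: h1; lra.
  have -> : q.2 + e - p.2 = (q.2 - p.2) + e by ring.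
  by apply: le_lt_trans (ler_normD _ _) _; lra.
have quot q e : square p (r / 2) q -> `|e| < r / 2 ->
    exists2 z : R, `|z - q.2| <= `|e| & u q.1 (q.2 + e) - u q.1 q.2 = P (q.1, z) * e.
  move=> sq eb; have [h1 h2] := sqr _ sq; have [_ h3] := sqe _ _ sq eb.
  have it z : `|z - p.2| < r -> p.2 - r < z < p.2 + r by rewrite ltr_norml; lra.
  have it' z : p.2 - r < z < p.2 + r -> `|z - p.2| < r by rewrite ltr_norml; qlra.
  have [z hz [_ Ez]] := mvt_between (fun z zi => (proj1 pot) q.1 z h1 (it' z zi)) (it _ h2) (it _ h3).
  by exists z; [move: hz|move: Ez]; rewrite addrAC subrr add0r.
have main (eta : R) : 0 < eta -> exists2 d : R, 0 < d & forall e, 0 < `|e| < d ->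
    exists2 v, `|v - (P (c t2) - P (c t1))| <= eta &
    u (c t2).1 ((c t2).2 + e) - u (c t2).1 (c t2).2 -
    (u (c t1).1 ((c t1).2 + e) - u (c t1).1 (c t1).2) = v * e.
  move=> eta0; have e20 : 0 < eta / 2 by lra.
  have [d1 d10 H1] := continuous_square (cP _ (sqr _ (sc t1 t11))) e20.
  have [d2 d20 H2] := continuous_square (cP _ (sqr _ (sc t2 t22))) e20.
  exists (Num.min (r / 2) (Num.min d1 d2)); first by rewrite !lt_min r20 d10.
  move=> e /andP[e0]; rewrite !lt_min => /and3P[er ed1 ed2].
  have [z1 hz1 E1] := quot _ _ (sc t1 t11) er; have [z2 hz2 E2] := quot _ _ (sc t2 t22) er.
  exists (P ((c t2).1, z2) - P ((c t1).1, z1)); last by rewrite E1 E2 mulrBl.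
  have := H1 (c t1).1 z1; rewrite subrr normr0 => /(_ d10 (le_lt_trans hz1 ed1)).
  have := H2 (c t2).1 z2; rewrite subrr normr0 => /(_ d20 (le_lt_trans hz2 ed2)).
  by rewrite !ler_norml; clear; lra.
have growth e : e != 0 -> `|e| < r / 2 -> forall n : R,
    (forall t, t1 <= t <= t2 -> e * n <= e * (H (c t) * Q (c t))) ->
    (t2 - t1) * (e * n - K * e ^+ 2) <= u (c t2).1 ((c t2).2 + e) - u (c t2).1 (c t2).2 -
      (u (c t1).1 ((c t1).2 + e) - u (c t1).1 (c t1).2).
  move=> e0 er n Hn; apply: (characteristic_growth K0 pot db lH cP PQ1 t12 e0 dc) => // t tt.
  by split; [exact: sqr (sc t tt)|exact: sqe (sc t tt) er].
have small (eta : R) : 0 < eta -> exists2 e : R, 0 < e &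
    [/\ e < r / 2, (t2 - t1) * (K * e) <= eta,
      exists2 v, `|v - (P (c t2) - P (c t1))| <= eta &
        (t2 - t1) * (e * m - K * e ^+ 2) <= v * e &
      exists2 v, `|v - (P (c t2) - P (c t1))| <= eta &
        (t2 - t1) * (- e * M - K * (- e) ^+ 2) <= v * - e].
  move=> eta0; have [d d0 Hd] := main _ eta0.
  pose G := 1 + (t2 - t1) * K.
  have G0 : 0 < G by rewrite /G; have := mulr_ge0 (_ : 0 <= t2 - t1) K0; rewrite subr_ge0 => /(_ t12); lra.
  pose e := Num.min (d / 2) (Num.min (r / 4) (eta / G)).
  have e0 : 0 < e by rewrite !lt_min !divr_gt0//; qlra.
  have e1 : e <= d / 2 by rewrite ge_min lexx.
  have e2 : e <= r / 4 by rewrite !ge_min lexx orbT.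
  have e3 : e * G <= eta by rewrite -ler_pdivlMr// !ge_min lexx !orbT.
  clearbody e; exists e => //; split; first qlra.
  - by move: e3; rewrite /G; nra.
  - have [v hv E] := Hd e ltac:(rewrite gtr0_norm; qlra).
    exists v => //; rewrite -E; apply: growth; rewrite ?gt_eqF ?gtr0_norm//; first qlra.
    by move=> t tt; rewrite ler_pM2l//; case/andP: (HmM t tt).
  - have [v hv E] := Hd (- e) ltac:(rewrite normrN gtr0_norm; qlra).
    exists v => //; rewrite -E; apply: growth; rewrite ?oppr_eq0 ?gt_eqF ?normrN ?gtr0_norm//; first qlra.
    by move=> t tt; rewrite ler_nM2l ?oppr_lt0//; case/andP: (HmM t tt).
apply/andP; split; apply/ler_addgt0Pr => z z0.
  have z20 : 0 < z / 2 by lra.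
  have [e e0 [_ eK [v hv gv] _]] := small _ z20.
  have : (t2 - t1) * (m - K * e) <= v.
    by rewrite -(ler_pM2r e0); apply: le_trans gv; rewrite le_eqVlt; apply/orP; left; apply/eqP; ring.
  by move: hv eK; rewrite ler_norml; clear; lra.
have z20 : 0 < z / 2 by lra.
have [e e0 [_ eK _ [v hv gv]]] := small _ z20.
have : v <= (t2 - t1) * (M + K * e).
  rewrite -subr_ge0 -(pmulr_rge0 _ e0); move: gv; rewrite -subr_ge0.
  by congr (_ <= _); ring.
by move: hv eK; rewrite ler_norml; clear; lra.
Qed.
End characteristic_core.

(** * Derivative of the field along a characteristic curve *)

Section characteristic_derivative.
Context {R : realType}.
Implicit Types (P Q H : R * R -> R) (u w : R -> R -> R) (p : R * R).

Lemma is_derive1_continuous (V : normedModType R) (c : R -> V) (t : R) (v : V) :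
  is_derive t 1 c v -> {for t, continuous c}.
Proof. by move=> [dc _]; apply: differentiable_continuous; apply/derivable1_diffP. Qed.

Lemma is_derive1_opp (V : normedModType R) (c : R -> V) (t : R) (v : V) :
  is_derive t 1 c v -> is_derive (- t) 1 (fun s => c (- s)) (- v).
Proof.
move=> /is_derive1P dc; apply/is_derive1P => e /dc[d d0 Hd]; exists d => // s sd.
have E : - s - t = - (s - - t) by rewrite opprD opprK.
have := Hd (- s); rewrite E normrN => /(_ sd).
by rewrite opprK scalerN scaleNr.
Qed.

Lemma near_open (A : set R) (t : R) : open A -> A t ->
  exists2 d : R, 0 < d & forall s, `|s - t| < d -> A s.
Proof.
move=> oA At; have /nbhs_ballP[d /= d0 Hd] := oA _ At.
by exists d => // s sd; apply: Hd; rewrite /ball/= distrC.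
Qed.

(** On a short time interval H Q stays within [e] of its value at [t], so the bounds of
    [characteristic_increment] are a first-order expansion. *)
Lemma characteristic_is_derive P Q H u w p (r K d0 : R) (c : R -> R * R) (t : R) :
  0 <= K -> 0 < r -> potentials_on P Q u w p r -> divergence_bounds H u w p r ->
  lip_on H p r K ->
  (forall q, square p r q -> {for q, continuous P}) ->
  {for p, continuous H} -> {for p, continuous Q} ->
  (forall q, P q ^+ 2 + Q q ^+ 2 = 1) -> c t = p -> 0 < d0 ->
  (forall s : R, `|s - t| < d0 -> is_derive s 1 c (Q (c s), - P (c s))) ->
  is_derive t 1 (P \o c) (H (c t) * Q (c t)).
Proof.
move=> K0 r0 pot db lH cP cH cQ PQ1 ctp d00 dc; apply/is_derive1P => e e0.
have ct : {for t, continuous c}.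
  by apply: (is_derive1_continuous (dc t _)); rewrite subrr normr0.
have cHQ : {for t, continuous (fun s => H (c s) * Q (c s))}.
  apply: continuousM.
    by apply: (@continuous_comp _ _ _ c H) => //; rewrite ctp.
  by apply: (@continuous_comp _ _ _ c Q) => //; rewrite ctp.
have /cvgrPdist_le/(_ _ e0)/nbhs_ballP[d1 /= d10 Hd1] := cHQ.
have r20 : 0 < r / 2 by lra.
have /cvgrPdist_lt/(_ _ r20)/nbhs_ballP[d2 /= d20 Hd2] := ct.
exists (Num.min d0 (Num.min d1 d2)); first by rewrite !lt_min d00 d10.
move=> s; rewrite !lt_min => /and3P[sd0 sd1 sd2]; rewrite /= scale_realE.
have main (t1 t2 : R) : t1 <= t2 -> (forall x, t1 <= x <= t2 -> `|x - t| <= `|s - t|) ->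
    `|P (c t2) - P (c t1) - (t2 - t1) * (H (c t) * Q (c t))| <= e * (t2 - t1).
  move=> t12 tt.
  have := @characteristic_increment R P Q H u w p r K c t1 t2
    (H (c t) * Q (c t) - e) (H (c t) * Q (c t) + e) K0 pot db lH cP PQ1 t12.
  have h1 x : t1 <= x <= t2 -> is_derive x 1 c (Q (c x), - P (c x)).
    by move=> /tt xs; apply: dc; exact: le_lt_trans xs sd0.
  have h2 x : t1 <= x <= t2 -> square p (r / 2) (c x).
    move=> /tt xs; have := Hd2 x; rewrite /ball/= distrC => /(_ (le_lt_trans xs sd2)).
    by rewrite ctp prod_normE /= gt_max => /andP[]; rewrite distrC => a; rewrite distrC.
  have h3 x : t1 <= x <= t2 -> H (c t) * Q (c t) - e <= H (c x) * Q (c x) <= H (c t) * Q (c t) + e.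
    move=> /tt xs; have := Hd1 x; rewrite /ball/= distrC => /(_ (le_lt_trans xs sd1)).
    by rewrite ler_norml; qlra.
  move=> /(_ h1 h2 h3); rewrite ler_norml; set X := H _ * Q _; clear; nra.
have [st|/ltW ts] := leP s t.
  have H1 := main s t st; rewrite (ler0_norm (x := s - t)) ?subr_le0// opprB -normrN.
  have -> : - (P (c s) - P (c t) - (s - t) * (H (c t) * Q (c t))) =
     P (c t) - P (c s) - (t - s) * (H (c t) * Q (c t)) by ring.
  by apply: H1 => x xx; rewrite !ler0_norm; qlra.
rewrite (ger0_norm (x := s - t)) ?subr_ge0//; apply: main => // x xx.
by rewrite !ger0_norm; qlra.
Qed.

Definition swap (q : R * R) : R * R := (q.2, q.1).

Lemma continuous_swap : continuous swap.
Proof. by move=> q; exact: (cvg_pair cvg_snd cvg_fst). Qed.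

Lemma is_derive1_swap (c : R -> R * R) (t : R) (v : R * R) :
  is_derive t 1 c v -> is_derive t 1 (swap \o c) (swap v).
Proof.
move=> /is_derive1P dc; apply/is_derive1P => e /dc[d d0 Hd]; exists d => // s /Hd.
by rewrite !prod_normE /= maxC.
Qed.

Lemma square_swap p r q : square (swap p) r (swap q) <-> square p r q.
Proof. by split=> -[]. Qed.

Lemma divergence_bounds_swap H u w p (r : R) : divergence_bounds H u w p r ->
  divergence_bounds (H \o swap) (fun x y => w y x) (fun x y => u y x) (swap p) r.
Proof.
move=> db x1 x2 y1 y2 m M h1 h2 h3 h4 h5 h6 HmM.
have := db y1 y2 x1 x2 m M h4 h5 h6 h1 h2 h3.
have Hs q : rect y1 y2 x1 x2 q -> m <= H q <= M.
  by move=> [a b]; have := HmM (swap q) (conj b a); rewrite /= /swap/= -surjective_pairing.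
move=> /(_ Hs); rewrite (mulrC (y2 - y1)).
have -> : mixed_diff u y1 y2 x1 x2 + mixed_diff w y1 y2 x1 x2 =
  mixed_diff (fun x y => w y x) x1 x2 y1 y2 + mixed_diff (fun x y => u y x) x1 x2 y1 y2.
  by rewrite /mixed_diff; ring.
by [].
Qed.

(** The second formula is the first one after exchanging the coordinates. The exchange turns the
    velocity (Q, - P) into (- P, Q), the opposite of the characteristic field of the exchanged pair;
    hence the time reversal in [c']. *)
Lemma characteristic_is_derive2 P Q H u w p (r K d0 : R) (c : R -> R * R) (t : R) :
  0 <= K -> 0 < r -> potentials_on P Q u w p r -> divergence_bounds H u w p r ->
  lip_on H p r K ->
  (forall q, square p r q -> {for q, continuous P} /\ {for q, continuous Q}) ->
  {for p, continuous H} ->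
  (forall q, P q ^+ 2 + Q q ^+ 2 = 1) -> c t = p -> 0 < d0 ->
  (forall s : R, `|s - t| < d0 -> is_derive s 1 c (Q (c s), - P (c s))) ->
  is_derive t 1 (P \o c) (H (c t) * Q (c t)) /\
  is_derive t 1 (Q \o c) (- (H (c t) * P (c t))).
Proof.
move=> K0 r0 pot db lH cPQ cH PQ1 ctp d00 dc.
have sp : square p r p by split; rewrite subrr normr0.
split.
  apply: (characteristic_is_derive K0 r0 pot db lH _ cH _ PQ1 ctp d00 dc).
    by move=> q /cPQ[].
  by have [] := cPQ p sp.
have swK q : swap (swap q) = q by case: q.
have swc (F : R * R -> R) (q : R * R) : {for swap q, continuous F} -> {for q, continuous (F \o swap)}.
  by move=> cF; apply: (@continuous_comp _ _ _ swap F) => //; exact: continuous_swap.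
pose c' s := swap (c (- s)).
have H1 : is_derive (- t) 1 ((Q \o swap) \o c') ((H \o swap) (c' (- t)) * (P \o swap) (c' (- t))).
  apply: (@characteristic_is_derive (Q \o swap) (P \o swap) (H \o swap)
    (fun x y => w y x) (fun x y => u y x) (swap p) r K d0 c' (- t)) => //.
  - by split=> x y xr yr; [exact: (proj2 pot)|exact: (proj1 pot)].
  - exact: divergence_bounds_swap.
  - move=> q q' sq sq'.
    have sq1 : square p r (swap q) by case: sq.
    have sq1' : square p r (swap q') by case: sq'.
    by have := lH _ _ sq1 sq1'; rewrite /= !prod_normE /= maxC.
  - by move=> q sq; apply: swc; apply: (proj2 (cPQ _ _)); rewrite -(square_swap _) swK.
  - by apply: swc; rewrite swK.
  - by apply: swc; rewrite swK; apply: (proj1 (cPQ _ _)).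
  - by move=> q; rewrite /= addrC.
  - by rewrite /c' opprK ctp.
  - move=> s sd.
    have E : `|- s - t| < d0 by rewrite -normrN; have -> : - (- s - t) = s - - t by ring.
    have := is_derive1_opp (dc (- s) E); rewrite opprK => /is_derive1_swap.
    by rewrite /= /swap/= /c' /= opprK /swap /= -!surjective_pairing.
have := is_derive1_opp H1; rewrite opprK /c' /= opprK.
have -> : (fun s => Q (swap (swap (c (- - s))))) = Q \o c.
  by apply/funext => s; rewrite /= opprK swK.
by rewrite !swK.
Qed.
End characteristic_derivative.

(** * Uniqueness of characteristic curves *)

Section characteristic_uniqueness.
Context {R : realType}.
Implicit Types (P Q H theta : R * R -> R) (u w : R -> R -> R) (p q : R * R).

Lemma is_derive1_fst (c : R -> R * R) (t : R) (v : R * R) :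
  is_derive t 1 c v -> is_derive t 1 (fun s => (c s).1) v.1.
Proof.
move=> /is_derive1P dc; apply/is_derive1P => e /dc[d d0 Hd]; exists d => // s /Hd.
by rewrite prod_normE /= ge_max => /andP[].
Qed.

Lemma is_derive1_snd (c : R -> R * R) (t : R) (v : R * R) :
  is_derive t 1 c v -> is_derive t 1 (fun s => (c s).2) v.2.
Proof. by move=> /is_derive1_swap/is_derive1_fst. Qed.

(** The function exp(- K s) E(s) starts at 0 and has a nonpositive derivative. *)
Lemma gronwall_right (E dE : R -> R) (K t : R) : 0 <= t -> E 0 = 0 ->
  (forall s : R, 0 <= s <= t -> [/\ 0 <= E s, is_derive s 1 E (dE s) & dE s <= K * E s]) ->
  E t = 0.
Proof.
move=> t0 E0 HE.
pose f s : R := expR (- (K * s)) * E s.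
pose df s : R := expR (- (K * s)) * (dE s - K * E s).
have df1 s : 0 <= s <= t -> is_derive s 1 f (df s).
  move=> /HE[_ dEs _]; rewrite /f /df.
  apply: is_derive_eq; rewrite /GRing.scale/=; ring.
have cf : {within `[0, t], continuous f}.
  apply: continuous_in_subspaceT => s; rewrite inE/= in_itv/= => /df1.
  exact: is_derive1_continuous.
have [s|s] := @MVT_segment _ f df 0 t t0 _ cf.
  by rewrite in_itv/= => /andP[s0 st]; apply: df1; rewrite !ltW.
rewrite in_itv/= => st; have [_ _ dEs] := HE s st.
rewrite {1 2}/f E0 mulr0 !subr0 => EE.
have : expR (- (K * t)) * E t <= 0.
  rewrite EE mulr_le0_ge0//; rewrite /df mulr_ge0_le0 ?expR_ge0//; lra.
rewrite pmulr_rle0 ?expR_gt0// => Et.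
by apply/eqP; rewrite eq_le Et; have [] := HE t; rewrite ?lexx ?t0.
Qed.

Lemma gronwall_zero (E dE : R -> R) (I : set R) (K : R) : is_interval I -> I 0 -> E 0 = 0 ->
  (forall s : R, I s -> [/\ 0 <= E s, is_derive s 1 E (dE s) & `|dE s| <= K * E s]) ->
  forall t, I t -> E t = 0.
Proof.
move=> iI I0 E0 HE t It; have [t0|/ltW t0] := leP 0 t.
  apply: (gronwall_right (dE := dE) (K := K) t0 E0) => s st.
  have [|h1 h2 h3] := HE s; first exact: iI I0 It _ st.
  by split => //; exact: le_trans (ler_norm _) h3.
have t0' : 0 <= - t by rewrite oppr_ge0.
rewrite -[t]opprK; apply: (gronwall_right (E := fun s => E (- s)) (dE := fun s => - dE (- s)) (K := K) t0' _).
  by rewrite oppr0.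
move=> s st; have [|h1 h2 h3] := HE (- s).
  by apply: iI It I0 _ _; lra.
split => //.
  by rewrite -[s]opprK; apply: (is_derive1_opp (c := E)); rewrite opprK.
by apply: le_trans h3; rewrite -normrN ler_norm.
Qed.

Lemma two_mul_le (D F d1 d2 A B k : R) : 0 <= k ->
  D ^+ 2 <= k * (d1 ^+ 2 + d2 ^+ 2) -> F ^+ 2 <= A ^+ 2 + B ^+ 2 ->
  `|2 * (d1 * B - d2 * A + D * F)| <= (2 + 2 * k) * (d1 ^+ 2 + d2 ^+ 2 + A ^+ 2 + B ^+ 2).
Proof.
move=> k0 hD hF.
have h1 := sqr_ge0 (D - F); have h2 := sqr_ge0 (D + F); have h3 := sqr_ge0 (d1 - B).
have h4 := sqr_ge0 (d1 + B); have h5 := sqr_ge0 (d2 - A); have h6 := sqr_ge0 (d2 + A).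
have h7 : 0 <= k * (A ^+ 2 + B ^+ 2) by rewrite mulr_ge0 ?addr_ge0 ?sqr_ge0.
have h8 : 0 <= k * (d1 ^+ 2 + d2 ^+ 2) by rewrite mulr_ge0 ?addr_ge0 ?sqr_ge0.
have h9 := sqr_ge0 d1; have h10 := sqr_ge0 d2; have h11 := sqr_ge0 A; have h12 := sqr_ge0 B.
rewrite ler_norml; apply/andP; split; lra.
Qed.

Lemma is_derive1_sqr (f : R -> R) (t df : R) : is_derive t 1 f df ->
  is_derive t 1 (fun s => f s ^+ 2) (2 * f t * df).
Proof.
move=> d; have := is_deriveM d d; rewrite /GRing.scale/= => h.
by apply: is_derive_eq; rewrite /GRing.scale/=; ring.
Qed.

(** Here [d1], [d2] are the differences of the positions of two curves and [A], [B] those of cosine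
    and sine. The terms in [hc] alone cancel, as a rotation preserves A^2 + B^2; what remains of H
    is [hc - he], which is bounded by the distance of the positions. *)
Lemma characteristic_energy (d1 d2 A B hc he qe pe : R) (K : R) : 0 <= K ->
  qe ^+ 2 + pe ^+ 2 <= 1 ->
  `|hc - he| <= K * Num.max `|d1| `|d2| ->
  `|2 * (d1 * B - d2 * A + A * (hc * B + (hc - he) * qe) - B * (hc * A + (hc - he) * pe))| <=
  (2 + 2 * K ^+ 2) * (d1 ^+ 2 + d2 ^+ 2 + A ^+ 2 + B ^+ 2).
Proof.
move=> K0 qp hK.
have h2 : (hc - he) ^+ 2 <= K ^+ 2 * (d1 ^+ 2 + d2 ^+ 2).
  rewrite -real_normK ?num_real//.
  apply: (@le_trans _ _ ((K * Num.max `|d1| `|d2|) ^+ 2)).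
    by rewrite ler_sqr ?nnegrE// mulr_ge0// le_max normr_ge0.
  rewrite exprMn ler_wpM2l ?sqr_ge0//.
  by rewrite /Num.max; case: ifP => _; rewrite real_normK ?num_real// ?lerDr ?lerDl sqr_ge0.
have -> : d1 * B - d2 * A + A * (hc * B + (hc - he) * qe) - B * (hc * A + (hc - he) * pe) =
  d1 * B - d2 * A + (hc - he) * (A * qe - B * pe) by ring.
set D := hc - he in h2 *.
have h3 : (A * qe - B * pe) ^+ 2 <= A ^+ 2 + B ^+ 2.
  have : 0 <= (A * pe + B * qe) ^+ 2 by exact: sqr_ge0.
  have : (A ^+ 2 + B ^+ 2) * (qe ^+ 2 + pe ^+ 2) <= A ^+ 2 + B ^+ 2.
    by rewrite ler_piMr// addr_ge0// sqr_ge0.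
  lra.
set F := A * qe - B * pe in h3 *.
exact: two_mul_le (sqr_ge0 K) h2 h3.
Qed.

Lemma lipschitz_ex (W : set (R * R)) H : [lipschitz H q | q in W] ->
  exists2 K : R, 0 <= K & forall q q', W q -> W q' -> `|H q - H q'| <= K * `|q - q'|.
Proof.
move=> /pinfty_ex_gt0[K /= K0 HK]; exists K; first exact: ltW.
by move=> q q' Wq Wq'; exact: (HK (q, q')).
Qed.

Lemma lipschitz_continuous_at (W : set (R * R)) H (K : R) q : open W -> W q -> 0 <= K ->
  (forall q q', W q -> W q' -> `|H q - H q'| <= K * `|q - q'|) ->
  {for q, continuous H}.
Proof.
move=> oW Wq K0 HK; apply/cvgrPdist_lt => e e0.
have K1 : 0 < K + 1 by lra.
near=> q'.
have Wq' : W q' by near: q'; exact: oW.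
have qq : `|q - q'| < e / (K + 1).
  by near: q'; apply: cvgr_dist_lt; rewrite ?divr_gt0//; exact: cvg_id.
apply: le_lt_trans (HK _ _ Wq Wq') _.
apply: le_lt_trans (_ : (K + 1) * `|q - q'| < e); first by rewrite ler_wpM2r//; lra.
by rewrite mulrC -ltr_pdivlMr.
Unshelve. all: by end_near. Qed.

Lemma open_square_in (W : set (R * R)) p : open W -> W p ->
  exists2 r : R, 0 < r & rect (p.1 - r) (p.1 + r) (p.2 - r) (p.2 + r) `<=` W.
Proof.
move=> oW /oW /nbhs_ballP[d /= d0 Hd]; exists (d / 2); first lra.
move=> q [/=]; rewrite !in_itv/= => h1 h2; apply: Hd; split; rewrite /ball/=.
  by rewrite ltr_norml; lra.
by rewrite ltr_norml; lra.
Qed.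

(** Potentials exist on squares inside [W] only, so each time [t] gets its own square, centred at
    [c t]. *)
Lemma characteristic_curve_derive W theta H (K : R) (I : set R) (c : R -> R * R) (t : R) :
  open W -> (forall q, W q -> {for q, continuous theta}) -> 0 <= K ->
  (forall q q', W q -> W q' -> `|H q - H q'| <= K * `|q - q'|) ->
  weak_solution W theta H -> open I -> I t ->
  (forall s, I s -> W (c s) /\ is_derive s 1 c (Nperp theta (c s))) ->
  is_derive t 1 (N1 theta \o c) (H (c t) * N2 theta (c t)) /\
  is_derive t 1 (N2 theta \o c) (- (H (c t) * N1 theta (c t))).
Proof.
move=> oW ct K0 HK ws oI It Ic.
have cH q : W q -> {for q, continuous H}.
  by move=> Wq; exact: (lipschitz_continuous_at oW Wq K0 HK).
have [r r0 rW] := open_square_in oW (proj1 (Ic t It)).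
have cN q : W q -> {for q, continuous (N1 theta)} /\ {for q, continuous (N2 theta)}.
  by move=> /ct; exact: N_continuous.
have [u [w [du dw uw]]] := flux_potentials r0 cN rW.
have sqW q : square (c t) r q -> W q.
  move=> [h1 h2]; apply: rW; move: h1 h2; rewrite !ltr_norml => h1 h2.
  by split; rewrite /= in_itv/=; qlra.
have [d0 d00 Hd0] := near_open oI It.
apply: (@characteristic_is_derive2 _ (N1 theta) (N2 theta) H u w (c t) r K d0 c t) => //.
- move=> x1 x2 y1 y2 m M h1 h2 h3 h4 h5 h6 HmM.
  rewrite -uw ?(ltW h2) ?(ltW h5)//; apply: (@weak_flux_bounds _ W _ H) => //.
  move=> q [/=]; rewrite !in_itv/= => a b; apply: rW; split; rewrite /= in_itv/=; qlra.
- by move=> q q' /sqW Wq /sqW Wq'; exact: HK.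
- by move=> q /sqW /cN.
- exact: cH (proj1 (Ic t It)).
- by move=> q; rewrite /N1 /N2 cos2Dsin2.
- by move=> s /Hd0/Ic[].
Qed.

Lemma characteristic_agree W theta H (K : R) p (I J : set R) (c e : R -> R * R) :
  open W -> (forall q, W q -> {for q, continuous theta}) -> 0 <= K ->
  (forall q q', W q -> W q' -> `|H q - H q'| <= K * `|q - q'|) ->
  weak_solution W theta H ->
  integral_curve (Nperp theta) W p I c -> integral_curve (Nperp theta) W p J e ->
  forall t, I t -> J t -> c t = e t.
Proof.
move=> oW ct K0 HK ws [oI iI I0 c0 Ic] [oJ iJ J0 e0 Je] t It Jt.
pose x1 s : R := (c s).1 - (e s).1; pose x2 s : R := (c s).2 - (e s).2.
pose A s : R := N1 theta (c s) - N1 theta (e s).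
pose B s : R := N2 theta (c s) - N2 theta (e s).
pose E s : R := x1 s ^+ 2 + x2 s ^+ 2 + A s ^+ 2 + B s ^+ 2.
pose h s : R := H (c s) - H (e s).
(* Each difference of products is split as H(c) times a difference of the field plus H(c) - H(e)
   times the field at [e s], the form estimated by [characteristic_energy]. *)
pose dE s : R := 2 * (x1 s * B s - x2 s * A s +
   A s * (H (c s) * B s + h s * N2 theta (e s)) - B s * (H (c s) * A s + h s * N1 theta (e s))).
have : E t = 0.
  apply: (@gronwall_zero E dE (I `&` J) (2 + 2 * K ^+ 2)) => //.
  - move=> a b [Ia Ja] [Ib Jb] s sab; split; [exact: iI sab|exact: iJ sab].
  - by rewrite /E /x1 /x2 /A /B c0 e0 !subrr !expr0n !addr0.
  move=> s [Is Js]; have [Wc dc] := Ic s Is; have [We de] := Je s Js.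
  have [dc1 dc2] := characteristic_curve_derive oW ct K0 HK ws oI Is Ic.
  have [de1 de2] := characteristic_curve_derive oW ct K0 HK ws oJ Js Je.
  split.
  - by rewrite /E !addr_ge0// sqr_ge0.
  - have dx1 := is_derive1_fst dc; have dx1' := is_derive1_fst de.
    have dx2 := is_derive1_snd dc; have dx2' := is_derive1_snd de.
    rewrite /= in dx1 dx1' dx2 dx2'.
    have dX1 : is_derive s 1 x1 (B s) by apply: is_derive_eq.
    have dX2 : is_derive s 1 x2 (- A s).
      by apply: is_derive_eq; rewrite /A /N1; ring.
    have dA : is_derive s 1 A (H (c s) * N2 theta (c s) - H (e s) * N2 theta (e s)).
      exact: (is_deriveB dc1 de1).
    have dB : is_derive s 1 B (- (H (c s) * N1 theta (c s)) - - (H (e s) * N1 theta (e s))).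
      exact: (is_deriveB dc2 de2).
    have dE1 := is_deriveD (is_deriveD (is_deriveD (is_derive1_sqr dX1) (is_derive1_sqr dX2))
      (is_derive1_sqr dA)) (is_derive1_sqr dB).
    apply: (is_derive_eq dE1); rewrite /dE /h /A /B.
    move: (x1 s) (x2 s) (N1 theta (c s)) (N1 theta (e s)) (N2 theta (c s)) (N2 theta (e s)) (H (c s)) (H (e s)).
    by clear => *; ring.
  - apply: characteristic_energy => //.
      by rewrite addrC /N1 /N2 cos2Dsin2.
    by have := HK _ _ Wc We; rewrite prod_normE.
move=> /eqP; rewrite /E paddr_eq0 ?addr_ge0 ?sqr_ge0// => /andP[+ _].
rewrite paddr_eq0 ?addr_ge0 ?sqr_ge0// => /andP[+ _].
rewrite paddr_eq0 ?sqr_ge0// => /andP[].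
by rewrite !sqrf_eq0 !subr_eq0 => /eqP h1 /eqP h2; exact: injective_projections.
Qed.

Lemma edist_le_norm p q : `|q.1 - p.1| <= Defs.edist p q /\ `|q.2 - p.2| <= Defs.edist p q.
Proof.
by split; rewrite -sqrtr_sqr ler_wsqrtr// ?lerDl ?lerDr sqr_ge0.
Qed.

Lemma norm_ge_edist p q : Defs.edist p q <= 2 * `|q - p|.
Proof.
rewrite -[leRHS]ger0_norm ?mulr_ge0// -sqrtr_sqr ler_wsqrtr//.
have h1 : `|q.1 - p.1| <= `|q - p| by rewrite prod_normE le_max lexx.
have h2 : `|q.2 - p.2| <= `|q - p| by rewrite prod_normE le_max lexx orbT.
rewrite -(real_normK (num_real (q.1 - p.1))) -(real_normK (num_real (q.2 - p.2))).
have := normr_ge0 (q.1 - p.1); have := normr_ge0 (q.2 - p.2).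
move: h1 h2; move: `|q - p| `|q.1 - p.1| `|q.2 - p.2| => a b d; clear; nra.
Qed.

Lemma integral_curve_exists (X : R * R -> R * R) p (r : R) : 0 < r ->
  (forall q, `|X q| <= 1) -> (forall q, disc p r q -> {for q, continuous X}) ->
  exists I c, integral_curve X (disc p r) p I c.
Proof.
move=> r0 X1 cX.
(* Passage from the max norm of [peano] to the Euclidean disc, at the price of a factor 2. *)
have inD (q : R * R) : `|q - p| < r / 2 -> disc p r q.
  by move=> h; apply: le_lt_trans (norm_ge_edist _ _) _; lra.
have r20 : 0 < r / 2 by lra.
have [c [cp Hc]] := @peano R X p (r / 2) r20 X1 (fun q h => cX q (inD q h)).
exists `]- (r / 2), (r / 2)[%classic, c; split => //.
- exact: interval_is_interval.
- by rewrite /= in_itv/=; lra.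
- move=> t; rewrite /= in_itv/= => tr.
  have tr' : `|t| < r / 2 by rewrite ltr_norml; lra.
  have [h1 h2] := Hc t tr'; split => //; apply: inD; exact: le_lt_trans h1 tr'.
Qed.

Lemma disc_sub_open (W : set (R * R)) p : open W -> W p ->
  exists2 r : R, 0 < r & disc p r `<=` W.
Proof.
move=> oW /oW /nbhs_ballP[d /= d0 Hd]; exists d => // q dq; apply: Hd.
have [h1 h2] := edist_le_norm p q.
by split; rewrite /ball/= distrC; [apply: le_lt_trans h1 _|apply: le_lt_trans h2 _].
Qed.

Lemma integral_curve_sub (X : R * R -> R * R) (V W : set (R * R)) p (I : set R) (c : R -> R * R) :
  V `<=` W -> integral_curve X V p I c -> integral_curve X W p I c.
Proof. by move=> VW [oI iI I0 c0 Ic]; split => // t /Ic[/VW]. Qed.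

Lemma prod_norm_le1 (x y : R) : `|x| <= 1 -> `|y| <= 1 -> `|(x, y)| <= 1.
Proof. by rewrite prod_normE /= ge_max => -> ->. Qed.

(** Agreement of two curves holds in all of [W], so any disc contained in [W] serves. *)
Theorem unique_characteristic W theta H p : open W ->
  (forall q, W q -> {for q, continuous theta}) -> [lipschitz H q | q in W] ->
  weak_solution W theta H -> W p ->
  exists r1 : R, [/\ 0 < r1, disc p r1 `<=` W &
    unique_integral_curve (Nperp theta) (disc p r1) p].
Proof.
move=> oW ct /lipschitz_ex[K K0 HK] ws Wp.
have [r r0 rW] := disc_sub_open oW Wp; exists r; split => //.
apply: unique_integral_curve_glue.
  apply: integral_curve_exists => // q.
    by have [h1 h2] := N_le1 theta q; apply: prod_norm_le1; rewrite ?normrN.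
  move=> /rW/ct/N_continuous[h1 h2]; 
  have h1' : {for q, continuous (fun q => - N1 theta q)} by apply: cvgN.
  exact: (cvg_pair h2 h1').
move=> I c J e Ic Je.
exact: (characteristic_agree oW ct K0 HK ws (integral_curve_sub rW Ic) (integral_curve_sub rW Je)).
Qed.
End characteristic_uniqueness.

(** * Polar coordinates *)

Section polar.
Context {R : realType}.
Local Notation mu := (@lebesgue_measure R).
Local Notation mu2 := (@lebesgue_measure R \x @lebesgue_measure R)%E.

Lemma measurable_affine (k d : R) :
  measurable_fun setT (fun x : R => k * x + d : measurableTypeR R).
Proof. by apply: measurable_funD => //; apply: measurable_funM. Qed.

Lemma lebesgue_preimage_affine (k d : R) (a b : R) : k != 0 ->
  (mu `]a, b] = `|k|%:E * mu ((fun x : R => k * x + d)%R @^-1` `]a, b]))%E.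
Proof.
move=> k0; have nk : 0 < `|k| by rewrite normr_gt0.
have [ab|ab] := ltP a b; last first.
  rewrite [X in mu X](_ : _ = set0) ?measure0; last first.
    by apply/seteqP; split => x //=; rewrite in_itv/=; lra.
  rewrite [X in mu X](_ : _ = set0) ?measure0 ?mule0//.
  by apply/seteqP; split => x //=; rewrite in_itv/=; lra.
rewrite lebesgue_measure_itv/= lte_fin ab -EFinB.
have [kp|kn] := ltP 0 k.
  rewrite [X in mu X](_ : _ = `](a - d) / k, (b - d) / k]%classic); last first.
    by apply/seteqP; split => x /=; rewrite !in_itv/= ltr_pdivrMr// ler_pdivlMr// (mulrC x); lra.
  rewrite lebesgue_measure_itv/= lte_fin ltr_pM2r ?invr_gt0//.
  have -> : a - d < b - d by lra.
  by rewrite -EFinB -EFinM ger0_norm ?ltW//; congr EFin; field.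
have {}kn : k < 0 by rewrite lt_neqAle k0.
rewrite [X in mu X](_ : _ = `[(b - d) / k, (a - d) / k[%classic); last first.
  by apply/seteqP; split => x /=; rewrite !in_itv/= ltr_ndivlMr// ler_ndivrMr// (mulrC x); lra.
rewrite lebesgue_measure_itv/= lte_fin ltr_nM2r ?invr_lt0//.
have -> : a - d < b - d by lra.
by rewrite -EFinB -EFinM ltr0_norm//; congr EFin; field.
Qed.

(** |k| times the image of Lebesgue measure under the affine map agrees with Lebesgue measure on
    half-open intervals, hence everywhere. *)
Lemma ge0_integral_affine (k d : R) (h : R -> R) : k != 0 ->
  measurable_fun setT h -> (forall x, 0 <= h x) ->
  (\int[mu]_x (h x)%:E = \int[mu]_x (`|k| * h (k * x + d))%:E)%E.
Proof.
move=> k0 mh h0.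
have mk : @measurable_fun _ _ (measurableTypeR R) (measurableTypeR R) setT (fun x => k * x + d) :=
  measurable_affine k d.
have mEh : @measurable_fun _ _ (measurableTypeR R) _ setT (EFin \o h) by exact/measurable_EFinP.
under [RHS]eq_integral do rewrite EFinM.
rewrite ge0_integralZl_EFin//; last 2 first.
- by move=> x _; rewrite lee_fin.
- by apply/measurable_EFinP; exact: (measurableT_comp mh mk).
have := ge0_integral_pushforward mk mu measurableT mEh.
rewrite preimage_setT => /(_ _)/= <-; last by move=> x _; rewrite lee_fin.
have -> : `|k|%:E = (NngNum (normr_ge0 k))%:num%:E by [].
rewrite -ge0_integral_mscale//; last by move=> x _; rewrite lee_fin.
apply: eq_measure_integral => A mA _.
apply: lebesgue_measure_unique => //= _ [[a b]] _ <-.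
exact: lebesgue_preimage_affine.
Qed.

Definition rad (q : R * R) : R := Num.sqrt (q.1 ^+ 2 + q.2 ^+ 2).

(* The slope [t] replaces the angle, so that only the linear substitutions
   [y = x t] and [x = r / sqrt (1 + t ^ 2)] in one variable are needed. *)
Definition polar_point (r t : R) : R * R :=
  ((Num.sqrt (1 + t ^+ 2))^-1 * r, (Num.sqrt (1 + t ^+ 2))^-1 * r * t).

Lemma sqrt_1Dsqr_gt0 (t : R) : 0 < Num.sqrt (1 + t ^+ 2).
Proof. by rewrite sqrtr_gt0 ltr_pwDl// sqr_ge0. Qed.

Lemma rad_polar_point (r t : R) : 0 <= r -> rad (polar_point r t) = r.
Proof.
move=> r0; rewrite /rad /polar_point /=.
set s := Num.sqrt (1 + t ^+ 2).
have s0 : 0 < s by exact: sqrt_1Dsqr_gt0.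
have s2 : s ^+ 2 = 1 + t ^+ 2 by rewrite sqr_sqrtr// addr_ge0// sqr_ge0.
have -> : (s^-1 * r) ^+ 2 + (s^-1 * r * t) ^+ 2 = s^-1 ^+ 2 * r ^+ 2 * s ^+ 2 by rewrite s2; ring.
rewrite exprVn mulrAC mulVf ?mul1r ?expf_neq0 ?gt_eqF//.
by rewrite sqrtr_sqr ger0_norm.
Qed.

Lemma slope_polar_point (r t : R) : 0 < r -> (polar_point r t).2 / (polar_point r t).1 = t.
Proof. by move=> r0; rewrite /polar_point /=; field; rewrite !gt_eqF// sqrt_1Dsqr_gt0. Qed.

Lemma measurable_inv_sqrt : measurable_fun setT (fun t : R => (Num.sqrt (1 + t ^+ 2))^-1).
Proof.
apply: continuous_measurable_fun => t; apply: cvgV; first by rewrite gt_eqF// sqrt_1Dsqr_gt0.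
apply: (@continuous_comp _ _ _ (fun t : R => 1 + t ^+ 2) (@Num.sqrt R)); last exact: sqrt_continuous.
by apply: cvgD; [exact: cvg_cst|exact: exprn_continuous].
Qed.

Lemma measurable_polar (g : R * R -> R) : measurable_fun setT g ->
  measurable_fun setT (fun z : R * R => (Num.sqrt (1 + z.2 ^+ 2))^-1 ^+ 2 * z.1 *
    g (polar_point z.1 z.2)).
Proof.
move=> mg.
have mK : measurable_fun setT (fun z : R * R => (Num.sqrt (1 + z.2 ^+ 2))^-1).
  exact: (measurableT_comp measurable_inv_sqrt measurable_snd).
have mKr : measurable_fun setT (fun z : R * R => (Num.sqrt (1 + z.2 ^+ 2))^-1 * z.1).
  by apply: measurable_funM => //; exact: measurable_fst.
apply: measurable_funM.
  by apply: measurable_funM; [exact: measurable_funX|exact: measurable_fst].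
apply: (measurableT_comp mg).
apply: measurable_fun_pair => //; apply: measurable_funM => //; exact: measurable_snd.
Qed.

(** Slopes parametrise the half-plane x > 0 only, hence the condition on the support. The Jacobian
    k^2 r with k = (1 + t^2)^(-1/2) arises as x = k r from the substitution in y times k from the
    one in x, with Tonelli's theorem between them. *)
Lemma polar_integral (g : R * R -> R) : measurable_fun setT g -> (forall q, 0 <= g q) ->
  (forall q, q.1 <= 0 -> g q = 0) ->
  (\int[mu2]_z (g z)%:E =
   \int[mu]_r \int[mu]_t ((Num.sqrt (1 + t ^+ 2))^-1 ^+ 2 * r * g (polar_point r t))%:E)%E.
Proof.
move=> mg g0 gN.
rewrite fubini_tonelli1; last 2 first.
- exact/measurable_EFinP.
- by move=> z; rewrite lee_fin.
pose G (z : R * R) : R := z.1 * g (z.1, z.1 * z.2).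
have mG : measurable_fun setT G.
  apply: measurable_funM; first exact: measurable_fst.
  apply: (measurableT_comp mg); apply: measurable_fun_pair; first exact: measurable_fst.
  by apply: measurable_funM; [exact: measurable_fst|exact: measurable_snd].
have G0 z : 0 <= G z.
  rewrite /G; have [z0|/ltW z0] := leP z.1 0; first by rewrite gN ?mulr0.
  by rewrite mulr_ge0.
transitivity (\int[mu]_x \int[mu]_t (G (x, t))%:E)%E.
  apply: eq_integral => x _; rewrite /fubini_F /G /=.
  have [x0|x0] := leP x 0.
    under eq_integral do rewrite gN//.
    by under [RHS]eq_integral do rewrite gN// mulr0.
  rewrite (@ge0_integral_affine x 0) ?gt_eqF//; last exact: (measurableT_comp mg (measurable_pair1 _)).
  by apply: eq_integral => t _; rewrite addr0 gtr0_norm.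
rewrite (@fubini_tonelli _ _ _ _ _ mu mu (fun z => (G z)%:E)); last 2 first.
- exact/measurable_EFinP.
- by move=> z; rewrite lee_fin.
pose K (z : R * R) : R := (Num.sqrt (1 + z.2 ^+ 2))^-1 ^+ 2 * z.1 * g (polar_point z.1 z.2).
have mK : measurable_fun setT K by exact: measurable_polar.
have K0 z : 0 <= K z.
  rewrite /K; have [z0|/ltW z0] := leP z.1 0.
    rewrite gN ?mulr0//= mulr_ge0_le0// invr_ge0 sqrtr_ge0//.
  by rewrite !mulr_ge0// ?sqr_ge0.
rewrite (@fubini_tonelli _ _ _ _ _ mu mu (fun z => (K z)%:E)); last 2 first.
- exact/measurable_EFinP.
- by move=> z; rewrite lee_fin.
apply: eq_integral => t _.
pose k : R := (Num.sqrt (1 + t ^+ 2))^-1.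
have k0 : 0 < k by rewrite invr_gt0 sqrt_1Dsqr_gt0.
rewrite (@ge0_integral_affine k 0) ?gt_eqF//; last exact: (measurableT_comp mG (measurable_pair2 _)).
apply: eq_integral => r _; rewrite addr0 gtr0_norm// /G /K /polar_point /= -/k.
by congr EFin; ring.
Qed.

(** On the circle of radius r the slopes met by [B] lie within l / r of any one of them, and the
    integrand in t is at most r h(r); so the inner integral is at most 2 (l / r) r h(r) = 2 l
    h(r). *)
Lemma polar_bound (f : R * R -> R) (h : R -> \bar R) (B : set (R * R)) (l rho : R) :
  measurable B -> measurable_fun setT f -> (forall q, 0 <= f q) ->
  (forall q, ((f q)%:E <= h (rad q))%E) ->
  (forall q, B q -> 0 < q.1 /\ rad q < rho) ->
  (forall q q', B q -> B q' -> rad q = rad q' ->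
     rad q * `|q.2 / q.1 - q'.2 / q'.1| <= l) -> 0 < l ->
  (\int[mu2]_(q in B) (f q)%:E <= (2 * l)%:E * \int[mu]_(r in `]0%R, rho[) h r)%E.
Proof.
move=> mB mf f0 fh BP Bl l0.
pose g (q : R * R) : R := f q * \1_B q.
have mg : measurable_fun setT g by apply: measurable_funM => //; exact: measurable_indic.
have g0 q : 0 <= g q by rewrite mulr_ge0// indicE; case: (_ \in _).
have gB q : ~ B q -> g q = 0.
  by move=> Bq; rewrite /g indicE memNset// mulr0.
have gf q : g q <= f q by rewrite ler_piMr// indicE; case: (_ \in _).
have gN q : q.1 <= 0 -> g q = 0.
  by move=> q0; apply: gB => /BP[]; rewrite ltNge q0.
have -> : (\int[mu2]_(q in B) (f q)%:E = \int[mu2]_q (g q)%:E)%E.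
  rewrite integral_mkcond; apply: eq_integral => q _; rewrite patchE /g indicE.
  by case: ifP; rewrite ?mulr1 ?mulr0.
rewrite polar_integral//.
set F := fun r : R => (\int[mu]_t _)%E.
have h0 r : 0 <= r -> (0 <= h r)%E.
  by move=> r0; rewrite -(rad_polar_point 0 r0); apply: le_trans (fh _); rewrite lee_fin.
pose D : set R := `]0, rho[%classic.
have l20 : 0 < 2 * l by lra.
have hD r : (0 <= (h \_ D) r)%E.
  rewrite patchE; case: ifPn => //; rewrite inE /D/= in_itv/= => /andP[r0 _].
  exact/h0/ltW.
pose K (z : R * R) : R := (Num.sqrt (1 + z.2 ^+ 2))^-1 ^+ 2 * z.1 * g (polar_point z.1 z.2).
have mK : measurable_fun setT K by exact: measurable_polar.
have K0 z : 0 <= K z.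
  rewrite /K; have [z0|/ltW z0] := leP z.1 0.
    rewrite gN ?mulr0//= mulr_ge0_le0// invr_ge0 sqrtr_ge0//.
  by rewrite !mulr_ge0// ?sqr_ge0.
have F0 r : (0 <= F r)%E by apply: integral_ge0 => t _; rewrite lee_fin (K0 (r, t)).
have mF : measurable_fun setT F.
  apply: (@measurable_fun_fubini_tonelli_F _ _ _ _ _ mu (fun z => (K z)%:E)).
    exact/measurable_EFinP.
  by move=> z; rewrite lee_fin.
have Fh r : (F r <= (2 * l)%:E * (h \_ D) r)%E.
  have F00 : (forall t, g (polar_point r t) = 0) -> F r = 0%E.
    move=> gr; rewrite /F; under eq_integral do rewrite gr mulr0.
    by rewrite integral0.
  have RHS0 : (0 <= (2 * l)%:E * (h \_ D) r)%E by rewrite mule_ge0// lee_fin ltW.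
  have [[t0 Bt]|nB] := pselect (exists t, B (polar_point r t)); last first.
    rewrite F00// => t; apply: gB => Bt; apply: nB; by exists t.
  have [p0 prho] := BP _ Bt.
  have r0 : 0 < r by move: p0; rewrite /polar_point /= pmulr_rgt0// invr_gt0 sqrt_1Dsqr_gt0.
  have rD : r \in D.
    by rewrite inE /D/= in_itv/= r0; move: prho; rewrite rad_polar_point// ltW.
  rewrite patchE rD.
  have [hr|hr] := eqVneq (h r) +oo%E; first by rewrite hr gt0_muley// ?lte_fin// leey.
  have hf : h r \is a fin_num.
    by rewrite ge0_fin_numE ?h0 ?ltW// lt_neqAle hr leey.
  rewrite -(fineK hf); set M := fine (h r).
  have M0 : 0 <= M by rewrite fine_ge0// h0// ltW.
  pose J : set R := `[t0 - l / r, t0 + l / r]%classic.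
  apply: (@le_trans _ _ (\int[mu]_(t in J) (r * M)%:E)%E).
    rewrite [leRHS]integral_mkcond.
    apply: (@le_integral_off_null _ _ _ mu set0) => //.
    - by move=> t; rewrite lee_fin (K0 (r, t)).
    - by move=> t; rewrite patchE; case: ifP => // _; rewrite lee_fin mulr_ge0// ltW.
    move=> t _; rewrite patchE.
    have [Bp|/gB ->] := pselect (B (polar_point r t)); last first.
      by rewrite mulr0; case: ifP => // _; rewrite lee_fin mulr_ge0// ltW.
    have tJ : t \in J.
      have := Bl _ _ Bp Bt; rewrite !(rad_polar_point _ (ltW r0)) !slope_polar_point// => /(_ erefl).
      rewrite mulrC -ler_pdivlMr// ler_norml inE /J/= in_itv/=; qlra.
    rewrite tJ lee_fin.
    have gM : g (polar_point r t) <= M.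
      apply: le_trans (gf _) _; rewrite -lee_fin fineK//.
      by have := fh (polar_point r t); rewrite rad_polar_point// ltW.
    have k1 : (Num.sqrt (1 + t ^+ 2))^-1 ^+ 2 <= 1.
      rewrite exprVn sqr_sqrtr ?addr_ge0 ?sqr_ge0// invf_le1 ?lerDl ?sqr_ge0//.
      by rewrite ltr_pwDl// sqr_ge0.
    rewrite ler_pM//; first by rewrite mulr_ge0 ?sqr_ge0// ltW.
    by rewrite ler_piMl// ltW.
  have muJ : mu J = (2 * (l / r))%:E.
    have lr : 0 < l / r by rewrite divr_gt0.
    rewrite /J lebesgue_measure_itv/= lte_fin.
    have -> : t0 - l / r < t0 + l / r by lra.
    by rewrite -EFinB; congr EFin; ring.
  rewrite integral_cst; last exact: measurable_itv.
  rewrite [X in ((r * M)%:E * X)%E]muJ -!EFinM lee_fin le_eqVlt; apply/orP; left; apply/eqP.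
  by field; rewrite gt_eqF.
(* The constant is moved to the side of [F], which is measurable, whereas [h] is not assumed to
   be. *)
have -> : (\int[mu]_r F r = (2 * l)%:E * \int[mu]_r ((2 * l)^-1%:E * F r))%E.
  rewrite ge0_integralZl_EFin// ?invr_ge0 ?ltW//.
  by rewrite muleA -EFinM divff ?mul1e// gt_eqF.
rewrite lee_pmul2l// ?lte_fin//.
rewrite [leRHS]integral_mkcond; apply: (@le_integral_off_null _ _ _ mu set0) => //.
  by move=> r; rewrite mule_ge0// lee_fin invr_ge0 ltW.
move=> r _; rewrite lee_pdivrMl//.
Qed.

Import HBNNSimple.

(** As [h] may fail to be measurable, smallness is obtained from a simple function [g] below [h]
    whose integral is within e/2 of the whole. A simple function [k] below [h] on (0, rho), together
    with [g] elsewhere, is still below [h] on (0, r0). Comparing integrals, [k] exceeds the part of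
    [g] on (0, rho) by at most e/2, and that part is at most M rho <= e/2. *)
Lemma lower_integral_small (h : R -> \bar R) (r0 e : R) : 0 < r0 -> 0 < e ->
  (forall r, 0 < r -> (0 <= h r)%E) ->
  (\int[mu]_(r in `]0%R, r0[) h r < +oo)%E ->
  exists2 rho : R, 0 < rho <= r0 & (\int[mu]_(r in `]0%R, rho[) h r <= e%:E)%E.
Proof.
move=> r00 e0 h0 hfin.
set A := (\int[mu]_(r in _) _)%E in hfin.
pose D (r : R) : set R := `]0, r[%classic.
have hD r : forall x, D r x -> (0 <= h x)%E.
  by move=> x; rewrite /D/= in_itv/= => /andP[/h0].
have hpD r x : (0 <= (h \_ (D r)) x)%E.
  by rewrite patchE; case: ifPn => //; rewrite inE; exact: hD.
have Af : A \is a fin_num by rewrite ge0_fin_numE// integral_ge0//; exact: hD.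
have AE : A = (\int[mu]_x (h \_ (D r0)) x)%E by rewrite /A integral_mkcond.
have e20 : 0 < e / 2 by lra.
have [g [gh Ag]] : exists g : {nnsfun measurableTypeR R >-> R}, (forall x, ((g x)%:E <= (h \_ (D r0)) x)%E) /\
    (A < \int[mu]_x (g x)%:E + (e / 2)%:E)%E.
  have Af' := Af; rewrite AE ge0_integralTE// in Af'.
  have [_ [g gh <-]] := ub_ereal_sup_adherent e20 Af'.
  rewrite -ge0_integralTE// -AE lteBlDr// => Ag.
  by exists g; split => //; rewrite integralT_nnsfun.
have [M0 [M0r gM0]] : bounded_fun g by exact: simple_bounded.
pose M : R := Num.max (M0 + 1) 1.
have M1 : 1 <= M by rewrite /M le_max lexx orbT.
have gM x : g x <= M.
  apply: le_trans (ler_norm _) _; apply: (gM0 M) => //.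
  by rewrite /M lt_max ltrDl ltr01.
exists (Num.min r0 (e / 2 / M)).
  rewrite ge_min lexx lt_min r00 /=; rewrite andbT divr_gt0//; lra.
set rho := Num.min _ _.
have rhoM : M * rho <= e / 2.
  by rewrite mulrC -ler_pdivlMr ?ge_min ?lexx ?orbT//; lra.
have rho0 : 0 < rho by rewrite lt_min r00 divr_gt0//; lra.
have rr0 : rho <= r0 by rewrite ge_min lexx.
have mD r : measurable (D r) by exact: measurable_itv.
rewrite ge0_integralE; last by move=> x; exact: hD.
apply: ge_ereal_sup => _ [k kh <-]; rewrite -integralT_nnsfun.
pose gi (x : R) : R := g x * \1_(D rho) x; pose go (x : R) : R := g x * \1_(~` D rho) x.
have mind (S : set R) : measurable S -> @measurable_fun _ _ (measurableTypeR R) _ setT (\1_S : R -> R).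
  by move=> mS; exact: (@measurable_indic _ (measurableTypeR R)).
have mg : @measurable_fun _ _ (measurableTypeR R) _ setT (g : R -> R) by [].
have mgi : measurable_fun setT gi := measurable_funM mg (mind _ (mD rho)).
have mgo : measurable_fun setT go := measurable_funM mg (mind _ (measurableC (mD rho))).
have gi0 x : 0 <= gi x by rewrite mulr_ge0.
have go0 x : 0 <= go x by rewrite mulr_ge0.
have gE : (\int[mu]_x (g x)%:E = \int[mu]_x (gi x)%:E + \int[mu]_x (go x)%:E)%E.
  rewrite -ge0_integralD//; last 4 first.
  - by move=> x _; rewrite lee_fin.
  - exact/measurable_EFinP.
  - by move=> x _; rewrite lee_fin.
  - exact/measurable_EFinP.
  apply: eq_integral => x _; rewrite -EFinD /gi /go !indicE in_setC.
  by case: (x \in D rho); rewrite /= ?mulr1 ?mulr0 ?addr0 ?add0r.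
have giE : (\int[mu]_x (gi x)%:E <= (e / 2)%:E)%E.
  apply: (@le_trans _ _ (\int[mu]_(x in D rho) M%:E)%E).
    rewrite [leRHS]integral_mkcond; apply: (@le_integral_off_null _ _ _ mu set0) => //.
    - by move=> x; rewrite patchE; case: ifP => // _; rewrite lee_fin; qlra.
    move=> x _; rewrite patchE /gi indicE; case: (x \in D rho); rewrite ?mulr1 ?mulr0 ?lee_fin//.
  rewrite integral_cst; last exact: mD.
  have muD : mu (D rho) = rho%:E by rewrite /D lebesgue_measure_itv/= lte_fin rho0 oppr0 adde0.
  by rewrite [X in (_ * X)%E]muD -EFinM lee_fin.
have kgo : (\int[mu]_x (k x)%:E + \int[mu]_x (go x)%:E <= A)%E.
  rewrite -ge0_integralD//; last 4 first.
  - by move=> x _; rewrite lee_fin.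
  - exact/measurable_EFinP.
  - by move=> x _; rewrite lee_fin.
  - exact/measurable_EFinP.
  rewrite AE; apply: (@le_integral_off_null _ _ _ mu set0) => //.
    by move=> x; rewrite -EFinD lee_fin addr_ge0.
  move=> x _; have := kh x; have := gh x; rewrite !patchE /go indicE in_setC.
  have [xD|xD] := boolP (x \in D rho).
    rewrite mulr0 adde0.
    have -> // : x \in D r0.
    by move: xD; rewrite !inE /D/= !in_itv/=; move: rr0; clear; lra.
  rewrite mulr1 => gx kx; apply: le_trans gx; rewrite geeDr//.
have goA : (\int[mu]_x (go x)%:E <= A)%E.
  by apply: le_trans kgo; rewrite leeDr// integral_ge0// => x _; rewrite lee_fin.
have gof : (\int[mu]_x (go x)%:E)%E \is a fin_num.
  rewrite ge0_fin_numE; first by apply: le_lt_trans goA _.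
  by apply: integral_ge0 => x _; rewrite lee_fin.
rewrite -(leeD2rE _ _ gof); apply: le_trans kgo _; apply: le_trans (ltW Ag) _.
rewrite gE addeAC leeD2r//.
have -> : e%:E = ((e / 2)%:E + (e / 2)%:E)%E by rewrite -EFinD; congr EFin; qlra.
by rewrite leeD2r.
Qed.

End polar.

(** * Seed curves *)

Section graphs.
Context {R : realType}.
Local Notation mu := (@lebesgue_measure R).
Local Notation mu2 := (@lebesgue_measure R \x @lebesgue_measure R)%E.
Implicit Types (P Q f : R * R -> R) (u w : R -> R -> R) (a b : R -> R).

Definition mass f (A : set (R * R)) : R := fine (\int[mu2]_(q in A) (f q)%:E)%E.

Section mass_lemmas.
Variable f : R * R -> R.
Hypothesis f0 : forall q, 0 <= f q.
Hypothesis fi : mu2.-integrable setT (EFin \o f).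

Lemma massE (A : set (R * R)) : measurable A -> ((mass f A)%:E = \int[mu2]_(q in A) (f q)%:E)%E.
Proof.
move=> mA; rewrite /mass fineK//.
by apply: integrable_fin_num => //; exact: (integrableS measurableT).
Qed.

Lemma mass_ge0 (A : set (R * R)) : 0 <= mass f A.
Proof. by rewrite fine_ge0// integral_ge0// => q _; rewrite lee_fin. Qed.

Lemma le_mass (A B : set (R * R)) : measurable A -> measurable B -> A `<=` B -> mass f A <= mass f B.
Proof.
move=> mA mB AB; rewrite -lee_fin !massE//.
apply: ge0_subset_integral => //; last by move=> q _; rewrite lee_fin.
by have /integrableP[] : mu2.-integrable B (EFin \o f) by exact: (integrableS measurableT).
Qed.

Lemma massU (A B : set (R * R)) : measurable A -> measurable B -> [disjoint A & B] ->
  mass f (A `|` B) = mass f A + mass f B.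
Proof.
move=> mA mB AB; apply: EFin_inj; rewrite EFinD !massE//; last exact: measurableU.
apply: ge0_integral_setU => //; last by move=> q _; rewrite lee_fin.
have /integrableP[] // : mu2.-integrable (A `|` B) (EFin \o f).
by apply: (integrableS measurableT) => //; exact: measurableU.
Qed.
End mass_lemmas.

(** The data of part (a), centred at the origin: the weak equation enters as a bound of the flux by
    the mass of [f], and [h], later the maximum of |H| over circles, is a radial majorant of [f]. *)
Definition flux_data P Q u w f (h : R -> \bar R) (r : R) :=
  [/\ forall x y : R, `|x| < r -> `|y| < r ->
        is_derive y 1 (u x) (P (x, y)) /\ is_derive x 1 (fun x => w x y) (Q (x, y)),
      forall x1 x2 y1 y2 : R, - r < x1 -> x1 < x2 -> x2 < r -> - r < y1 -> y1 < y2 -> y2 < r ->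
        `|mixed_diff u x1 x2 y1 y2 + mixed_diff w x1 x2 y1 y2| <= mass f (open_rect x1 x2 y1 y2),
      measurable_fun setT f /\ forall q, 0 <= f q,
      mu2.-integrable setT (EFin \o f) &
      forall q, ((f q)%:E <= h (rad q))%E].

(** The slope Q / P stays within 1/16 of [m], which confines the graphs starting at the origin to a
    narrow cone about the line y = m x. *)
Definition cone P Q (r m : R) := `|m| <= 1 /\
  forall q : R * R, `|q.1| < r -> `|q.2| < r ->
    [/\ 1 / 2 <= P q, P q <= 1, `|Q q - m * P q| <= P q / 16,
        {for q, continuous P} & {for q, continuous Q}].

Definition graph P Q (r X : R) a := [/\ a 0 = 0,
  forall x : R, 0 <= x <= X -> `|a x| < r &
  forall x : R, 0 <= x <= X -> is_derive x 1 a (Q (x, a x) / P (x, a x))].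

Lemma graph_slope P Q (r m X : R) a (x x' : R) : cone P Q r m -> X < r -> graph P Q r X a ->
  0 <= x -> x <= x' -> x' <= X ->
  (m - 1 / 16) * (x' - x) <= a x' - a x <= (m + 1 / 16) * (x' - x).
Proof.
move=> [m1 co] Xr [a0 ar da] x0 xx xX.
have [z||z zx ->] := @MVT_segment _ a (fun x => Q (x, a x) / P (x, a x)) x x' xx.
- by rewrite in_itv/= => zz; apply: da; lra.
- apply: continuous_in_subspaceT => z; rewrite inE/= in_itv/= => zz.
  by apply: (is_derive1_continuous (da z _)); lra.
move: zx; rewrite in_itv/= => zx.
have z0 : 0 <= z <= X by lra.
have [||P2 _ QP _ _] := co (z, a z).
- by rewrite /= ger0_norm; lra.
- exact: ar.
have P0 : 0 < P (z, a z) by lra.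
suff : m - 1 / 16 <= Q (z, a z) / P (z, a z) <= m + 1 / 16.
  by move=> /andP[h1 h2]; rewrite !ler_wpM2r// subr_ge0.
rewrite ler_pdivlMr// ler_pdivrMr//; move: QP; rewrite ler_norml; lra.
Qed.

Lemma graph_lip P Q (r m X : R) a (x x' : R) : cone P Q r m -> X < r -> graph P Q r X a ->
  0 <= x <= X -> 0 <= x' <= X -> `|a x' - a x| <= 2 * `|x' - x|.
Proof.
move=> co Xr ga; have [m1 _] := co; move: m1; rewrite ler_norml => m1.
have main (s t : R) : 0 <= s -> s <= t -> t <= X -> `|a t - a s| <= 2 * (t - s).
  move=> s0 st tX; have := graph_slope co Xr ga s0 st tX.
  by rewrite ler_norml; move: m1 st; clear; nra.
move=> xX xX'; have [xx|/ltW xx] := leP x x'.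
  by rewrite [`|x' - x|]ger0_norm ?subr_ge0//; apply: main; lra.
by rewrite distrC [`|x' - x|]distrC [`|x - x'|]ger0_norm ?subr_ge0//; apply: main; lra.
Qed.

(** No flux crosses a seed curve, in infinitesimal form: the difference of [u] is about P a' dx,
    that of [w] about Q dx, and P a' = Q along the graph. *)
Lemma graph_step P Q u w f h (r m X : R) a (x e : R) : flux_data P Q u w f h r ->
  cone P Q r m -> X < r -> graph P Q r X a -> 0 <= x <= X -> 0 < e ->
  exists2 d : R, 0 < d & forall x', 0 <= x' <= X -> `|x' - x| < d ->
    `|u x' (a x') - u x' (a x) - (w x' (a x) - w x (a x))| <= e * `|x' - x|.
Proof.
move=> [du _ _ _ _] co Xr ga xX e0; have [m1 co'] := co; have [a0 ar da] := ga.
have xr : `|x| < r by rewrite ger0_norm; lra.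
have [P2 P1 QP cP cQ] := co' (x, a x) xr (ar x xX).
have e40 : 0 < e / 4 by lra.
have /cvgrPdist_le/(_ _ e40)/nbhs_ballP[d1 /= d10 Hd1] := cP.
have /cvgrPdist_le/(_ _ e40)/nbhs_ballP[d2 /= d20 Hd2] := cQ.
have /is_derive1P/(_ _ e40)[d3 d30 Hd3] := da x xX.
exists (Num.min (d1 / 2) (Num.min (d2 / 2) d3)); first by rewrite !lt_min d30 !divr_gt0.
move=> x' xX'; rewrite !lt_min => /and3P[xd1 xd2 xd3].
have xr' : `|x'| < r by rewrite ger0_norm; qlra.
have lip := graph_lip co Xr ga xX xX'.
have arx := ar x xX; have arx' := ar x' xX'.
have rl (y : R) : - r < y < r -> `|y| < r by rewrite ltr_norml.
have rl' (y : R) : `|y| < r -> - r < y < r by rewrite ltr_norml.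
have [z zx [_ Ez]] := @mvt_between _ (u x') (fun y => P (x', y)) (- r) r (a x) (a x')
  (fun y yr => proj1 (du x' y xr' (rl y yr))) (rl' _ arx) (rl' _ arx').
have [s sx [_ Es]] := @mvt_between _ (fun s => w s (a x)) (fun s => Q (s, a x)) (- r) r x x'
  (fun y yr => proj2 (du y (a x) (rl y yr) arx)) (rl' _ xr) (rl' _ xr').
rewrite Ez Es.
have hP : `|P (x, a x) - P (x', z)| <= e / 4.
  apply: Hd1; split; rewrite /ball/= distrC; first by qlra.
  by move: zx lip xd1; clear; lra.
have hQ : `|Q (x, a x) - Q (s, a x)| <= e / 4.
  apply: Hd2; split; rewrite /ball/= distrC; first by qlra.
  by rewrite subrr normr0.
have := Hd3 x' xd3; rewrite scale_realE.
set p := P (x, a x) in P2 P1 QP hP *; set q := Q (x, a x) in QP hQ *.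
set p' := P (x', z) in hP *; set q' := Q (s, a x) in hQ *.
set D := a x' - a x in lip *; set X' := x' - x in lip *.
move=> hD.
have -> : p' * D - q' * X' = - ((p - p') * D) + p * (D - X' * (q / p)) + (q - q') * X'.
  by field; qlra.
have p0 : 0 <= p by qlra.
apply: (@le_trans _ _ (e / 4 * (2 * `|X'|) + 1 * (e / 4 * `|X'|) + e / 4 * `|X'|)); last first.
  by rewrite le_eqVlt; apply/orP; left; apply/eqP; field.
apply: le_trans (ler_normD _ _) _; apply: lerD; last first.
  by rewrite normrM ler_wpM2r.
apply: le_trans (ler_normD _ _) _; apply: lerD.
  by rewrite normrN normrM ler_pM.
by rewrite normrM ler_pM// ger0_norm.
Qed.

Lemma mixed_diff_swap1 u (x1 x2 y1 y2 : R) : mixed_diff u x2 x1 y1 y2 = - mixed_diff u x1 x2 y1 y2.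
Proof. by rewrite /mixed_diff; ring. Qed.

Lemma mixed_diff_swap2 u (x1 x2 y1 y2 : R) : mixed_diff u x1 x2 y2 y1 = - mixed_diff u x1 x2 y1 y2.
Proof. by rewrite /mixed_diff; ring. Qed.

Lemma rect_flux_le_mass P Q u w f h (r x x' y y' : R) : flux_data P Q u w f h r ->
  `|x| < r -> `|x'| < r -> `|y| < r -> `|y'| < r ->
  `|mixed_diff u x x' y y' + mixed_diff w x x' y y'| <=
  mass f (open_rect (Num.min x x') (Num.max x x') (Num.min y y') (Num.max y y')).
Proof.
move=> [_ rf [_ f0] _ _] xr xr' yr yr'; rewrite !ltr_norml in xr xr' yr yr'.
have [xx|xx|xx] := ltgtP x x'; last 1 first.
- by rewrite xx /mixed_diff !subrr addr0 normr0 mass_ge0.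
- have [yy|yy|yy] := ltgtP y y'; last 1 first.
  + by rewrite yy /mixed_diff !subrr addr0 normr0 mass_ge0.
  + by apply: rf; qlra.
  + by rewrite mixed_diff_swap2 (mixed_diff_swap2 w) -opprD normrN; apply: rf; qlra.
- have [yy|yy|yy] := ltgtP y y'; last 1 first.
  + by rewrite yy /mixed_diff !subrr addr0 normr0 mass_ge0.
  + by rewrite mixed_diff_swap1 (mixed_diff_swap1 w) -opprD normrN; apply: rf; qlra.
  + rewrite mixed_diff_swap1 (mixed_diff_swap1 w) -opprD normrN.
    by rewrite mixed_diff_swap2 (mixed_diff_swap2 w) -opprD normrN; apply: rf; qlra.
Qed.

(** Subtracting [graph_step] for [a] from the one for [b] leaves the flux through the rectangle
    between the heights [a x] and [b x]. *)
Lemma gap_step P Q u w f h (r m X : R) a b (x e : R) : flux_data P Q u w f h r ->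
  cone P Q r m -> X < r -> graph P Q r X a -> graph P Q r X b -> 0 <= x <= X -> 0 < e ->
  exists2 d : R, 0 < d & forall x', 0 <= x' <= X -> `|x' - x| < d ->
    `|(u x' (b x') - u x' (a x')) - (u x (b x) - u x (a x))| <=
    mass f (open_rect (Num.min x x') (Num.max x x') (Num.min (a x) (b x)) (Num.max (a x) (b x))) +
    e * `|x' - x|.
Proof.
move=> fd co Xr ga gb xX e0; have e20 : 0 < e / 2 by lra.
have [d1 d10 Hd1] := graph_step fd co Xr ga xX e20.
have [d2 d20 Hd2] := graph_step fd co Xr gb xX e20.
exists (Num.min d1 d2); first by rewrite lt_min d10.
move=> x' xX'; rewrite lt_min => /andP[xd1 xd2].
have := Hd1 x' xX' xd1; have := Hd2 x' xX' xd2.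
have [_ ar _] := ga; have [_ br _] := gb.
have xr : `|x| < r by rewrite ger0_norm; qlra.
have xr' : `|x'| < r by rewrite ger0_norm; qlra.
have := rect_flux_le_mass fd xr xr' (ar x xX) (br x xX).
set M := mass _ _; rewrite /mixed_diff !ler_norml.
move: (u x' (b x')) (u x' (a x')) (u x (b x)) (u x (a x)) (u x' (b x)) (u x' (a x))
  (w x' (b x)) (w x' (a x)) (w x (b x)) (w x (a x)) (`|x' - x|).
by clear => *; lra.
Qed.

(* Widening by [e x] instead of a constant keeps the lens inside a cone, so that
   it meets small circles in short arcs. *)
Definition lens a b (X e : R) : set (R * R) := [set q | 0 < q.1 < X /\
  Num.min (a q.1) (b q.1) - e * q.1 < q.2 < Num.max (a q.1) (b q.1) + e * q.1].

Lemma min_max_slope (a1 a2 b1 b2 c d : R) : c <= a2 - a1 <= d -> c <= b2 - b1 <= d ->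
  c <= Num.min a2 b2 - Num.min a1 b1 <= d /\ c <= Num.max a2 b2 - Num.max a1 b1 <= d.
Proof.
by move=> h1 h2; have [h3|h3] := leP a1 b1; have [h4|h4] := leP a2 b2; split; lra.
Qed.

Lemma min_max_lip P Q (r m X : R) a b (x x' : R) : cone P Q r m -> X < r ->
  graph P Q r X a -> graph P Q r X b -> 0 <= x <= X -> 0 <= x' <= X ->
  `|Num.min (a x') (b x') - Num.min (a x) (b x)| <= 2 * `|x' - x| /\
  `|Num.max (a x') (b x') - Num.max (a x) (b x)| <= 2 * `|x' - x|.
Proof.
move=> co Xr ga gb xX xX'; rewrite !ler_norml; apply: min_max_slope.
  by rewrite -ler_norml; exact: (graph_lip co Xr ga).
by rewrite -ler_norml; exact: (graph_lip co Xr gb).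
Qed.

Lemma measurable_lens P Q (r m X e : R) a b : cone P Q r m -> X < r ->
  graph P Q r X a -> graph P Q r X b -> 0 < e <= 1 -> measurable (lens a b X e).
Proof.
move=> co Xr ga gb e01; apply: open_measurable_plane; rewrite openE => q [q1 q2].
pose d := Num.min (Num.min q.1 (X - q.1))
  (Num.min (q.2 - (Num.min (a q.1) (b q.1) - e * q.1)) (Num.max (a q.1) (b q.1) + e * q.1 - q.2)).
have [d1 d2 d3 d4] : [/\ d <= q.1, d <= X - q.1, d <= q.2 - (Num.min (a q.1) (b q.1) - e * q.1) &
    d <= Num.max (a q.1) (b q.1) + e * q.1 - q.2].
  by rewrite /d; split; rewrite !ge_min lexx ?orbT.
have d0 : 0 < d by rewrite /d !lt_min; lra.
apply/nbhs_ballP; exists (d / 4) => /=; first by rewrite divr_gt0.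
move=> z [/=]; rewrite /ball/= !ltr_norml => z1 z2.
have z1X : 0 < z.1 < X by qlra.
split => //.
have [l1 l2] := @min_max_lip P Q r m X a b q.1 z.1 co Xr ga gb ltac:(qlra) ltac:(qlra).
have zq : `|z.1 - q.1| <= d / 4 by rewrite ler_norml; qlra.
have ee : `|e * (z.1 - q.1)| <= 1 * (d / 4) by rewrite normrM ler_pM// ger0_norm; qlra.
have {}l1 := le_trans l1 (ler_wpM2l (ler0n R 2) zq).
have {}l2 := le_trans l2 (ler_wpM2l (ler0n R 2) zq).
rewrite mulrBr in ee; rewrite !ler_norml in ee l1 l2.
move: (Num.min (a z.1) _) (Num.min _ _) (Num.max (a z.1) _) (Num.max _ _) (e * z.1) (e * q.1) d1 d2 d3 d4 z2 ee l1 l2.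
by clear => *; lra.
Qed.

(** The gap minus the mass of the lens to the left of x minus e x is locally nonincreasing: by
    [gap_step] the gap grows at most by the mass of a thin rectangle, and the widened lens contains
    it. *)
Lemma gap_le_mass P Q u w f h (r m X e : R) a b : flux_data P Q u w f h r ->
  cone P Q r m -> 0 <= X -> X < r -> graph P Q r X a -> graph P Q r X b -> 0 < e <= 1 ->
  u X (b X) - u X (a X) <= mass f (lens a b X e) + e * X.
Proof.
move=> fd co X0 Xr ga gb e01.
have [_ _ [_ f0] fi _] := fd.
have mB := measurable_lens co Xr ga gb e01; set B := lens a b X e in mB *.
pose left (x : R) : set (R * R) := [set q | q.1 < x].
have ml x : measurable (left x).
  have -> : left x = `]-oo, x[%classic `*` setT.
    by apply/seteqP; split => q; rewrite /left /= in_itv/=; [move=> ->|case].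
  by apply: measurableX => //; exact: measurable_itv.
have mBl x : measurable (B `&` left x) by exact: measurableI.
pose F (x : R) : R := u x (b x) - u x (a x) - mass f (B `&` left x) - e * x.
have FX : F X <= F 0.
  apply: locally_nonincreasing => // x xX.
  have e0 : 0 < e by lra.
  have [d d0 Hd] := gap_step fd co Xr ga gb xX e0.
  pose lo := Num.min (a x) (b x); pose hi := Num.max (a x) (b x).
  have [d' d'0 Hd'] : exists2 d' : R, 0 < d' & forall x', 0 <= x' <= X -> `|x' - x| < d' ->
      open_rect (Num.min x x') (Num.max x x') lo hi `<=` B.
    (* At x = 0 the graphs meet and the rectangle is empty. For x > 0 the graphs move by less than e
       x / 2 over the rectangle, which the widening absorbs. *)
    have [x0|x0] := leP x 0.
      exists 1 => // x' _ _ q [_]; rewrite /lo /hi.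
      have -> : x = 0 by lra.
      have [-> _ _] := ga; have [-> _ _] := gb.
      by rewrite minxx maxxx /= in_itv/=; lra.
    exists (Num.min (x / 2) (e * x / 4)); first by rewrite lt_min !divr_gt0// mulr_gt0.
    move=> x' xX'; rewrite lt_min => /andP[xd1 xd2] q [].
    rewrite /= !in_itv/= gt_min lt_max => qx qy.
    have qx' : 0 < q.1 < X by move: xd1; rewrite ltr_norml; qlra.
    have qd : `|q.1 - x| <= `|x' - x|.
      have [xx|xx] := leP x x'.
        by rewrite !ger0_norm; qlra.
      by rewrite !ler0_norm; qlra.
    split => //.
    have [] := @min_max_lip P Q r m X a b x q.1 co Xr ga gb ltac:(qlra) ltac:(qlra).
    have qx2 : x / 2 <= q.1 by have := le_lt_trans qd xd1; rewrite ltr_norml; qlra.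
    have eq : e * x / 2 <= e * q.1 by rewrite -mulrA ler_wpM2l// ltW.
    rewrite -/lo -/hi !ler_norml.
    move: (Num.min _ _) (Num.max _ _) qd xd2 eq qy.
    by clear; move=> *; lra.
  exists (Num.min d d'); first by rewrite lt_min d0.
  move=> x' xX'; rewrite lt_min => /andP[xd xd'].
  have := Hd x' xX' xd; have := Hd' x' xX' xd'; rewrite -/lo -/hi /F => rB.
  have mR (s t : R) : measurable (open_rect s t lo hi).
    by apply: measurableX; exact: measurable_itv.
  have key (s t : R) : s <= t -> open_rect s t lo hi `<=` B ->
      mass f (B `&` left s) + mass f (open_rect s t lo hi) <= mass f (B `&` left t).
    move=> st sB; rewrite -massU//; last first.
      apply/disj_setPS => q [[_ qs] [/= + _]]; rewrite in_itv/=; have {}qs : q.1 < s := qs; qlra.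
    apply: le_mass => //; first exact: measurableU.
    move=> q [[Bq qs]|qr]; first by split => //; move: qs; rewrite /left /=; qlra.
    by split; [exact: sB|move: qr => [/=]; rewrite /left /= in_itv/=; qlra].
  move=> est; split => xx.
    move: est rB; rewrite (min_idPr xx) (max_idPl xx) => est rB.
    have := key x' x xx rB; rewrite [`|x' - x|]ler0_norm ?subr_le0// in est.
    by move: est; rewrite ler_norml; qlra.
  move: est rB; rewrite (min_idPl xx) (max_idPr xx) => est rB.
  have := key x x' xx rB; rewrite [`|x' - x|]ger0_norm ?subr_ge0// in est.
  by move: est; rewrite ler_norml; qlra.
have F0 : F 0 <= 0.
  rewrite /F; have [-> _ _] := ga; have [-> _ _] := gb.
  by have := mass_ge0 f0 (B `&` left 0); lra.
have : mass f (B `&` left X) <= mass f B by apply: le_mass.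
by move: FX F0; rewrite /F; lra.
Qed.

(** A chord whose direction is close to [m], inside a cone about y = m x, would be nearly radial;
    with both ends on one circle, its length is controlled by the allowance [l]. The proof gives x'
    - x <= l, then |y' - y| <= 3 l, then the bound on the slopes. *)
Lemma circle_slice (m x x' y y' l : R) : 0 < x -> x <= x' -> `|m| <= 1 -> 0 <= l ->
  `|y' - y - m * (x' - x)| <= (x' - x) / 16 + l ->
  `|y - m * x| <= x / 8 -> `|y' - m * x'| <= x' / 8 ->
  x ^+ 2 + y ^+ 2 = x' ^+ 2 + y' ^+ 2 ->
  rad (x', y') * `|y / x - y' / x'| <= 8 * l.
Proof.
move=> x0 xx m1 l0 h1 h2 h3 hc.
have x0' : 0 < x' by lra.
pose d := x' - x; pose rho := y' - y - m * d; pose M : R := `|m|.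
have d0 : 0 <= d by rewrite /d; lra.
have M0 : 0 <= M by exact: normr_ge0.
have dl : d <= l.
  pose S := x + x'; pose sg := y + y' - m * S.
  have S0 : 0 < S by rewrite /S; lra.
  have sgS : `|sg| <= S / 8.
    have -> : sg = (y - m * x) + (y' - m * x') by rewrite /sg /S; ring.
    by apply: le_trans (ler_normD _ _) _; rewrite /S; lra.
  (* Difference of the two circle equations, d S + (y' - y) (y + y') = 0, with the direction [m]
     split off from both factors: y' - y = m d + rho and y + y' = m S + sg. *)
  have E : d * (S + m ^+ 2 * S + m * sg) = - (rho * (m * S + sg)).
    by have : d * S + (m * d + rho) * (m * S + sg) = 0;
      [rewrite /rho /sg /d /S; move: hc; clear; lra|clear; lra].
  have b1 : - (M * (S / 8)) <= m * sg.
    have : `|m * sg| <= M * (S / 8) by rewrite normrM ler_wpM2l.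
    by rewrite ler_norml => /andP[].
  have b2 : - (rho * (m * S + sg)) <= (d / 16 + l) * (M * S + S / 8).
    apply: le_trans (ler_norm _) _; rewrite normrN normrM; apply: ler_pM => //.
    apply: le_trans (ler_normD _ _) _; apply: lerD => //.
    by rewrite normrM (ger0_norm (ltW S0)).
  have M2 : m ^+ 2 = M ^+ 2 by rewrite /M real_normK// num_real.
  have b3 : d * (S * (1 + M ^+ 2 - M / 8)) <= (d / 16 + l) * (S * (M + 1 / 8)).
    apply: le_trans (_ : d * (S + m ^+ 2 * S + m * sg) <= _).
      by rewrite ler_wpM2l// M2; move: b1; clear; lra.
    by rewrite E; apply: le_trans b2 _; rewrite le_eqVlt; apply/orP; left; apply/eqP; field.
  have b4 : d * (1 + M ^+ 2 - M / 8) <= (d / 16 + l) * (M + 1 / 8).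
    by rewrite -(ler_pM2l S0) mulrCA [leRHS]mulrCA.
  have b5 : d * (1 + M ^+ 2 - M / 8 - (M + 1 / 8) / 16) <= l * (M + 1 / 8).
    by move: b4; clear; lra.
  (* The difference of the two sides is quadratic in M with its minimum at 19/32, where it is
     positive. *)
  have b6 : M + 1 / 8 <= 1 + M ^+ 2 - M / 8 - (M + 1 / 8) / 16.
    by have := sqr_ge0 (M - 19 / 32); rewrite sqrrB; clear; lra.
  have b7 : d * (M + 1 / 8) <= l * (M + 1 / 8).
    by apply: le_trans b5; rewrite ler_wpM2l.
  by move: b7; rewrite ler_pM2r//; qlra.
pose e := y' - y.
have el : `|e| <= 3 * l.
  have -> : e = rho + m * d by rewrite /e /rho; ring.
  apply: le_trans (ler_normD _ _) _; rewrite normrM (ger0_norm d0).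
  have : M * d <= 1 * l by rewrite ler_pM.
  by move: h1; rewrite -/d -/rho -/M; lra.
have tl : `|y / x| <= 9 / 8.
  rewrite normrM normfV (ger0_norm (ltW x0)) ler_pdivrMr//.
  have -> : y = (y - m * x) + m * x by ring.
  apply: le_trans (ler_normD _ _) _; rewrite normrM (ger0_norm (ltW x0)).
  have : `|m| * x <= 1 * x by rewrite ler_wpM2r// ltW.
  by lra.
have yl : `|y'| <= 9 / 8 * x'.
  have -> : y' = (y' - m * x') + m * x' by ring.
  apply: le_trans (ler_normD _ _) _; rewrite normrM (ger0_norm (ltW x0')).
  have : `|m| * x' <= 1 * x' by rewrite ler_wpM2r// ltW.
  by lra.
have E : y / x - y' / x' = (y / x * d - e) / x'.
  by rewrite /d /e; field; rewrite !gt_eqF.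
have r2 : rad (x', y') <= 2 * x' * (4 / 5).
  rewrite -[leRHS]ger0_norm; last by qlra.
  rewrite -sqrtr_sqr /rad ler_wsqrtr//=.
  have : `|y'| ^+ 2 <= (9 / 8 * x') ^+ 2 by rewrite ler_sqr ?nnegrE//; qlra.
  rewrite real_normK ?num_real// !exprMn; have := sqr_ge0 x'.
  by clear; lra.
rewrite E normrM normfV (ger0_norm (ltW x0')) mulrA ler_pdivrMr//.
have : `|y / x * d - e| <= 9 / 8 * l + 3 * l.
  apply: le_trans (ler_normB _ _) _; apply: lerD => //.
  by rewrite normrM (ger0_norm d0) ler_pM.
move=> h; have r0 : 0 <= rad (x', y') by exact: sqrtr_ge0.
apply: le_trans (_ : 2 * x' * (4 / 5) * (9 / 8 * l + 3 * l) <= _).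
  by rewrite ler_pM.
have : 0 <= l * x' by rewrite mulr_ge0// ltW.
by clear; lra.
Qed.
End graphs.

(** * Coincidence of two graphs through the origin *)

Section graphs_agree.
Context {R : realType}.
Local Notation mu := (@lebesgue_measure R).
Local Notation mu2 := (@lebesgue_measure R \x @lebesgue_measure R)%E.
Implicit Types (P Q f : R * R -> R) (u w : R -> R -> R) (a b : R -> R).

(** The opening 1/8 is 1/16 for the slopes of the graphs plus 1/16 for the widening. *)
Lemma lens_cone P Q (r m X e : R) a b q : cone P Q r m -> X < r ->
  graph P Q r X a -> graph P Q r X b -> 0 < e <= 1 / 16 -> lens a b X e q ->
  `|q.2 - m * q.1| <= q.1 / 8.
Proof.
move=> co Xr ga gb e1 [q1 q2].
have h0 : (0 : R) <= 0 by []. have h1 : 0 <= q.1 by lra. have h2 : q.1 <= X by lra.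
have sa := graph_slope co Xr ga h0 h1 h2; have sb := graph_slope co Xr gb h0 h1 h2.
have [a0 _ _] := ga; have [b0 _ _] := gb.
have [] := min_max_slope sa sb; rewrite a0 b0 minxx maxxx !subr0.
have eq : e * q.1 <= 1 / 16 * q.1 by rewrite ler_wpM2r//; lra.
move: q2 eq; rewrite ler_norml; move: (e * q.1) (Num.min _ _) (Num.max _ _).
by clear => *; lra.
Qed.

Lemma rad_le_cone (x y m : R) : 0 < x -> `|m| <= 1 -> `|y - m * x| <= x / 8 -> rad (x, y) <= 2 * x.
Proof.
move=> x0 m1 h.
have yl : `|y| <= 9 / 8 * x.
  have -> : y = (y - m * x) + m * x by ring.
  apply: le_trans (ler_normD _ _) _; rewrite normrM (ger0_norm (ltW x0)).
  have : `|m| * x <= 1 * x by rewrite ler_wpM2r// ltW.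
  by lra.
rewrite -[leRHS]ger0_norm; last by lra.
rewrite -sqrtr_sqr /rad ler_wsqrtr//=.
have : `|y| ^+ 2 <= (9 / 8 * x) ^+ 2 by rewrite ler_sqr ?nnegrE//; lra.
rewrite real_normK ?num_real// !exprMn; have := sqr_ge0 x.
by clear; lra.
Qed.

(** The 1/16 comes from the slopes of the graphs, and L + 2 e X bounds the vertical thickness of the
    lens. *)
Lemma lens_diff P Q (r m X e L : R) a b (q q' : R * R) : cone P Q r m -> X < r ->
  graph P Q r X a -> graph P Q r X b -> 0 < e <= 1 / 16 ->
  (forall x, 0 <= x <= X -> `|b x - a x| <= L) ->
  lens a b X e q -> lens a b X e q' -> q.1 <= q'.1 ->
  `|q'.2 - q.2 - m * (q'.1 - q.1)| <= (q'.1 - q.1) / 16 + (L + 2 * (e * X)).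
Proof.
move=> co Xr ga gb e1 hL [q1 q2] [q1' q2'] qq.
have h1 : 0 <= q.1 by lra. have h2 : q'.1 <= X by lra.
have sa := graph_slope co Xr ga h1 qq h2; have sb := graph_slope co Xr gb h1 qq h2.
have [] := min_max_slope sa sb.
have mm x : 0 <= x <= X -> Num.max (a x) (b x) - Num.min (a x) (b x) <= L.
  move=> /hL; rewrite ler_norml; have [ab|ab] := leP (a x) (b x); qlra.
have := mm q.1 ltac:(qlra); have := mm q'.1 ltac:(qlra).
have eq : e * q.1 <= e * X by rewrite ler_wpM2l//; qlra.
have eq' : e * q'.1 <= e * X by rewrite ler_wpM2l//; qlra.
move: q2 q2' eq eq'; rewrite ler_norml.
move: (Num.min (a q.1) _) (Num.max (a q.1) _) (Num.min (a q'.1) _) (Num.max (a q'.1) _) (e * q.1) (e * q'.1) (e * X).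
by clear => *; lra.
Qed.

(** If the largest gap L, reached at [X], were positive, then L / 2 <= D(X) <= mass + e X, where the
    mass of the lens is at most 16 (L + 2 e X) / 72 by [polar_bound] and [circle_slice]. This is at
    most L / 4 + e X / 2, so that e X <= L / 12 yields a contradiction. *)
Lemma gap_zero P Q u w f h (r m X : R) a b : flux_data P Q u w f h r ->
  cone P Q r m -> 0 < X -> X < r -> graph P Q r X a -> graph P Q r X b ->
  (\int[mu]_(s in `]0%R, (2 * r)%R[) h s <= (1 / 72)%:E)%E ->
  (forall x, 0 <= x <= X -> `|b x - a x| <= b X - a X) -> b X - a X <= 0.
Proof.
move=> fd co X0 Xr ga gb hs hL; rewrite leNgt; apply/negP.
set L := b X - a X in hL * => L0.
pose e : R := Num.min (1 / 16) (L / (12 * X)).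
have e0 : 0 < e by rewrite lt_min !divr_gt0// mulr_gt0.
have e1 : 0 < e <= 1 / 16 by rewrite e0 /e ge_min lexx.
have eX : e * X <= L / 12.
  rewrite -ler_pdivlMr//; have -> : L / 12 / X = L / (12 * X) by field; rewrite gt_eqF.
  by rewrite /e ge_min lexx orbT.
have eX0 : 0 < e * X by rewrite mulr_gt0.
have [_ ar _] := ga; have [_ br _] := gb; have [m1 co'] := co.
have XX : 0 <= X <= X by rewrite lexx ltW.
have Xr' : `|X| < r by rewrite ger0_norm ?ltW.
have low : L / 2 <= u X (b X) - u X (a X).
  have [du _ _ _ _] := fd.
  have rl (y : R) : - r < y < r -> `|y| < r by rewrite ltr_norml.
  have rl' (y : R) : `|y| < r -> - r < y < r by rewrite ltr_norml.
  have [z _ [zr ->]] := @mvt_between _ (u X) (fun y => P (X, y)) (- r) r (a X) (b X)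
    (fun y yr => proj1 (du X y Xr' (rl y yr))) (rl' _ (ar X XX)) (rl' _ (br X XX)).
  have [P2 _ _ _ _] := co' (X, z) Xr' (rl _ zr).
  have -> : L / 2 = 1 / 2 * L by field.
  by rewrite ler_wpM2r// ltW.
have e11 : 0 < e <= 1 by qlra.
have up := gap_le_mass fd co (ltW X0) Xr ga gb e11.
have [_ _ [mf f0] fi fh] := fd.
have mB := measurable_lens co Xr ga gb e11.
set B := lens a b X e in mB up.
pose l : R := L + 2 * (e * X).
have l0 : 0 < l by rewrite /l; qlra.
have BC q : B q -> `|q.2 - m * q.1| <= q.1 / 8 by exact: lens_cone co Xr ga gb e1.
have B1 q : B q -> 0 < q.1 < X by case.
have slice (q q' : R * R) : B q -> B q' -> q.1 <= q'.1 -> rad q = rad q' ->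
    rad q * `|q.2 / q.1 - q'.2 / q'.1| <= 8 * l.
  move=> Bq Bq' qq rr; rewrite rr [X in rad X](surjective_pairing q').
  apply: (@circle_slice R m q.1 q'.1 q.2 q'.2 l) => //.
  - by have /andP[] := B1 q Bq.
  - exact: ltW.
  - exact: (lens_diff co Xr ga gb e1 hL Bq Bq' qq).
  - exact: BC.
  - exact: BC.
  - have : rad q ^+ 2 = rad q' ^+ 2 by rewrite rr.
    by rewrite /rad !sqr_sqrtr ?addr_ge0 ?sqr_ge0.
have pb : (\int[mu2]_(q in B) (f q)%:E <= (2 * (8 * l))%:E * \int[mu]_(s in `]0%R, (2 * r)%R[) h s)%E.
  apply: polar_bound => //.
  - move=> q Bq; have /andP[q0 qX] := B1 q Bq; split => //.
    rewrite (surjective_pairing q); apply: le_lt_trans (rad_le_cone q0 m1 (BC q Bq)) _.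
    by qlra.
  - move=> q q' Bq Bq' rr; have [qq|/ltW qq] := leP q.1 q'.1; first exact: slice.
    by rewrite rr distrC; apply: slice.
  - by rewrite mulr_gt0.
have mB' : mass f B <= L / 4 + (e * X) / 2.
  rewrite -lee_fin massE//; apply: le_trans pb _.
  apply: (@le_trans _ _ ((2 * (8 * l))%:E * (1 / 72)%:E)%E).
    by rewrite lee_wpmul2l// lee_fin !mulr_ge0// ltW.
  by rewrite -EFinM lee_fin /l; qlra.
by qlra.
Qed.

Lemma graph_sub P Q (r X X' : R) a : X' <= X -> graph P Q r X a -> graph P Q r X' a.
Proof. by move=> XX [a0 ar da]; split => // x xX; [apply: ar|apply: da]; lra. Qed.

(** [gap_zero] is applied on [0, y], where y maximises |b - a| on [0, X], so that the gap is largest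
    at the right end. *)
Theorem graphs_agree P Q u w f h (r m X : R) a b : flux_data P Q u w f h r ->
  cone P Q r m -> 0 <= X -> X < r -> graph P Q r X a -> graph P Q r X b ->
  (\int[mu]_(s in `]0%R, (2 * r)%R[) h s <= (1 / 72)%:E)%E ->
  forall x, 0 <= x <= X -> a x = b x.
Proof.
move=> fd co X0 Xr ga gb hs.
have cont c : graph P Q r X c -> forall x, 0 <= x <= X -> {for x, continuous c}.
  by move=> [_ _ dc] x /dc; exact: is_derive1_continuous.
have cg : {within `[0, X], continuous (fun x => `|b x - a x|)}.
  apply: continuous_in_subspaceT => x; rewrite inE/= in_itv/= => xX.
  apply: (@continuous_comp _ _ _ (fun x => b x - a x) (fun y : R => `|y|)); last exact: norm_continuous.
  by apply: cvgB; exact: cont.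
have [y yX hy] := EVT_max X0 cg; rewrite in_itv/= in yX.
have hL x : 0 <= x <= y -> `|b x - a x| <= `|b y - a y|.
  by move=> xy; apply: hy; rewrite in_itv/=; lra.
have [a0 _ _] := ga; have [b0 _ _] := gb.
have /andP[y0 yX'] := yX.
have yr : y < r by lra.
have ga' := graph_sub yX' ga; have gb' := graph_sub yX' gb.
have zy : `|b y - a y| <= 0.
  have [y00|y00] := eqVneq y 0; first by rewrite y00 a0 b0 subrr normr0.
  have {}y0 : 0 < y by rewrite lt_neqAle eq_sym y00.
  have [ab|/ltW ab] := leP (a y) (b y).
    rewrite ger0_norm ?subr_ge0// in hL *.
    exact: (gap_zero fd co y0 yr ga' gb' hs hL).
  rewrite distrC ger0_norm ?subr_ge0//; apply: (gap_zero fd co y0 yr gb' ga' hs) => x xy.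
  by have := hL x xy; rewrite distrC [`|b y - a y|]distrC [`|a y - b y|]ger0_norm ?subr_ge0.
move=> x xX; have : `|b x - a x| <= 0 by apply: le_trans zy; apply: hy; rewrite in_itv.
by rewrite normr_le0 subr_eq0 => /eqP.
Qed.
End graphs_agree.

(** * From graphs back to parametrised curves *)

Section curves.
Context {R : realType}.
Local Notation mu := (@lebesgue_measure R).
Implicit Types (P Q f : R * R -> R) (u w : R -> R -> R) (c e : R -> R * R) (I J : set R).

Lemma curve_mono P Q (r m : R) I c (s t : R) : cone P Q r m ->
  integral_curve (fun q => (P q, Q q)) (square 0 r) 0 I c ->
  I s -> I t -> s < t -> (c s).1 < (c t).1.
Proof.
move=> [_ co] [oI iI I0 c0 Ic] Is It st.
have dc x : s <= x <= t -> is_derive x 1 (fun x => (c x).1) (P (c x)).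
  by move=> xx; exact: (is_derive1_fst (proj2 (Ic x (iI s t Is It x xx)))).
have [x||x xx E] := @MVT_segment _ (fun x => (c x).1) (fun x => P (c x)) s t (ltW st).
- by rewrite in_itv/= => xx; apply: dc; lra.
- apply: continuous_in_subspaceT => z; rewrite inE/= in_itv/= => /dc.
  exact: is_derive1_continuous.
move: xx; rewrite in_itv/= => xx.
have [sqx _] := Ic x (iI s t Is It x xx).
have [x1 x2] := sqx; rewrite /= !subr0 in x1 x2.
have [P2 _ _ _ _] := co _ x1 x2.
have : 0 < P (c x) * (t - s) by rewrite mulr_gt0//; lra.
by rewrite -E subr_gt0.
Qed.

(** As P > 0, the abscissa increases strictly with time. [g] is the inverse, giving time in terms of
    the abscissa, and [a] is the ordinate at that time; [g] is kept so that the parametrisation can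
    be recovered. *)
Lemma curve_graph P Q (r m : R) I c : cone P Q r m ->
  integral_curve (fun q => (P q, Q q)) (square 0 r) 0 I c ->
  exists g a : R -> R,
  [/\ forall s, I s -> g (c s).1 = s,
      forall s, I s -> is_derive (c s).1 1 g (P (c s))^-1,
      forall s, I s -> a (c s).1 = (c s).2,
      forall t x, I t -> 0 <= t -> 0 <= x <= (c t).1 -> exists s, [/\ I s, 0 <= s <= t & (c s).1 = x] &
      forall t, I t -> 0 <= t -> graph P Q r (c t).1 a].
Proof.
move=> co ic; have [oI iI I0 c0 Ic] := ic.
pose g (x : R) : R := xget 0 [set s | I s /\ (c s).1 = x].
have gK s : I s -> g (c s).1 = s.
  move=> Is; rewrite /g; case: xgetP => [z _ [Iz zs]|/(_ s)/not_andP[]//].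
  apply/eqP; rewrite eq_le !leNgt; apply/andP; split; apply/negP => lt.
    by have := curve_mono co ic Is Iz lt; rewrite zs ltxx.
  by have := curve_mono co ic Iz Is lt; rewrite zs ltxx.
have d1 s : I s -> is_derive s 1 (fun x => (c x).1) (P (c s)).
  by move=> /Ic[_] /is_derive1_fst.
have d2 s : I s -> is_derive s 1 (fun x => (c x).2) (Q (c s)).
  by move=> /Ic[_] /is_derive1_snd.
have P0 s : I s -> 0 < P (c s).
  move=> /Ic[[x1 x2] _]; rewrite /= !subr0 in x1 x2.
  by have [P2 _ _ _ _] := (proj2 co) _ x1 x2; lra.
have dg s : I s -> is_derive (c s).1 1 g (P (c s))^-1.
  move=> Is; apply: (@is_derive_inverse _ (fun x => (c x).1) g (P (c s)) s).
  - by near=> x; apply: gK; near: x; exact: oI.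
  - by near=> x; apply: is_derive1_continuous (d1 x _); near: x; exact: oI.
  - exact: d1.
  - by rewrite gt_eqF// P0.
pose a (x : R) : R := (c (g x)).2.
have aE s : I s -> a (c s).1 = (c s).2 by move=> Is; rewrite /a gK.
have da s : I s -> is_derive (c s).1 1 a (Q (c s) / P (c s)).
  move=> Is; have := d2 s Is; rewrite -{1}(gK s Is) => d2'.
  exact: (is_derive1_comp d2' (dg s Is)).
have sur t x : I t -> 0 <= t -> 0 <= x <= (c t).1 -> exists s, [/\ I s, 0 <= s <= t & (c s).1 = x].
  move=> It t0 xx.
  have cc : {within `[0, t], continuous (fun x => (c x).1)}.
    apply: continuous_in_subspaceT => z; rewrite inE/= in_itv/= => zz.
    exact: is_derive1_continuous (d1 z (iI 0 t I0 It z zz)).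
  have [|s] := @IVT _ _ _ _ x t0 cc.
    by rewrite c0 /= ge_min le_max; move: xx => /andP[-> ->]; rewrite orbT.
  by rewrite in_itv/= => st <-; exists s; split => //; exact: iI I0 It _ st.
exists g, a; split => // t It t0.
split.
- by have := aE 0 I0; rewrite c0.
- by move=> x xx; have [s [Is _ <-]] := sur t x It t0 xx; rewrite aE//; have [[_]] := Ic s Is; rewrite /= subr0.
- move=> x xx; have [s [Is _ <-]] := sur t x It t0 xx.
  by rewrite aE// -surjective_pairing; exact: da.
Unshelve. all: by end_near. Qed.

(** By symmetry [c] may be taken to be the curve with the smaller abscissa at time [t], so that both
    graphs are defined up to it. Once the graphs coincide, the two inverse time functions have the
    same derivative 1 / P and both vanish at 0, so the parametrisations coincide too. *)
Lemma forward_agree P Q u w f h (r m : R) I J c e : flux_data P Q u w f h r -> cone P Q r m ->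
  (\int[mu]_(s in `]0%R, (2 * r)%R[) h s <= (1 / 72)%:E)%E ->
  integral_curve (fun q => (P q, Q q)) (square 0 r) 0 I c ->
  integral_curve (fun q => (P q, Q q)) (square 0 r) 0 J e ->
  forall t, 0 <= t -> I t -> J t -> c t = e t.
Proof.
move=> fd co hs.
wlog suff main : I J c e / forall t : R, 0 <= t -> I t -> J t -> (c t).1 <= (e t).1 ->
    integral_curve (fun q => (P q, Q q)) (square 0 r) 0 I c ->
    integral_curve (fun q => (P q, Q q)) (square 0 r) 0 J e -> c t = e t.
  move=> ic ie t t0 It Jt; have [ce|/ltW ce] := leP (c t).1 (e t).1.
    exact: (main I J c e t t0 It Jt ce ic ie).
  by apply/esym; exact: (main J I e c t t0 Jt It ce ie ic).
move=> t t0 It Jt ce ic ie; have [oI iI I0 c0 Ic] := ic; have [oJ iJ J0 e0 Je] := ie.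
have [g [a [gK dg aE surc ga]]] := curve_graph co ic.
have [k [b [kK dk bE sure gb]]] := curve_graph co ie.
pose X := (c t).1.
have X0 : 0 <= X.
  have [t00|t00] := eqVneq t 0; first by rewrite /X t00 c0.
  have tp : 0 < t by rewrite lt_neqAle eq_sym t00.
  by have := curve_mono co ic I0 It tp; rewrite c0 => /ltW.
have Xr : X < r.
  by have [[+ _] _] := Ic t It; rewrite /= subr0 => h1; exact: le_lt_trans (ler_norm _) h1.
have ab := graphs_agree fd co X0 Xr (ga t It t0) (graph_sub ce (gb t Jt t0)) hs.
have xe x : 0 <= x <= X -> 0 <= x <= (e t).1 by rewrite /X; lra.
have dd x : 0 <= x <= X -> is_derive x 1 (fun x => g x - k x) 0.
  move=> xX; have [s [Is _ sx]] := surc t x It t0 xX.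
  have [s' [Js' _ sx']] := sure t x Jt t0 (xe x xX).
  have d1 := dg s Is; have d2 := dk s' Js'; rewrite sx in d1; rewrite sx' in d2.
  (* At a common abscissa the curves are at the same point, though a priori at different times. *)
  have E : c s = e s'.
    apply: injective_projections; first by rewrite sx sx'.
    by rewrite -aE// -bE// sx sx' ab.
  rewrite -E in d2; have := is_deriveB d1 d2; rewrite subrr; exact.
have [x||x xx] := @MVT_segment _ (fun x => g x - k x) (fun=> 0) 0 X X0.
- by rewrite in_itv/= => xx; apply: dd; lra.
- apply: continuous_in_subspaceT => z; rewrite inE/= in_itv/= => /dd.
  exact: is_derive1_continuous.
have g0 : g 0 = 0 by have := gK 0 I0; rewrite c0.
have k0 : k 0 = 0 by have := kK 0 J0; rewrite e0.
rewrite g0 k0 mul0r !subr0 /X gK// => /eqP; rewrite subr_eq0 => /eqP tk.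
have [s [Js _ sX]] := sure t X Jt t0 (xe X ltac:(rewrite lexx X0//)).
have st : s = t by rewrite -(kK s Js) sX.
rewrite st in sX; apply: injective_projections; first by rewrite sX.
by rewrite -aE// -bE// sX ab// lexx X0.
Qed.
End curves.

(** * Translations, point reflections and the exchange of coordinates *)

Section transforms.
Context {R : realType}.
Local Notation mu := (@lebesgue_measure R).
Local Notation mu2 := (@lebesgue_measure R \x @lebesgue_measure R)%E.
Implicit Types (P Q f : R * R -> R) (u w : R -> R -> R) (p q : R * R).

(** Used with s = 1 to move [p] to the origin, and with s = -1 to add a point reflection, which
    turns backward times into forward ones. *)
Definition affine (s : R) p q : R * R := (s * q.1 + p.1, s * q.2 + p.2).

Lemma measurable_affine2 (s : R) p : measurable_fun setT (affine s p).
Proof.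
apply: measurable_fun_pair; apply: measurable_funD => //; apply: measurable_funM => //.
Qed.

Lemma measurable_swap : measurable_fun setT (@swap R).
Proof. by apply: measurable_fun_pair; [exact: measurable_snd|exact: measurable_fst]. Qed.

Definition preserves_mu2 (phi : R * R -> R * R) := measurable_fun setT phi /\
  forall F : R * R -> R, measurable_fun setT F -> (forall q, 0 <= F q) ->
  (\int[mu2]_q (F q)%:E = \int[mu2]_q (F (phi q))%:E)%E.

Lemma affine_preserves (s : R) p : `|s| = 1 -> preserves_mu2 (affine s p).
Proof.
move=> s1; split; first exact: measurable_affine2.
move=> F mF F0.
have s0 : s != 0 by rewrite -normr_gt0 s1.
pose F1 (q : R * R) : R := F (q.1, s * q.2 + p.2).
have mF1 : measurable_fun setT F1.
  apply: (measurableT_comp mF); apply: measurable_fun_pair; first exact: measurable_fst.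
  by apply: measurable_funD => //; apply: measurable_funM => //; exact: measurable_snd.
rewrite fubini_tonelli1; last 2 first.
- exact/measurable_EFinP.
- by move=> z; rewrite lee_fin.
rewrite fubini_tonelli2; last 2 first.
- by apply/measurable_EFinP; exact: (measurableT_comp mF (measurable_affine2 s p)).
- by move=> z; rewrite lee_fin.
transitivity (\int[mu]_x \int[mu]_y (F1 (x, y))%:E)%E.
  apply: eq_integral => x _; rewrite /fubini_F /F1 /=.
  rewrite (@ge0_integral_affine _ s p.2)//; last exact: (measurableT_comp mF (measurable_pair1 _)).
  by apply: eq_integral => y _; rewrite s1 mul1r.
rewrite (@fubini_tonelli _ _ _ _ _ mu mu (fun z => (F1 z)%:E)); last 2 first.
- exact/measurable_EFinP.
- by move=> z; rewrite lee_fin /F1 F0.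
apply: eq_integral => y _; rewrite /fubini_G /F1 /=.
rewrite (@ge0_integral_affine _ s p.1 (fun x => F (x, s * y + p.2)))//; last first.
  exact: (measurableT_comp mF (measurable_pair2 _)).
by apply: eq_integral => x _; rewrite s1 mul1r.
Qed.

Lemma swap_preserves : preserves_mu2 (@swap R).
Proof.
split; first exact: measurable_swap.
move=> F mF F0; rewrite fubini_tonelli1; last 2 first.
- exact/measurable_EFinP.
- by move=> z; rewrite lee_fin.
rewrite fubini_tonelli2//.
- by apply/measurable_EFinP; exact: (measurableT_comp mF measurable_swap).
- by move=> z; rewrite lee_fin.
Qed.

Lemma preserves_mass (phi : R * R -> R * R) f (A : set (R * R)) : preserves_mu2 phi ->
  measurable_fun setT f -> (forall q, 0 <= f q) -> measurable A ->
  mass f A = mass (f \o phi) (phi @^-1` A).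
Proof.
move=> [mp pp] mf f0 mA; rewrite /mass; congr fine.
rewrite integral_mkcond [RHS]integral_mkcond.
have E : (fun q => ((f q * \1_A q)%:E : \bar R)) = ((fun q => (f q)%:E) \_ A).
  apply/funext => q; rewrite patchE indicE.
  by case: ifP; rewrite ?mulr1 ?mulr0.
rewrite -E pp.
- apply: eq_integral => q _; rewrite patchE indicE /=.
  have -> : (q \in phi @^-1` A) = (phi q \in A) by apply/idP/idP; rewrite !inE.
  by case: ifP; rewrite ?mulr1 ?mulr0.
- by apply: measurable_funM => //; exact: measurable_indic.
- by move=> q; rewrite mulr_ge0// indicE.
Qed.

Lemma preserves_integrable (phi : R * R -> R * R) f : preserves_mu2 phi ->
  measurable_fun setT f -> (forall q, 0 <= f q) ->
  mu2.-integrable setT (EFin \o f) -> mu2.-integrable setT (EFin \o (f \o phi)).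
Proof.
move=> [mp pp] mf f0 /integrableP[_ fi]; apply/integrableP; split.
  by apply/measurable_EFinP; exact: measurableT_comp.
move: fi; under eq_integral do rewrite /= ger0_norm//.
rewrite pp//; under [X in _ -> (X < _)%E]eq_integral do rewrite /= ger0_norm//.
by [].
Qed.

Definition flux_data_at p P Q u w f (h : R -> \bar R) (r : R) :=
  [/\ forall x y : R, `|x - p.1| < r -> `|y - p.2| < r ->
        is_derive y 1 (u x) (P (x, y)) /\ is_derive x 1 (fun x => w x y) (Q (x, y)),
      forall x1 x2 y1 y2 : R, p.1 - r < x1 -> x1 < x2 -> x2 < p.1 + r ->
        p.2 - r < y1 -> y1 < y2 -> y2 < p.2 + r ->
        `|mixed_diff u x1 x2 y1 y2 + mixed_diff w x1 x2 y1 y2| <= mass f (open_rect x1 x2 y1 y2),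
      measurable_fun setT f /\ forall q, 0 <= f q,
      mu2.-integrable setT (EFin \o f) &
      forall q, ((f q)%:E <= h (Defs.edist p q))%E].

Lemma is_derive1_affine (g : R -> R) (s d x l : R) : is_derive (s * x + d) 1 g l ->
  is_derive x 1 (fun y => g (s * y + d)) (s * l).
Proof.
move=> dg; rewrite mulrC.
apply: (@is_derive1_comp _ g (fun y => s * y + d)) => //.
by apply: is_derive_eq; rewrite /GRing.scale/= mulr1 addr0.
Qed.

Lemma measurable_open_rect (x1 x2 y1 y2 : R) : measurable (open_rect x1 x2 y1 y2).
Proof. by apply: measurableX; exact: measurable_itv. Qed.

(** The factor [s] in front of the potentials cancels the one from the chain rule, so they are
    potentials of [P] and [Q] composed with the map, without a change of sign. *)
Lemma flux_data_affine (s : R) p P Q u w f h (r : R) : s = 1 \/ s = -1 ->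
  flux_data_at p P Q u w f h r ->
  flux_data (P \o affine s p) (Q \o affine s p)
    (fun x y => s * u (s * x + p.1) (s * y + p.2))
    (fun x y => s * w (s * x + p.1) (s * y + p.2)) (f \o affine s p) h r.
Proof.
move=> s1 [du rf [mf f0] fi fh].
have ns : `|s| = 1 by case: s1 => ->; rewrite ?normrN normr1.
have ss : s * s = 1 by case: s1 => ->; ring.
have ph := affine_preserves p ns.
split.
- move=> x y xr yr.
  have [|| d1 d2] := du (s * x + p.1) (s * y + p.2); rewrite ?addrK ?normrM ?ns ?mul1r//.
  split.
    have := is_deriveZ s (is_derive1_affine d1); rewrite !scale_realE mulrA ss mul1r; exact.
  have := is_deriveZ s (@is_derive1_affine (fun x => w x (s * y + p.2)) s p.1 x _ d2).
  by rewrite !scale_realE mulrA ss mul1r; exact.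
- move=> x1 x2 y1 y2 h1 h2 h3 h4 h5 h6.
  case: s1 => sE; subst s.
    have := rf (x1 + p.1) (x2 + p.1) (y1 + p.2) (y2 + p.2) ltac:(qlra) ltac:(qlra) ltac:(qlra) ltac:(qlra) ltac:(qlra) ltac:(qlra).
    rewrite (preserves_mass ph mf f0 (measurable_open_rect _ _ _ _)).
    have -> : affine 1 p @^-1` open_rect (x1 + p.1) (x2 + p.1) (y1 + p.2) (y2 + p.2) =
        open_rect x1 x2 y1 y2.
      by apply/seteqP; split => q [/=]; rewrite !in_itv/= => a b; split; rewrite /= in_itv/=; qlra.
    by rewrite /mixed_diff !mul1r.
  have := rf (- x2 + p.1) (- x1 + p.1) (- y2 + p.2) (- y1 + p.2) ltac:(qlra) ltac:(qlra) ltac:(qlra) ltac:(qlra) ltac:(qlra) ltac:(qlra).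
  rewrite (preserves_mass ph mf f0 (measurable_open_rect _ _ _ _)).
  have -> : affine (-1) p @^-1` open_rect (- x2 + p.1) (- x1 + p.1) (- y2 + p.2) (- y1 + p.2) =
      open_rect x1 x2 y1 y2.
    by apply/seteqP; split => q [/=]; rewrite !in_itv/= => a b; split; rewrite /= in_itv/=; qlra.
  rewrite /mixed_diff !mulN1r -normrN; congr (`|_| <= _); ring.
- split; first exact: (measurableT_comp mf (proj1 ph)).
  by move=> q; exact: f0.
- exact: preserves_integrable.
- move=> q; have := fh (affine s p q); rewrite /Defs.edist /affine /= !addrK /rad.
  by rewrite !exprMn -mulrDr (expr2 s) ss mul1r.
Qed.

Lemma flux_data_opp p P Q u w f h (r : R) : flux_data_at p P Q u w f h r ->
  flux_data_at p (fun q => - P q) (fun q => - Q q) (fun x y => - u x y) (fun x y => - w x y) f h r.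
Proof.
move=> [du rf fp fi fh]; split => //.
  move=> x y xr yr; have [d1 d2] := du x y xr yr; split; first exact: (is_deriveN d1).
  exact: (is_deriveN d2).
move=> x1 x2 y1 y2 h1 h2 h3 h4 h5 h6.
have := rf x1 x2 y1 y2 h1 h2 h3 h4 h5 h6; rewrite /mixed_diff -normrN.
by congr (`|_| <= _); ring.
Qed.

Lemma flux_data_swap p P Q u w f h (r : R) : flux_data_at p P Q u w f h r ->
  flux_data_at (swap p) (Q \o swap) (P \o swap) (fun x y => w y x) (fun x y => u y x)
    (f \o swap) h r.
Proof.
move=> [du rf [mf f0] fi fh]; have ph := swap_preserves; split.
- by move=> x y xr yr; have [d1 d2] := du y x yr xr; split.
- move=> x1 x2 y1 y2 h1 h2 h3 h4 h5 h6.
  have := rf y1 y2 x1 x2 h4 h5 h6 h1 h2 h3.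
  rewrite (preserves_mass ph mf f0 (measurable_open_rect _ _ _ _)).
  have -> : swap @^-1` open_rect y1 y2 x1 x2 = open_rect x1 x2 y1 y2.
    by apply/seteqP; split => q [].
  by rewrite /mixed_diff; congr (`|_| <= _); ring.
- split; first exact: (measurableT_comp mf measurable_swap).
  by move=> q; exact: f0.
- exact: preserves_integrable.
- by move=> q; have := fh (swap q); rewrite /Defs.edist /= addrC.
Qed.
End transforms.

(** * Uniqueness of seed curves *)

Section seed_uniqueness.
Context {R : realType}.
Local Notation mu := (@lebesgue_measure R).
Local Notation mu2 := (@lebesgue_measure R \x @lebesgue_measure R)%E.
Implicit Types (P Q f : R * R -> R) (u w : R -> R -> R) (p q : R * R) (c e : R -> R * R) (I J : set R).

Definition cone_at p P Q (r m : R) := `|m| <= 1 /\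
  forall q, square p r q ->
    [/\ 1 / 2 <= P q, P q <= 1, `|Q q - m * P q| <= P q / 16,
        {for q, continuous P} & {for q, continuous Q}].

Lemma continuous_affine (s : R) p : continuous (affine s p).
Proof.
move=> q.
have h1 : {for q, continuous (fun q : R * R => s * q.1 + p.1)}.
  by apply: cvgD; [apply: cvgMr; exact: cvg_fst|exact: cvg_cst].
have h2 : {for q, continuous (fun q : R * R => s * q.2 + p.2)}.
  by apply: cvgD; [apply: cvgMr; exact: cvg_snd|exact: cvg_cst].
exact: (cvg_pair h1 h2).
Qed.

Lemma cone_affine (s : R) p P Q (r m : R) : `|s| = 1 -> cone_at p P Q r m ->
  cone (P \o affine s p) (Q \o affine s p) r m.
Proof.
move=> s1 [m1 co]; split => // q q1 q2.
have sq : square p r (affine s p q).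
  by split; rewrite /= addrK normrM s1 mul1r.
have [h1 h2 h3 cP cQ] := co _ sq; split => //.
  by apply: (@continuous_comp _ _ _ (affine s p) P) => //; exact: continuous_affine.
by apply: (@continuous_comp _ _ _ (affine s p) Q) => //; exact: continuous_affine.
Qed.

(** Reflecting both space and time leaves the velocity unchanged, so the new curve follows the field
    read at the image point, without a sign. *)
Lemma curve_affine (s : R) p P Q (r : R) I c : s = 1 \/ s = -1 ->
  integral_curve (fun q => (P q, Q q)) (square p r) p I c ->
  integral_curve (fun q => (P (affine s p q), Q (affine s p q))) (square 0 r) 0
    [set t | I (s * t)] (fun t => s *: (c (s * t) - p)).
Proof.
move=> s1 [oI iI I0 c0 Ic].
have ns : `|s| = 1 by case: s1 => ->; rewrite ?normrN normr1.
have ss : s * s = 1 by case: s1 => ->; ring.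
have aE t : affine s p (s *: (c (s * t) - p)) = c (s * t).
  by apply: injective_projections; rewrite /affine /= scale_realE mulrA ss mul1r subrK.
split.
- apply: (@open_comp _ _ (fun t => s * t) I) => // t _.
  by apply: cvgMr; exact: cvg_id.
- move=> a b /= Ia Ib x xab; case: s1 => sE; subst s.
    by rewrite !mul1r in Ia Ib *; exact: iI Ia Ib _ xab.
  by rewrite !mulN1r in Ia Ib *; apply: (iI _ _ Ib Ia); lra.
- by rewrite /= mulr0.
- by rewrite mulr0 c0 subrr scaler0.
- move=> t /= It; rewrite aE; have [[h1 h2] dc] := Ic _ It; split.
    by split; rewrite /= scale_realE subr0 normrM ns mul1r.
  apply/is_derive1P => e e0.
  have [d d0 Hd] := (proj1 (is_derive1P c (s * t) _) dc) e e0; exists d => // x xd.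
  have xd' : `|s * x - s * t| < d by rewrite -mulrBr normrM ns mul1r.
  have := Hd _ xd'; rewrite -mulrBr normrM ns mul1r.
  rewrite -scalerBr opprB addrA subrK -(scalerA s).
  have -> : s *: (c (s * x) - c (s * t)) - (x - t) *: (P (c (s * t)), Q (c (s * t))) =
    s *: (c (s * x) - c (s * t) - s *: ((x - t) *: (P (c (s * t)), Q (c (s * t))))).
    by rewrite [RHS]scalerBr !scalerA ss mul1r.
  by rewrite normrZ ns mul1r.
Qed.

(** Nonnegative times are settled by translating [p] to the origin, negative ones by the point
    reflection. *)
Lemma agree_cone p P Q u w f h (r m : R) I J c e : flux_data_at p P Q u w f h r ->
  cone_at p P Q r m -> (\int[mu]_(s in `]0%R, (2 * r)%R[) h s <= (1 / 72)%:E)%E ->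
  integral_curve (fun q => (P q, Q q)) (square p r) p I c ->
  integral_curve (fun q => (P q, Q q)) (square p r) p J e ->
  forall t, I t -> J t -> c t = e t.
Proof.
move=> fd co hs ic ie t It Jt.
have main (s : R) : s = 1 \/ s = -1 -> 0 <= s * t -> c t = e t.
  move=> s1 st.
  have ns : `|s| = 1 by case: s1 => ->; rewrite ?normrN normr1.
  have ss : s * (s * t) = t by rewrite mulrA; case: s1 => ->; ring.
  have s0 : s != 0 by rewrite -normr_gt0 ns.
  have := forward_agree (flux_data_affine s1 fd) (cone_affine ns co) hs
    (curve_affine s1 ic) (curve_affine s1 ie) st.
  rewrite /= ss => /(_ It Jt) /(scalerI s0) E.
  by rewrite -[c t](subrK p) E subrK.
have [t0|/ltW t0] := leP 0 t; first by apply: (main 1); [left|rewrite mul1r].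
by apply: (main (-1)); [right|rewrite mulN1r oppr_ge0].
Qed.

Definition close_at p P Q (r : R) := forall q, square p r q ->
  [/\ `|P q - P p| <= 1 / 64, `|Q q - Q p| <= 1 / 64,
      {for q, continuous P} & {for q, continuous Q}].

(** From |Q p| <= P p and P^2 + Q^2 = 1 comes P p >= 7/10, hence P >= 1/2 on the square. With m = Q
    p / P p, the oscillation 1/64 gives |Q - m P| <= 1/32 <= P / 16, as [cone_at] asks. *)
Lemma agree_pos p P Q u w f h (r : R) I J c e : flux_data_at p P Q u w f h r ->
  close_at p P Q r -> (forall q, P q ^+ 2 + Q q ^+ 2 = 1) -> `|Q p| <= P p ->
  (\int[mu]_(s in `]0%R, (2 * r)%R[) h s <= (1 / 72)%:E)%E ->
  integral_curve (fun q => (P q, Q q)) (square p r) p I c ->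
  integral_curve (fun q => (P q, Q q)) (square p r) p J e ->
  forall t, I t -> J t -> c t = e t.
Proof.
move=> fd cl PQ1 QP.
have P0 : 0 <= P p by exact: le_trans (normr_ge0 _) QP.
have P7 : 7 / 10 <= P p.
  have : Q p ^+ 2 <= P p ^+ 2 by rewrite -real_normK ?num_real// ler_sqr ?nnegrE.
  have := PQ1 p; rewrite leNgt => h1 h2; apply/negP => h3.
  have : P p ^+ 2 < (7 / 10) ^+ 2 by rewrite ltr_sqr ?nnegrE//; lra.
  by lra.
have P1 q : P q <= 1.
  rewrite -[leRHS]/(1 : R); apply: le_trans (ler_norm _) _.
  rewrite -ler_sqr ?nnegrE// expr1n real_normK ?num_real//.
  by have := PQ1 q; have := sqr_ge0 (Q q); lra.
have Pp : 0 < P p by lra.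
pose m : R := Q p / P p.
have mP : m * P p = Q p by rewrite /m divfK// gt_eqF.
have m1 : `|m| <= 1 by rewrite /m normrM normfV (ger0_norm P0) ler_pdivrMr// mul1r.
apply: (agree_cone (m := m) fd); split => // q /cl[hP hQ cP cQ].
have P2 : 1 / 2 <= P q by move: hP; rewrite ler_norml; lra.
split => //.
have -> : Q q - m * P q = (Q q - Q p) - m * (P q - P p) by rewrite mulrBr mP; ring.
apply: le_trans (ler_normB _ _) _; rewrite normrM.
have : `|m| * `|P q - P p| <= 1 * (1 / 64) by rewrite ler_pM.
by lra.
Qed.

Lemma curve_opp P Q W p I c : integral_curve (fun q => (P q, Q q)) W p I c ->
  integral_curve (fun q => (- P q, - Q q)) W p [set t | I (- t)] (fun t => c (- t)).
Proof.
move=> [oI iI I0 c0 Ic]; split.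
- by apply: (@open_comp _ _ (fun t : R => - t) I) => // t _; exact: opp_continuous.
- by move=> a b /= Ia Ib x xab; apply: (iI _ _ Ib Ia); lra.
- by rewrite /= oppr0.
- by rewrite oppr0.
- move=> t /= It; have [Wc dc] := Ic _ It; split => //.
  by have := is_derive1_opp dc; rewrite opprK.
Qed.

(** A field pointing to the left at [p] is reversed together with time. *)
Lemma agree_horizontal p P Q u w f h (r : R) I J c e : flux_data_at p P Q u w f h r ->
  close_at p P Q r -> (forall q, P q ^+ 2 + Q q ^+ 2 = 1) -> `|Q p| <= `|P p| ->
  (\int[mu]_(s in `]0%R, (2 * r)%R[) h s <= (1 / 72)%:E)%E ->
  integral_curve (fun q => (P q, Q q)) (square p r) p I c ->
  integral_curve (fun q => (P q, Q q)) (square p r) p J e ->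
  forall t, I t -> J t -> c t = e t.
Proof.
move=> fd cl PQ1 QP hs ic ie t It Jt.
have [P0|P0] := leP 0 (P p).
  by rewrite (ger0_norm P0) in QP; exact: (agree_pos fd cl PQ1 QP hs ic ie).
rewrite (ltr0_norm P0) -normrN in QP.
have cl' : close_at p (fun q => - P q) (fun q => - Q q) r.
  move=> q /cl[hP hQ cP cQ]; split.
  - by rewrite -normrN opprB opprK addrC.
  - by rewrite -normrN opprB opprK addrC.
  - exact: cvgN.
  - exact: cvgN.
have PQ1' q : (- P q) ^+ 2 + (- Q q) ^+ 2 = 1 by rewrite !sqrrN.
have := agree_pos (flux_data_opp fd) cl' PQ1' QP hs (curve_opp ic) (curve_opp ie).
by move=> /(_ (- t)); rewrite /= opprK; exact.
Qed.

Lemma curve_swap p P Q (r : R) I c : integral_curve (fun q => (P q, Q q)) (square p r) p I c ->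
  integral_curve (fun q => ((Q \o swap) q, (P \o swap) q)) (square (swap p) r) (swap p) I (swap \o c).
Proof.
move=> [oI iI I0 c0 Ic]; split => //; first by rewrite /= c0.
move=> t /Ic[[h1 h2] dc]; split => //.
by have := is_derive1_swap dc; rewrite /= /swap /= -surjective_pairing.
Qed.

(** When the field at [p] is closer to the vertical, the coordinates are exchanged. *)
Lemma agree_seed p P Q u w f h (r : R) I J c e : flux_data_at p P Q u w f h r ->
  close_at p P Q r -> (forall q, P q ^+ 2 + Q q ^+ 2 = 1) ->
  (\int[mu]_(s in `]0%R, (2 * r)%R[) h s <= (1 / 72)%:E)%E ->
  integral_curve (fun q => (P q, Q q)) (square p r) p I c ->
  integral_curve (fun q => (P q, Q q)) (square p r) p J e ->
  forall t, I t -> J t -> c t = e t.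
Proof.
move=> fd cl PQ1 hs ic ie t It Jt.
have [QP|/ltW PQ] := leP `|Q p| `|P p|.
  exact: (agree_horizontal fd cl PQ1 QP hs ic ie).
have sK q : swap (swap q) = q by case: q.
have cl' : close_at (swap p) (Q \o swap) (P \o swap) r.
  move=> q [h1 h2]; have sq : square p r (swap q) by [].
  have [hP hQ cP cQ] := cl _ sq; rewrite /= sK; split => //.
    by apply: (@continuous_comp _ _ _ swap Q) => //; exact: continuous_swap.
  by apply: (@continuous_comp _ _ _ swap P) => //; exact: continuous_swap.
have PQ1' q : (Q \o swap) q ^+ 2 + (P \o swap) q ^+ 2 = 1 by rewrite addrC /= PQ1.
have PQ' : `|(P \o swap) (swap p)| <= `|(Q \o swap) (swap p)| by rewrite /= sK.
have := agree_horizontal (flux_data_swap fd) cl' PQ1' PQ' hs (curve_swap ic) (curve_swap ie) It Jt.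
by move=> /(congr1 swap); rewrite /= !sK.
Qed.

(** For r > 0 the circle has a point; over an empty set the supremum would be -oo. *)
Lemma circle_max_ge0 H p (r : R) : 0 < r -> (0 <= circle_max H p r)%E.
Proof.
move=> r0; pose q : R * R := (p.1 + r, p.2).
apply: (@le_trans _ _ `|H q|%:E); first by rewrite lee_fin.
apply: ereal_sup_ubound; exists q => //.
rewrite /circle /Defs.edist /=.
have -> : p.1 + r - p.1 = r by ring.
rewrite subrr expr0n addr0 sqrtr_sqr ger0_norm//; exact: ltW.
Qed.

Lemma le_lower_integral_itv (h : R -> \bar R) (r r' : R) : r <= r' ->
  (forall s, 0 < s -> (0 <= h s)%E) ->
  (\int[mu]_(s in `]0%R, r[) h s <= \int[mu]_(s in `]0%R, r'[) h s)%E.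
Proof.
move=> rr h0; rewrite integral_mkcond [leRHS]integral_mkcond.
have hp (z s : R) : (0 <= (h \_ `]0%R, z[) s)%E.
  by rewrite patchE; case: ifPn => //; rewrite inE/= in_itv/= => /andP[/h0].
apply: (@le_integral_off_null _ _ _ mu set0) => // s _; rewrite !patchE.
case: ifPn => sr; last by have := hp r' s; rewrite patchE.
by rewrite ifT//; move: sr; rewrite !inE/= !in_itv/=; lra.
Qed.

Theorem unique_seed W theta H p (r0 : R) : open W ->
  (forall q, W q -> {for q, continuous theta}) -> L1loc W H -> weak_solution W theta H ->
  W p -> 0 < r0 -> compactly_contained (disc p r0) W ->
  (\int[mu]_(r in `]0%R, r0[) circle_max H p r < +oo)%E ->
  exists r1 : R, 0 < r1 <= r0 /\ unique_integral_curve (Nfield theta) (disc p r1) p.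
Proof.
move=> oW ct lH ws Wp r00 cc hfin.
have DW : disc p r0 `<=` W by move=> q Dq; apply: (proj2 cc); exact: subset_closure.
have [f [[mf f0] fH fi fflux]] := weak_flux_density oW ct lH ws cc.
have h0 := circle_max_ge0 H p.
have e72 : (0 : R) < 1 / 72 by lra.
have [rho /andP[rho0 rhor] hrho] := lower_integral_small r00 e72 h0 hfin.
have cN q : W q -> {for q, continuous (N1 theta)} /\ {for q, continuous (N2 theta)}.
  by move=> /ct; exact: N_continuous.
have e64 : (0 : R) < 1 / 64 by lra.
have [cP cQ] := cN p Wp.
have /cvgrPdist_le/(_ _ e64)/nbhs_ballP[d1 /= d10 Hd1] := cP.
have /cvgrPdist_le/(_ _ e64)/nbhs_ballP[d2 /= d20 Hd2] := cQ.
(* [d1] and [d2] bound the oscillation of the field, [rho / 2] is there because the estimate uses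
   the integral over (0, 2 r), and [r0 / 4] puts the closed square inside the disc of radius
   [r0]. *)
pose r : R := Num.min (Num.min d1 d2) (Num.min (rho / 2) (r0 / 4)).
have [rd1 rd2 rrho rr0] : [/\ r <= d1, r <= d2, r <= rho / 2 & r <= r0 / 4].
  by rewrite /r; split; rewrite !ge_min lexx ?orbT.
have rp : 0 < r by rewrite /r !lt_min d10 d20 !divr_gt0.
have normD (q : R * R) : `|q.1 - p.1| <= r -> `|q.2 - p.2| <= r -> disc p r0 q.
  move=> q1 q2; apply: le_lt_trans (norm_ge_edist _ _) _.
  have : `|q - p| <= r by rewrite prod_normE ge_max /= q1 q2.
  by qlra.
have rD : rect (p.1 - r) (p.1 + r) (p.2 - r) (p.2 + r) `<=` disc p r0.
  by move=> q [/=]; rewrite !in_itv/= => a b; apply: normD; rewrite ler_norml; qlra.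
have [u [w [du dw uw]]] := flux_potentials rp cN (subset_trans rD DW).
have fd : flux_data_at p (N1 theta) (N2 theta) u w f (circle_max H p) r.
  split => //.
  - by move=> x y xr yr; split; [exact: du|exact: dw].
  - move=> x1 x2 y1 y2 a1 a2 a3 b1 b2 b3.
    rewrite -uw ?(ltW a2) ?(ltW b2)// -lee_fin massE//; last exact: measurable_open_rect.
    apply: fflux => //; apply: subset_trans rD => q [/=]; rewrite !in_itv/= => a b.
    by split; rewrite /= in_itv/=; qlra.
  - move=> q; apply: (@le_trans _ _ `|H q|%:E); first by rewrite lee_fin.
    by apply: ereal_sup_ubound; exists q.
have cl : close_at p (N1 theta) (N2 theta) r.
  move=> q [q1 q2].
  have bd (d : R) : r <= d -> ball p d q.
    by move=> rd; split; rewrite /ball/= distrC; qlra.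
  have Wq : W q by apply: DW; apply: normD; exact: ltW.
  have [c1 c2] := cN q Wq; split => //; rewrite distrC; [exact: Hd1 (bd _ rd1)|exact: Hd2 (bd _ rd2)].
have PQ1 q : N1 theta q ^+ 2 + N2 theta q ^+ 2 = 1 by rewrite /N1 /N2 cos2Dsin2.
have hs : (\int[mu]_(s in `]0%R, (2 * r)%R[) circle_max H p s <= (1 / 72)%:E)%E.
  by apply: le_trans hrho; apply: le_lower_integral_itv => //; qlra.
(* Uniqueness is proved in the square, which suits rectangles and graphs, and then restricted to the
   disc. *)
have sq : disc p r `<=` square p r.
  move=> q dq; have [h1 h2] := edist_le_norm p q.
  by split; [exact: le_lt_trans h1 dq|exact: le_lt_trans h2 dq].
exists r; split; first by rewrite rp /=; qlra.
apply: unique_integral_curve_glue.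
  apply: integral_curve_exists => // q.
    by have [h1 h2] := N_le1 theta q; apply: prod_norm_le1.
  move=> /sq[q1 q2]; have [|h1 h2] := cN q; last exact: (cvg_pair h1 h2).
  by apply: DW; apply: normD; exact: ltW.
move=> I c J e ic ie.
exact: (agree_seed fd cl PQ1 hs (integral_curve_sub sq ic) (integral_curve_sub sq ie)).
Qed.
End seed_uniqueness.

Theorem theoremB (R : realType) (Omega : set (R * R)) (hOmega : domain Omega) :
  (forall theta H : R * R -> R,
     {within Omega, continuous theta} ->
     L1loc Omega H ->
     weak_solution Omega theta H ->
     forall (p : R * R) (r0 : R),
       Omega p ->
       0 < r0 ->
       compactly_contained (disc p r0) Omega ->
       (\int[@lebesgue_measure R]_(r in `]0%R, r0[) circle_max H p r < +oo)%E ->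
       exists r1 : R, 0 < r1 <= r0 /\
         unique_integral_curve (Nfield theta) (disc p r1) p)
  /\
  (forall theta H : R * R -> R,
     {within Omega, continuous theta} ->
     [lipschitz H q | q in Omega] ->
     weak_solution Omega theta H ->
     forall p : R * R,
       Omega p ->
       exists r1 : R, [/\ 0 < r1, disc p r1 `<=` Omega &
         unique_integral_curve (Nperp theta) (disc p r1) p]).
Proof.
have [oO _ _] := hOmega.
have ct (theta : R * R -> R) : {within Omega, continuous theta} ->
    forall q, Omega q -> {for q, continuous theta}.
  by rewrite continuous_open_subspace// => cth q Oq; apply: cth; rewrite inE.
split.
  move=> theta H /ct cth lH ws p r0 Op r00 cc hfin.
  exact: (unique_seed oO cth lH ws Op r00 cc hfin).
move=> theta H /ct cth lH ws p Op.
exact: (unique_characteristic oO cth lH ws Op).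
Qed.
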